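(* There is an algorithm (IntegrateLnFoliation) which takes as input a rational function $f\in\mathbb{C}(x,y)$, without any a priori bound on orders or degrees, always terminates, and: if $\int f(x,\ln x)\,dx$ can be written in the form $$\sum_{p\in\mathbb{Z}^*,\,\lambda\in\mathbb{C}} a_{p,\lambda}\,\mathrm{Ei}(p\ln x+\lambda)+\sum_{p\in\mathbb{N}^*,\,r\in\mathbb{N},\,\lambda\in\mathbb{C}^*} b_{p,r,\lambda}(\ln x)^r\,\mathrm{Li}_p(\lambda x)+\sum_{\lambda\in\mathbb{C}}\lambda\ln\big(K_\lambda(x,\ln x)\big)+H(x,\ln x)$$ (finite sums, $a_{p,\lambda},b_{p,r,\lambda}\in\mathbb{C}$, $K_\lambda,H\in\mathbb{C}(x,y)$), it returns such an expression; otherwise it returns ''None''.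
   Context: $\mathrm{Ei}$ is the exponential integral, $\mathrm{Ei}'(z)=e^z/z$, and $\mathrm{Li}_p$ is the polylogarithm, $\mathrm{Li}_1(z)=-\ln(1-z)$, $z\,\mathrm{Li}_p'(z)=\mathrm{Li}_{p-1}(z)$. The integral is an antiderivative in $x$, defined up to an additive constant. Coefficients are assumed to lie in a field where exact arithmetic and absolute polynomial factorization are available. *)

(* Defs.v *)
From HB Require Import structures.
From mathcomp Require Import all_boot all_order all_algebra.
From mathcomp Require Import all_classical all_reals all_analysis.
From mathcomp Require Import complex.

Set Implicit Arguments.
Unset Strict Implicit.
Unset Printing Implicit Defensive.

Import Order.TTheory GRing.Theory Num.Theory.
Import numFieldNormedType.Exports.
Local Open Scope classical_set_scope.
Local Open Scope ring_scope.

(** * Complex functions *)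

(* [R[i]], typed as a [numClosedFieldType] so that the topology and the
   normed-module structure over itself are inferred: [is_derive z 1 f d] with
   [f : CC R -> CC R] is complex differentiability.  The order of [CC R] is the
   partial one: [z <= 0] says that z is real and nonpositive. *)
Definition CC (R : realType) : numClosedFieldType := R[i].

Section ComplexFunctions.
Variable R : realType.
Implicit Type z : CC R.

Definition Cexp z : CC R :=
  let: Complex a b := z in Complex (expR a * cos b) (expR a * sin b).

(* Principal argument, in ]-pi, pi] for z != 0. *)
Definition Carg z : R :=
  let: Complex a b := z in
  let t := acos (a / Num.sqrt (a ^+ 2 + b ^+ 2)) in
  if 0 <= b then t else - t.

Definition Cln z : CC R :=
  let: Complex a b := z in Complex (ln (Num.sqrt (a ^+ 2 + b ^+ 2))) (Carg z).

(* On the plane slit along ]-oo, 0] this determines Ei up to a constant. *)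
Definition is_Ei (Ei : CC R -> CC R) :=
  forall z, ~~ (z <= 0) -> is_derive z 1 Ei (Cexp z / z).

(* Principal branches, on the plane slit along [1, +oo[.  The values on the slit
   are left free, and so is [Li 0]. *)
Definition is_polylog (Li : nat -> CC R -> CC R) :=
  [/\ forall z, ~~ (1 <= z) -> Li 1%N z = - Cln (1 - z),
      forall p z, (0 < p)%N -> ~~ (1 <= z) ->
        derivable (Li p.+1) z 1 /\ z * 'D_1 (Li p.+1) z = Li p z
    & forall p, (0 < p)%N -> Li p 0 = 0].

End ComplexFunctions.

(** * Expressions *)

(* In [{poly {poly F}}] the inner variable is x and the outer one is y. *)
Definition eval2 (F : fieldType) (q : {poly {poly F}}) (x y : F) : F :=
  q.[y%:P].[x].

(* An element of F(x, y) is given by a quotient with nonzero denominator. *)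
Notation ratfun F := {ratio {poly {poly F}}}.

Definition evalr (F : fieldType) (f : ratfun F) (x y : F) : F :=
  eval2 (frac f).1 x y / eval2 (frac f).2 x y.

(* The three finite sums are lists of (index, coefficient) pairs.

   The coefficient a of an Ei term is kept as a pair (c, m) standing for
   c * exp m: every complex a is of this form (m = 0), and the form is needed
   to write answers down exactly, as in
   \int dx / (ln x + l) = exp (- l) * Ei (ln x + l),
   where exp (- l) is not algebraic over the coefficients of the integrand. *)
Record expression (F : fieldType) := Expression {
  ei_terms : seq ((int * F) * (F * F));     (* ((p, lambda), (c, m)) *)
  li_terms : seq ((nat * nat * F) * F);     (* ((p, r, lambda), b) *)
  ln_terms : seq (F * ratfun F);            (* (lambda, K_lambda) *)
  rat_part : ratfun F
}.

Definition wf_expression (F : fieldType) (e : expression F) : bool :=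
  [&& uniq [seq t.1 | t <- ei_terms e],
      all (fun t => t.1.1 != 0) (ei_terms e),
      uniq [seq t.1 | t <- li_terms e],
      all (fun t => (0 < t.1.1.1)%N && (t.1.2 != 0)) (li_terms e),
      uniq [seq t.1 | t <- ln_terms e]
    & all (fun t => (frac t.2).1 != 0) (ln_terms e)].

Section Meaning.
Variables (R : realType) (Ei : CC R -> CC R) (Li : nat -> CC R -> CC R).

Definition value (e : expression (CC R)) (x : CC R) : CC R :=
  \sum_(t <- ei_terms e)
     (t.2.1 * Cexp t.2.2) * Ei (t.1.1%:~R * Cln x + t.1.2)
  + \sum_(t <- li_terms e)
     t.2 * Cln x ^+ t.1.1.2 * Li t.1.1.1 (t.1.2 * x)
  + \sum_(t <- ln_terms e) t.1 * Cln (evalr t.2 x (Cln x))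
  + evalr (rat_part e) x (Cln x).

(* Equality of multivalued analytic functions is tested on a nonempty open set:
   by analytic continuation it then holds along every path, so neither the set
   nor the branch cuts and poles outside it matter. *)
Definition expresses_integral (e : expression (CC R)) (f : ratfun (CC R)) :=
  wf_expression e /\
  exists2 U : set (CC R), open U /\ U !=set0 &
    forall x, U x -> is_derive x 1 (value e) (evalr f x (Cln x)).

End Meaning.

(** * Algorithms *)

(* Programs are those of Jones's language WHILE on binary trees, whose leaves
   may in addition carry elements of a field.  Besides tree manipulation, they
   have exact field arithmetic, an equality test and a polynomial factorization
   oracle.  The only field constants are 0 and 1, so a program has finitely many
   symbols and contains no hidden data.  [Nil] plays the role of "false".
   Run over C on an input with coefficients in a subfield k, a program whose
   oracle stays over the algebraic closure of k only meets elements of that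
   closure: it is an actual algorithm as soon as these primitives are. *)
Inductive data (F : Type) :=
  | Nil
  | Atom of F
  | Cons of data F & data F.
Arguments Nil {F}.

Inductive prim :=
  | PId | PNil | PFst | PSnd
  | PZero | POne | PAdd | POpp | PMul | PInv | PEq
  | PFactor.

Inductive prog :=
  | Prim of prim
  | Pair of prog & prog
  | Comp of prog & prog         (* [Comp p q] runs q, then p *)
  | If of prog & prog & prog
  | While of prog & prog.

Section Semantics.
Variables (F : fieldType) (factor : data F -> data F).
Implicit Type d : data F.

Definition run_prim (o : prim) (d : data F) : data F :=
  match o, d with
  | PId, _ => d
  | PFst, Cons d1 _ => d1
  | PSnd, Cons _ d2 => d2
  | PZero, _ => Atom 0
  | POne, _ => Atom 1
  | PAdd, Cons (Atom a) (Atom b) => Atom (a + b)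
  | POpp, Atom a => Atom (- a)
  | PMul, Cons (Atom a) (Atom b) => Atom (a * b)
  | PInv, Atom a => Atom a^-1
  | PEq, Cons (Atom a) (Atom b) => if a == b then Cons Nil Nil else Nil
  | PFactor, _ => factor d
  | _, _ => Nil
  end.

(* [exec p d d'] : on input d, the program p halts and outputs d'. *)
Inductive exec : prog -> data F -> data F -> Prop :=
  | exec_prim o d : exec (Prim o) d (run_prim o d)
  | exec_pair p q d d1 d2 :
      exec p d d1 -> exec q d d2 -> exec (Pair p q) d (Cons d1 d2)
  | exec_comp p q d d1 d2 :
      exec q d d1 -> exec p d1 d2 -> exec (Comp p q) d d2
  | exec_if_true b p q d v d1 :
      exec b d v -> v <> Nil -> exec p d d1 -> exec (If b p q) d d1
  | exec_if_false b p q d d1 :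
      exec b d Nil -> exec q d d1 -> exec (If b p q) d d1
  | exec_while_true b p d v d1 d2 :
      exec b d v -> v <> Nil -> exec p d d1 -> exec (While b p) d1 d2 ->
      exec (While b p) d d2
  | exec_while_false b p d :
      exec b d Nil -> exec (While b p) d d.

Lemma exec_det p d d1 d2 : exec p d d1 -> exec p d d2 -> d1 = d2.
Proof.
have absurd_Nil b v d' (P : Prop) :
    (forall d3, exec b d' d3 -> v = d3) -> v <> Nil -> exec b d' Nil -> P.
  by move=> E vN /E.
move=> e1; elim: e1 d2 => {p d d1}.
- by move=> o d d2 e2; inversion e2.
- move=> p q d d1 d2 _ IHp _ IHq d3 e2; inversion e2; subst.
  by congr Cons; [apply: IHp | apply: IHq].
- move=> p q d d1 d2 _ IHq _ IHp d3 e2; inversion e2 as [| | p' q' d' d4 d5 e3 e4 | | | |]; subst.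
  by apply: IHp; rewrite (IHq _ e3).
- move=> b p q d v d1 _ IHb vN _ IH d3 e2; inversion e2; subst; first exact: IH.
  by apply: (absurd_Nil b v d).
- move=> b p q d d1 _ IHb _ IH d3 e2.
  inversion e2 as [| | | b' p' q' d' v d4 ev vN | | |]; subst; last exact: IH.
  by case: vN; rewrite -(IHb _ ev).
- move=> b p d v d1 d2 _ IHb vN _ IHp _ IHw d3 e2.
  inversion e2 as [| | | | | b' p' d' v' d4 d5 ev v'N ep ew |]; subst.
    by apply: IHw; rewrite (IHp _ ep).
  by apply: (absurd_Nil b v d3).
- move=> b p d _ IHb d3 e2.
  inversion e2 as [| | | | | b' p' d' v d4 d5 ev vN |]; subst=> //.
  by case: vN; rewrite -(IHb _ ev).
Qed.

End Semantics.

(** ** Encodings *)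

Section Encodings.
Variable F : fieldType.

Definition enc_seq (T : Type) (enc : T -> data F) (s : seq T) : data F :=
  foldr (fun t d => Cons (enc t) d) Nil s.

(* Coefficient lists, lowest degree first, without trailing zeros. *)
Definition enc_poly (q : {poly F}) : data F := enc_seq (@Atom F) q.
Definition enc_poly2 (q : {poly {poly F}}) : data F := enc_seq enc_poly q.

Definition enc_ratfun (f : ratfun F) : data F :=
  Cons (enc_poly2 (frac f).1) (enc_poly2 (frac f).2).

Definition enc_ei (t : (int * F) * (F * F)) : data F :=
  Cons (Cons (Atom t.1.1%:~R) (Atom t.1.2)) (Cons (Atom t.2.1) (Atom t.2.2)).

Definition enc_li (t : (nat * nat * F) * F) : data F :=
  Cons (Cons (Cons (Atom t.1.1.1%:R) (Atom t.1.1.2%:R)) (Atom t.1.2))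
       (Atom t.2).

Definition enc_ln (t : F * ratfun F) : data F :=
  Cons (Atom t.1) (enc_ratfun t.2).

Definition enc_expression (e : expression F) : data F :=
  Cons (Cons (enc_seq enc_ei (ei_terms e)) (enc_seq enc_li (li_terms e)))
       (Cons (enc_seq enc_ln (ln_terms e)) (enc_ratfun (rat_part e))).

(* [Nil] is the answer "None". *)
Definition enc_result (r : option (expression F)) : data F :=
  if r is Some e then enc_expression e else Nil.

End Encodings.

Definition irreducible_elt (A : unitRingType) (q : A) :=
  [/\ q != 0, q \isn't a GRing.unit &
      forall a b, q = a * b -> a \is a GRing.unit \/ b \is a GRing.unit].

(* Given a nonzero q in F[x, y], the oracle returns the list, with
   multiplicities, of its irreducible factors in F[x, y], each up to a constant.
   Over F = C this is absolute factorization; on q in C[x] it finds roots. *)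
Definition factorization_oracle (F : fieldType) (factor : data F -> data F) :=
  forall q : {poly {poly F}}, q != 0 ->
  exists (c : F) (s : seq {poly {poly F}}),
    [/\ factor (enc_poly2 q) = enc_seq (@enc_poly2 F) s,
        forall g, g \in s -> irreducible_elt g
      & q = c%:P%:P * \prod_(g <- s) g].

(* Main.v *)
From HB Require Import structures.
From mathcomp Require Import all_boot all_order all_algebra.
From mathcomp Require Import polyXY ring lra zify boolp.
Require Import Defs.

Set Implicit Arguments.
Unset Strict Implicit.
Unset Printing Implicit Defensive.

Import Order.TTheory GRing.Theory Num.Theory.
Local Open Scope ring_scope.

(** Write y for ln x. Multiplied by x, the derivation d/dx becomes [del] = x d/dx + d/dy
on C[x, y], extended to the field L of fractions by [dL]. Up to constant factors, x
d/dx turns Ei (p ln x + l) into x^p / (y + l / p), turns ln K into dL K / K, and turns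
y^n Li_1 (x / a) into y^n x / (a - x) plus the polylogarithm n y^(n-1) Li_1 (x / a); a
combination of polylogarithms has a derivative in C(x, ln x) only when the
polylogarithms left by differentiation cancel, since the functions (ln x)^r Li_p (l x)
are linearly independent over C modulo C(x, ln x) ([sLi_independent]). Since x and ln
x are algebraically independent ([evq_somewhere0]), f has an integral of the required
form if and only if x f = dL H + sum of c * [tval] t for a fraction H and finitely
many terms t of the kinds [TEi], [TLi] and [TLog] ([integral_rational],
[rational_integral], [rep_value_rat]).

The algorithm rests on a bound for such an identity. Let B be the denominator of f.
Along an irreducible curve P other than x = 0, a derivative has no simple pole
([loc_integral], because P does not divide [del] P), whereas the terms attached to P
have a simple pole at most; hence the terms attached to a P that does not divide B
cancel ([terms_vanish]), and the denominator of H is a power of x times a divisor of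
B. At each of the places x = oo, x = 0 and y = oo, comparing leading coefficients
bounds the order of H, the exponents p of the Ei terms and the exponents n of the Li
terms by the order of x f ([boundI], [bound0x], [boundY]). So H and the terms may be
taken from a finite explicit list ([bounded_solution]), and only their constant
coefficients remain unknown.

The program factors B, lists the candidate terms and monomials, clears denominators,
and solves the resulting linear system over C by elimination. A row of the system
carries, next to its polynomial, the piece of the answer that it is the derivative of;
elimination acts on both, so that a vanishing right-hand side comes with its primitive
([row_ok], [solve_items_spec]). Failure of the elimination means that x f is not in
the span of the list, hence that the answer is None ([span_all]). That all this is
carried out by one program is shown by a small calculus of computable functions
([computable]), closed under pairing, tests, folds and polynomial arithmetic. *)

(** * Irreducible polynomials in two variables are prime *)

Section PrimeElements.
Variable F : numClosedFieldType.
Local Notation P2 := {poly {poly F}}.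
Implicit Types (p q P Q : P2) (a : F).

Definition dvd2 P q := exists r, q = P * r.

Lemma dvd2_refl P : dvd2 P P. Proof. by exists 1; rewrite mulr1. Qed.
Lemma dvd2_0 P : dvd2 P 0. Proof. by exists 0; rewrite mulr0. Qed.
Lemma unit2P p : reflect (exists2 a, a != 0 & p = a%:P%:P) (p \is a GRing.unit).
Proof.
apply: (iffP idP) => [|[a a0 ->]]; last first.
  by rewrite poly_unitE size_polyC polyC_eq0 a0 coefC /= poly_unitE size_polyC a0 coefC /= unitfE.
rewrite poly_unitE => /andP[/size_poly1P [c c0 ->]].
rewrite coefC /= poly_unitE => /andP[/size_poly1P [d d0 ->] _].
by exists d.
Qed.

Definition lin a : {poly F} := 'X - a%:P.

Lemma lin_neq0 a : lin a != 0. Proof. by rewrite polyXsubC_eq0. Qed.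
Lemma size_lin a : size (lin a) = 2%N. Proof. exact: size_XsubC. Qed.

(** The substitution x := a. *)
Definition atx a q : {poly F} := map_poly (horner_eval a) q.

HB.instance Definition _ a := GRing.RMorphism.copy (atx a) (map_poly (horner_eval a)).

Lemma atxM a p q : atx a (p * q) = atx a p * atx a q. Proof. exact: rmorphM. Qed.
Lemma atxB a p q : atx a (p - q) = atx a p - atx a q. Proof. exact: raddfB. Qed.

Lemma atx_eq0P a q : atx a q = 0 <-> dvd2 (lin a)%:P q.
Proof.
split=> [h|[r ->]]; last first.
  rewrite rmorphM /= /atx map_polyC /= /horner_eval /lin !hornerE subrr.
  by rewrite mul0r.
have root_c i : exists c, q`_i = lin a * c.
  have /rootP/factor_theorem [c e] : (q`_i).[a] = 0.
    by move/polyP: h => /(_ i); rewrite coef_map coef0.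
  by exists c; rewrite e mulrC.
exists (\poly_(i < size q) (q`_i %/ lin a)).
rewrite mul_polyC; apply/polyP => i; rewrite coefZ coef_poly.
case: ltnP => hi; last by rewrite nth_default // mulr0.
have [c e] := root_c i; rewrite e mulKp //; exact: lin_neq0.
Qed.

(** F[x, y] / (x - a) is the domain F[y]. *)
Lemma atx_lin_prime a p q :
  dvd2 (lin a)%:P (p * q) -> dvd2 (lin a)%:P p \/ dvd2 (lin a)%:P q.
Proof.
move=> /atx_eq0P; rewrite rmorphM /= => /eqP; rewrite mulf_eq0.
by case/orP => /eqP /atx_eq0P; [left|right].
Qed.

Lemma linP_neq0 a : (lin a)%:P != 0 :> P2.
Proof. by rewrite polyC_eq0 lin_neq0. Qed.

Lemma linP_nunit a : (lin a)%:P \isn't a @GRing.unit P2.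
Proof.
apply/unit2P => -[b _ /polyC_inj] /(congr1 (size \o polyseq)) /=.
by rewrite size_lin size_polyC; case: (b != 0).
Qed.

Lemma size_unit2 p : p \is a GRing.unit -> size p = 1%N.
Proof. by case/unit2P => a a0 ->; rewrite size_polyC polyC_eq0 a0. Qed.

Lemma lin_factor (c : {poly F}) : (1 < size c)%N -> exists a d, c = lin a * d.
Proof.
move=> hc; have /closed_rootP [a /factor_theorem[d e]] : size c != 1%N.
  by rewrite neq_ltn hc orbT.
by exists a, d; rewrite e mulrC.
Qed.

Lemma irreducible_nlin P a : irreducible_elt P -> (1 < size P)%N ->
  ~ dvd2 (lin a)%:P P.
Proof.
case=> P0 _ irr hs [r e]; have [|u] := irr _ _ e; first exact/negP/linP_nunit.
by move: hs; rewrite e mul_polyC size_scale ?lin_neq0 // (size_unit2 u).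
Qed.

(** Factors of c are of the form x - a, since F is algebraically closed; each is prime
    and does not divide P, so all of them can be moved into q. *)
Lemma cancel_content P (c : {poly F}) q r : irreducible_elt P -> (1 < size P)%N ->
  c != 0 -> c%:P * r = P * q -> dvd2 P r.
Proof.
move=> irr hs; have [n] := ubnP (size c); elim: n c q => // n IHn c q.
rewrite ltnS => hc c0 e; have [c1|c1] := leqP (size c) 1.
  have /size_poly1P [d d0 ed] : size c == 1%N by rewrite eqn_leq c1 size_poly_gt0.
  exists (d^-1%:P%:P * q); rewrite mulrCA -e ed mulrA -!polyCM mulVf //.
  by rewrite mul1r.
have [a [d ec]] := lin_factor c1; have d0 : d != 0.
  by apply: contraNneq c0 => d0; rewrite ec d0 mulr0.
have : dvd2 (lin a)%:P (P * q).
  by rewrite -e ec polyCM -mulrA; exists (d%:P * r).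
case/atx_lin_prime => [/irreducible_nlin|[q' eq']]; first by case.
apply: (IHn d q') => //.
  by apply: leq_trans hc; rewrite ec size_mul ?lin_neq0 // size_lin.
apply: (mulfI (linP_neq0 a)); rewrite mulrA -polyCM -ec e eq'; ring.
Qed.

(** The linear factors of c divide q or r and are distributed between them; what
    remains is a factorization of P itself. *)
Lemma split_content P (c : {poly F}) q r : irreducible_elt P ->
  c != 0 -> c%:P * P = q * r -> size q = 1%N \/ size r = 1%N.
Proof.
move=> [P0 Pu irr]; have [n] := ubnP (size c); elim: n c q r => // n IHn c q r.
rewrite ltnS => hc c0 e; have [c1|c1] := leqP (size c) 1.
  have /size_poly1P [d d0 ed] : size c == 1%N by rewrite eqn_leq c1 size_poly_gt0.
  have du : d%:P%:P \is a @GRing.unit P2 by apply/unit2P; exists d.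
  have /irr [u|u] : P = ((d%:P%:P)^-1 * q) * r.
    by rewrite -mulrA -e ed mulKr.
    left; rewrite -(mulVKr du q) mul_polyC size_scale ?polyC_eq0 //.
    exact: size_unit2.
  by right; apply: size_unit2.
have [a [d ec]] := lin_factor c1; have d0 : d != 0.
  by apply: contraNneq c0 => d0; rewrite ec d0 mulr0.
have hd : (size d < n)%N.
  by apply: leq_trans hc; rewrite ec size_mul ?lin_neq0 // size_lin.
have l0 := linP_neq0 a.
have : dvd2 (lin a)%:P (q * r).
  by rewrite -e ec polyCM -mulrA; exists (d%:P * P).
case/atx_lin_prime => [[s es]|[s es]].
  have [||] := IHn d s r hd d0; last by right.
    by apply: (mulfI l0); rewrite !mulrA -polyCM -ec e es.
  by move=> h; left; rewrite es mul_polyC size_scale // lin_neq0.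
have [||] := IHn d q s hd d0; last 1 first.
- by move=> h; right; rewrite es mul_polyC size_scale // lin_neq0.
- by apply: (mulfI l0); rewrite mulrA -polyCM -ec e es; ring.
- by left.
Qed.

(** Gauss's lemma: if P is coprime to p over F(x), pseudo-division gives a
    divisibility of q up to a factor in F[x], which [cancel_content] removes;
    otherwise the pseudo-gcd has full degree by [split_content].  A polynomial in x
    alone is a multiple of some x - a. *)
Theorem irreducible_prime P p q :
  irreducible_elt P -> dvd2 P (p * q) -> dvd2 P p \/ dvd2 P q.
Proof.
move=> irrP; have [P0 Pu irr] := irrP; have [s1|s1] := leqP (size P) 1.
  have /size_poly1P [c c0 e] : size P == 1%N by rewrite eqn_leq s1 size_poly_gt0.
  have c1 : (1 < size c)%N.
    rewrite ltnNge; apply/negP => h; case/negP: Pu.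
    have /size_poly1P [d d0 ed] : size c == 1%N by rewrite eqn_leq h size_poly_gt0.
    by apply/unit2P; exists d => //; rewrite e ed.
  have [a [d ec]] := lin_factor c1.
  have /irr [|u] : P = (lin a)%:P * d%:P by rewrite e ec polyCM.
    by move=> /negPn; rewrite linP_nunit.
  have eP r : dvd2 P r <-> dvd2 (lin a)%:P r.
    rewrite e ec polyCM; split=> -[t ->]; first by exists (d%:P * t); rewrite mulrA.
    by exists ((d%:P)^-1 * t); rewrite -mulrA mulVKr.
  by rewrite !eP; apply: atx_lin_prime.
case=> r e.
have true_dvd s : P %| s -> dvd2 P s.
  case/Pdiv.Idomain.dvdpP => -[c t] /= c0 et; apply: (cancel_content (c := c) (q := t)) => //.
  by rewrite mul_polyC et mulrC.
have [cop|ncop] := boolP (coprimep P p).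
  right; apply: true_dvd; rewrite -(Gauss_dvdpr _ cop).
  by apply/Pdiv.Idomain.dvdpP; exists (1, r); rewrite ?oner_eq0 //= scale1r e mulrC.
left; apply: true_dvd; have /Pdiv.Idomain.dvdpP [[c t] /= c0 et] := dvdp_gcdl P p.
case: (split_content irrP c0 (q := t) (r := gcdp P p)).
- by rewrite mul_polyC et.
- move=> t1; apply: dvdp_trans (dvdp_gcdr P p).
  have sz : size (gcdp P p) = size P.
    have t0 : t != 0 by rewrite -size_poly_eq0 t1.
    have g0 : gcdp P p != 0.
      by rewrite gcdp_eq0 (negPf P0).
    have := congr1 (size \o polyseq) et; rewrite /= size_scale // size_mul // t1.
    by move=> ->.
  move: (dvdp_size_eqp (dvdp_gcdl P p)); rewrite sz eqxx => /esym.
  by rewrite /eqp => /andP[].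
- by move=> g1; move: ncop; rewrite /coprimep g1 eqxx.
Qed.

Lemma lin_irreducible a : irreducible_elt (lin a)%:P.
Proof.
split; [exact: linP_neq0 | exact: linP_nunit | move=> p q e].
have cof r t : (lin a)%:P = r * t -> dvd2 (lin a)%:P r -> t \is a GRing.unit.
  move=> ert [v ev]; apply/unitrPr; exists v; rewrite mulrC.
  by apply: (mulfI (linP_neq0 a)); rewrite mulr1 mulrA -ev -ert.
have := atx_lin_prime (a := a) (p := p) (q := q); rewrite -e.
case; first exact: dvd2_refl.
- by move=> /(cof _ _ e); right.
- by move=> h; left; apply: cof h; rewrite mulrC.
Qed.

Lemma yadd_irreducible a : irreducible_elt ('X + a%:P%:P : P2).
Proof.
have s2 : size ('X + a%:P%:P : P2) = 2%N by rewrite size_XaddC.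
have nz : 'X + a%:P%:P != 0 :> P2 by rewrite -size_poly_eq0 s2.
split=> //; first by apply/negP => /size_unit2; rewrite s2.
move=> p q e; have p0 : p != 0 by apply: contraNneq nz => z; rewrite e z mul0r.
have q0 : q != 0 by apply: contraNneq nz => z; rewrite e z mulr0.
have lc : lead_coef p * lead_coef q = 1.
  by rewrite -lead_coefM -e lead_coefDl ?lead_coefX // size_polyX ltnS size_polyC_leq1.
have const r t : lead_coef r * lead_coef t = 1 -> size r = 1%N -> r \is a GRing.unit.
  move=> h r1; have /size_poly1P [c c0 er] : size r == 1%N by rewrite r1.
  move: h; rewrite er lead_coefC => h; apply/unitrPr; exists (lead_coef t)%:P.
  by rewrite -polyCM h.
have := congr1 (size \o polyseq) e; rewrite /= s2 size_mul //.
have : (0 < size p)%N by rewrite size_poly_gt0.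
have : (0 < size q)%N by rewrite size_poly_gt0.
case sp : (size p) => [|[|m]] //; first by move=> _ _ _; left; apply: const lc sp.
case sq : (size q) => [|[|n]] //; last first.
  by move=> _ _; rewrite !addSn !addnS.
have lc' : lead_coef q * lead_coef p = 1 by rewrite mulrC.
by move=> _ _ _; right; exact: const lc' sq.
Qed.

End PrimeElements.

(** * The derivation x d/dx on C(x, ln x) *)

Section Derivation.
Variable F : numClosedFieldType.
Local Notation P2 := {poly {poly F}}.
Implicit Types (p q P Q : P2) (a : F).

Definition X1 : P2 := 'X%:P.
(** x d/dx + d/dy.  As y stands for ln x, this is x times the derivative with respect
    to x. *)
Definition del q : P2 := X1 * map_poly (@deriv F) q + q^`().

Lemma coef_del q i : (del q)`_i = 'X * (q`_i)^`() + q`_i.+1 *+ i.+1.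
Proof. by rewrite /del coefD mul_polyC coefZ coef_map coef_deriv. Qed.

Lemma coef2_del q i j :
  (del q)`_i`_j = q`_i`_j *+ j + q`_i.+1`_j *+ i.+1.
Proof.
rewrite coef_del coefD coefMn coefXM; case: j => [|j] /=; first by rewrite mulr0n.
by rewrite coef_deriv.
Qed.

Lemma del_is_zmod_morphism : zmod_morphism del.
Proof.
move=> p q; apply/polyP => i; apply/polyP => j.
rewrite coef2_del !coefB !coef2_del !mulrnBl; ring.
Qed.
HB.instance Definition _ :=
  GRing.isZmodMorphism.Build P2 P2 del del_is_zmod_morphism.

Lemma delD p q : del (p + q) = del p + del q. Proof. exact: raddfD. Qed.
Lemma delB p q : del (p - q) = del p - del q. Proof. exact: raddfB. Qed.

Lemma map_derivM p q : map_poly (@deriv F) (p * q) =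
  map_poly (@deriv F) p * q + p * map_poly (@deriv F) q.
Proof.
apply/polyP => i; rewrite coef_map coefD !coefM /= linear_sum /= -big_split /=.
by apply: eq_bigr => j _; rewrite !coef_map derivM.
Qed.

Lemma delM p q : del (p * q) = del p * q + p * del q.
Proof. by rewrite /del map_derivM derivM; ring. Qed.

Lemma del_const a : del a%:P%:P = 0.
Proof. by rewrite /del map_polyC /= !derivC polyC0 mulr0 addr0. Qed.

Lemma del1 : del 1 = 0. Proof. exact: del_const 1. Qed.

Lemma delZ a q : del (a%:P%:P * q) = a%:P%:P * del q.
Proof. by rewrite delM del_const mul0r add0r. Qed.

Lemma del_X1 : del X1 = X1.
Proof. by rewrite /del /X1 map_polyC /= derivX derivC addr0 mulr1. Qed.

Lemma del_Y : del 'X = 1.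
Proof.
apply/polyP => i; rewrite coef_del !coefX coef1.
by case: i => [|[|i]] /=; rewrite ?derivC ?deriv0 ?mulr0 ?add0r ?mul0rn //= derivC mulr0.
Qed.

Lemma size_del q : (size (del q) <= size q)%N.
Proof.
apply/leq_sizeP => i hi; apply/polyP => j; rewrite coef2_del coef0.
by rewrite [q`_i]nth_default // [q`_i.+1]nth_default ?leqW // !coef0 !mul0rn addr0.
Qed.

Lemma sizeY_leP q n : reflect (forall i j, (n <= j)%N -> q`_i`_j = 0) (sizeY q <= n)%N.
Proof.
apply: (iffP idP) => [h i j hj|h].
  by rewrite nth_default // (leq_trans _ hj) // (leq_trans (max_size_coefXY _ _) h).
by apply/bigmax_leqP => i _; apply/leq_sizeP => j; apply: h.
Qed.

Lemma sizeY_del q : (sizeY (del q) <= sizeY q)%N.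
Proof.
apply/sizeY_leP => i j hj; have /sizeY_leP h := leqnn (sizeY q).
by rewrite coef2_del !h // !mul0rn addr0.
Qed.

(** On x^j the operator multiplies by j and in the y direction it is nilpotent, so
    eigenvectors are homogeneous in x and constant in y. *)
Lemma del_eigen q (c : F) : del q = c%:P%:P * q -> q != 0 ->
  exists a k, [/\ a != 0, c = k%:R & q = a%:P%:P * X1 ^+ k].
Proof.
move=> e q0; set n := (size q).-1.
have cf i j : q`_i`_j *+ j + q`_i.+1`_j *+ i.+1 = c * q`_i`_j.
  by rewrite -coef2_del e mul_polyC coefZ mul_polyC coefZ.
have sn i : (n < i)%N -> q`_i = 0.
  by move=> hi; rewrite nth_default //; move: hi; rewrite /n; case: (size q).
have qn0 : q`_n != 0 by rewrite -/(lead_coef q) lead_coef_eq0.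
have top j : q`_n`_j != 0 -> c = j%:R.
  move=> h; apply: (mulIf h); rewrite -cf (sn n.+1) // coef0 mul0rn addr0.
  by rewrite mulr_natl.
pose k := (size q`_n).-1; have qk0 : q`_n`_k != 0.
  by rewrite -/(lead_coef q`_n) lead_coef_eq0.
have ck := top _ qk0.
have n0 : n = 0%N.
  case en: n => [//|m]; have := cf m k; rewrite -en ck mulr_natl => /eqP.
  rewrite -subr_eq0 addrAC subrr add0r -mulr_natr mulf_eq0 (negPf qk0) /=.
  by rewrite pnatr_eq0 en.
exists q`_n`_k, k; split=> //; apply/polyP => i; apply/polyP => j.
rewrite /X1 -polyC_exp -!polyCM coefC; case: i => [|i]; last first.
  by rewrite sn ?n0 // !coef0.
rewrite /= mul_polyC coefZ coefXn n0; case: eqP => [->|/eqP hj]; first by rewrite mulr1.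
rewrite mulr0; apply: contraNeq hj => hj; rewrite -{1}n0 in hj.
by rewrite -(eqr_nat F) -(top _ hj) ck.
Qed.

(** The associates of x, the only irreducible polynomials that divide their
    derivative. *)
Definition like_x P := exists2 a : F, a != 0 & P = a%:P%:P * X1.

Lemma X1E : X1 = (lin 0)%:P. Proof. by rewrite /lin polyC0 subr0. Qed.

Lemma X1_irreducible : irreducible_elt X1.
Proof. by rewrite X1E; apply: lin_irreducible. Qed.

(** Since [del] does not raise the degrees, the cofactor would be a constant and P an
    eigenvector. *)
Lemma ndvd_del P : irreducible_elt P -> ~ like_x P -> ~ dvd2 P (del P).
Proof.
move=> irrP nx [Q e]; have [P0 Pu irr] := irrP.
have [c ec] : exists c : F, Q = c%:P%:P.
  have [->|Q0] := eqVneq Q 0; first by exists 0; rewrite !polyC0.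
  have sQ : (size Q <= 1)%N.
    have := size_del P; rewrite e size_mul // -[X in (_ <= X)%N -> _]addn0.
    have := P0; rewrite -size_poly_gt0; case: (size P) => // m _.
    rewrite addSn /= addn0 => h; rewrite -(leq_add2l m); apply: leq_trans h _.
    by rewrite addn1.
  have sQ' : (sizeY Q <= 1)%N.
    have := sizeY_del P; rewrite e !sizeYE rmorphM /= size_mul ?swapXY_eq0 //.
    have := P0; rewrite -swapXY_eq0 -size_poly_gt0.
    case: (size (swapXY P)) => // m _; rewrite addSn /= => h.
    by rewrite -(leq_add2l m); apply: leq_trans h _; rewrite addn1.
  have e1 := size1_polyC sQ; exists Q`_0`_0; rewrite [LHS]e1.
  congr (_%:P); apply: size1_polyC; apply: leq_trans sQ'; exact: max_size_coefXY.
have [|a [k [a0 _ eP]]] := del_eigen (c := c) (q := P) _ P0.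
  by rewrite e ec mulrC.
case: k eP => [|[|k]] eP.
- by case/negP: Pu; apply/unit2P; exists a; rewrite // eP mulr1.
- by apply: nx; exists a; rewrite // eP expr1.
have := irr (a%:P%:P * X1 ^+ k.+1) X1.
have [_ /negPf xu _] := X1_irreducible.
rewrite -mulrA -exprSr -eP xu; case=> // u.
have : X1 \is a @GRing.unit P2.
  by move: u; rewrite unitrM exprS unitrM => /andP[_ /andP[]].
by rewrite xu.
Qed.

End Derivation.

Lemma quotient_ruleD (K : fieldType) (n d m e n' d' m' e' : K) :
  d != 0 -> e != 0 ->
  ((n' * e + n * e' + (m' * d + m * d')) * (d * e) -
   (n * e + m * d) * (d' * e + d * e')) / (d * e) ^+ 2 =
  (n' * d - n * d') / d ^+ 2 + (m' * e - m * e') / e ^+ 2.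
Proof. by move=> d0 e0; field; rewrite d0 e0. Qed.

Lemma quotient_ruleM (K : fieldType) (n d m e n' d' m' e' : K) :
  d != 0 -> e != 0 ->
  ((n' * m + n * m') * (d * e) - n * m * (d' * e + d * e')) / (d * e) ^+ 2 =
  (n' * d - n * d') / d ^+ 2 * (m / e) + n / d * ((m' * e - m * e') / e ^+ 2).
Proof. by move=> d0 e0; field; rewrite d0 e0. Qed.

(** A fraction field presented by its embedding and a choice of numerators and
    denominators.  Proofs work with an abstract [L : fractions P2]: unification then
    never unfolds the quotient construction of {fraction P2}. *)
Record fractions (A : idomainType) := Fractions {
  frac_field :> fieldType;
  embed : {rmorphism A -> frac_field};
  numer : frac_field -> A;
  denom : frac_field -> A;
  _ : injective embed;
  _ : forall a, denom a != 0;
  _ : forall a, a = embed (numer a) / embed (denom a)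
}.

Lemma fraction_reprE (A : idomainType) (a : {fraction A}) :
  a = FracField.tofrac (\n_(repr a)) / FracField.tofrac (\d_(repr a)).
Proof.
rewrite -[LHS]reprK; set r := repr a.
apply: (@mulIf _ (FracField.tofrac \d_r)); first by rewrite tofrac_eq0 denom_ratioP.
rewrite divfK ?tofrac_eq0 ?denom_ratioP //.
unlock FracField.tofrac; rewrite -[LHS]FracField.pi_mul; apply/eqmodP => /=.
rewrite FracField.equivfE /FracField.mulf !numden_Ratio ?mulf_neq0 ?denom_ratioP ?oner_neq0 //.
by rewrite !mulr1 mulrC.
Qed.

Definition fractions_of (A : idomainType) : fractions A.
Proof.
apply: (@Fractions A {fraction A} (@FracField.tofrac A)
  (fun a => \n_(repr a)) (fun a => \d_(repr a))).
- by move=> p q /eqP; rewrite tofrac_eq => /eqP.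
- by move=> a; apply: denom_ratioP.
- exact: fraction_reprE.
Qed.

Section FractionField.
Variable F : numClosedFieldType.
Local Notation P2 := {poly {poly F}}.
Variable L : fractions P2.
Local Notation "p %:F" := (embed L p).
Implicit Types (p q P Q : P2) (a b : L).

Lemma emb_inj : injective (embed L). Proof. by case: L. Qed.
Lemma emb_eq0 p : (p%:F == 0) = (p == 0).
Proof. by rewrite -(inj_eq emb_inj) rmorph0. Qed.

Lemma embM p q : (p * q)%:F = p%:F * q%:F. Proof. exact: rmorphM. Qed.
Lemma embD p q : (p + q)%:F = p%:F + q%:F. Proof. exact: rmorphD. Qed.
Lemma embB p q : (p - q)%:F = p%:F - q%:F. Proof. exact: rmorphB. Qed.
Lemma embX p n : (p ^+ n)%:F = p%:F ^+ n. Proof. exact: rmorphXn. Qed.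
Lemma emb1 : 1%:F = 1 :> L. Proof. exact: rmorph1. Qed.
Lemma emb0 : 0%:F = 0 :> L. Proof. exact: rmorph0. Qed.

Lemma fracE a : exists n d, d != 0 /\ a = n%:F / d%:F.
Proof.
by exists (numer a), (denom a); case: L a => /= K e n d i d0 h a; split.
Qed.

(** The extension of [del], defined on the chosen representative; [dL_frac] shows that
    the representative does not matter. *)
Definition dL (a : L) : L :=
  let n := numer a in let d := denom a in
  (del n * d - n * del d)%:F / (d ^+ 2)%:F.

Lemma reprE a : denom a != 0 /\ a = (numer a)%:F / (denom a)%:F.
Proof. by case: L a => /= K e n d i d0 h a; split. Qed.

Lemma dL_frac n d : d != 0 ->
  dL (n%:F / d%:F) = (del n * d - n * del d)%:F / (d ^+ 2)%:F.
Proof.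
move=> d0; rewrite /dL; set a := n%:F / d%:F.
have [d'0 ea] := reprE a; move: d'0 ea; set n' := numer a; set d' := denom a.
move=> d'0 ea.
have fd0 : d%:F != 0 by rewrite emb_eq0.
have fd'0 : d'%:F != 0 by rewrite emb_eq0.
have e : n * d' = n' * d.
  apply: emb_inj; rewrite !rmorphM /=; apply/eqP; rewrite -eqr_div //.
  by apply/eqP.
have e' := congr1 (@del F) e; rewrite !delM in e'.
apply/eqP; rewrite eqr_div ?emb_eq0 ?expf_neq0 // -!rmorphM (inj_eq emb_inj).
apply/eqP; apply: (mulfI d0); apply: (mulfI d'0).
have e1 : n' * del d * d = n * d' * del d by rewrite e; ring.
have e2 : n * del d' * d' = n' * d * del d' by rewrite -e; ring.
have e3 : del n' * d = del n * d' + n * del d' - n' * del d by rewrite e'; ring.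
transitivity (d' * d * (del n' * d * d' * d - n' * d * del d' * d)); first by ring.
rewrite e3 -e2.
transitivity (d' * d * (del n * d' ^+ 2 * d - n' * del d * d * d')); first by ring.
by rewrite e1; ring.
Qed.

Lemma dL_emb n : dL n%:F = (del n)%:F.
Proof.
have := dL_frac n (oner_neq0 _); rewrite del1 expr1n !mulr1 mulr0 subr0.
by rewrite !rmorph1 !divr1.
Qed.

Lemma dLD a b : dL (a + b) = dL a + dL b.
Proof.
have [n [d [d0 ->]]] := fracE a; have [m [e [e0 ->]]] := fracE b.
have fd0 : d%:F != 0 by rewrite emb_eq0.
have fe0 : e%:F != 0 by rewrite emb_eq0.
have -> : n%:F / d%:F + m%:F / e%:F = (n * e + m * d)%:F / (d * e)%:F.
  by rewrite rmorphD !rmorphM addf_div.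
rewrite (dL_frac n d0) (dL_frac m e0) (dL_frac _ (mulf_neq0 d0 e0)).
rewrite !(delD, delM) !(embB, embD, embM, embX).
exact: quotient_ruleD.
Qed.

Lemma dLM a b : dL (a * b) = dL a * b + a * dL b.
Proof.
have [n [d [d0 ->]]] := fracE a; have [m [e [e0 ->]]] := fracE b.
have fd0 : d%:F != 0 by rewrite emb_eq0.
have fe0 : e%:F != 0 by rewrite emb_eq0.
have -> : n%:F / d%:F * (m%:F / e%:F) = (n * m)%:F / (d * e)%:F.
  by rewrite !rmorphM mulf_div.
rewrite (dL_frac n d0) (dL_frac m e0) (dL_frac _ (mulf_neq0 d0 e0)).
rewrite !(delD, delM) !(embB, embD, embM, embX).
exact: quotient_ruleM.
Qed.

Lemma dL0 : dL 0 = 0.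
Proof. by rewrite -(rmorph0 (embed L)) dL_emb raddf0. Qed.

Lemma dLN a : dL (- a) = - dL a.
Proof. by apply/eqP; rewrite -addr_eq0 -dLD addNr dL0. Qed.

Lemma dLB a b : dL (a - b) = dL a - dL b.
Proof. by rewrite dLD dLN. Qed.

Lemma dL_is_zmod_morphism : zmod_morphism dL.
Proof. by move=> a b; rewrite dLD dLN. Qed.
HB.instance Definition _ :=
  GRing.isZmodMorphism.Build L L dL dL_is_zmod_morphism.

(** Constant functions, as elements of L. *)
Definition cstF (c : F) : L := (c%:P%:P)%:F.
HB.instance Definition _ := GRing.RMorphism.copy cstF
  ((embed L) \o (@polyC {poly F}) \o (@polyC F)).

Lemma cstM c d : cstF (c * d) = cstF c * cstF d. Proof. exact: rmorphM. Qed.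
Lemma cst_nat n : cstF n%:R = n%:R. Proof. exact: rmorph_nat. Qed.
Lemma cst0 : cstF 0 = 0. Proof. exact: rmorph0. Qed.
Lemma cst1 : cstF 1 = 1. Proof. exact: rmorph1. Qed.

Lemma cst_eq0 c : (cstF c == 0) = (c == 0).
Proof. exact: fmorph_eq0. Qed.

Lemma dL_cst c : dL (cstF c) = 0.
Proof. by rewrite dL_emb del_const rmorph0. Qed.

Lemma dLZ c a : dL (cstF c * a) = cstF c * dL a.
Proof. by rewrite dLM dL_cst mul0r add0r. Qed.

Lemma dLXn a n : dL (a ^+ n) = (a ^+ n.-1 * dL a) *+ n.
Proof.
elim: n => [|n IHn]; first by rewrite expr0 -(rmorph1 cstF) dL_cst mulr0n.
rewrite exprS dLM IHn; case: n {IHn} => [|n] /=; first by rewrite !expr0; ring.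
by rewrite !exprS; ring.
Qed.

Lemma dLV a : a != 0 -> dL a^-1 = - dL a / a ^+ 2.
Proof.
move=> a0; have : dL (a * a^-1) = 0 by rewrite divff // -(rmorph1 cstF) dL_cst.
rewrite dLM addrC => /eqP; rewrite addr_eq0 => /eqP h.
apply: (mulfI a0); rewrite h; field; exact: a0.
Qed.

End FractionField.

(** * Factorization, and regularity along an irreducible curve *)

Section Factorization.
Variable F : numClosedFieldType.
Local Notation P2 := {poly {poly F}}.
Implicit Types (p q P Q : P2).

(** Sum of the two degrees, plus 2; it decreases under proper factorization. *)
Definition size2 q := (size q + sizeY q)%N.

Lemma sizeYM p q : p != 0 -> q != 0 -> sizeY (p * q) = (sizeY p + sizeY q).-1.
Proof. by move=> p0 q0; rewrite !sizeYE rmorphM /= size_mul ?swapXY_eq0. Qed.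

Lemma sizeY_gt0 q : (0 < sizeY q)%N = (q != 0).
Proof. by rewrite lt0n sizeY_eq0. Qed.

Lemma size2M p q : p != 0 -> q != 0 -> (size2 (p * q) + 2 = size2 p + size2 q)%N.
Proof.
move=> p0 q0; rewrite /size2 size_mul // sizeYM //.
have : (0 < size p)%N by rewrite size_poly_gt0.
have : (0 < size q)%N by rewrite size_poly_gt0.
have : (0 < sizeY p)%N by rewrite sizeY_gt0.
have : (0 < sizeY q)%N by rewrite sizeY_gt0.
by move: (size p) (size q) (sizeY p) (sizeY q) => a b c d; lia.
Qed.

Lemma size2_nunit q : q != 0 -> q \isn't a GRing.unit -> (2 < size2 q)%N.
Proof.
move=> q0; apply: contraNltn => h.
have : (size q <= 1)%N /\ (sizeY q <= 1)%N.
  have : (0 < size q)%N by rewrite size_poly_gt0.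
  have : (0 < sizeY q)%N by rewrite sizeY_gt0.
  by move: h; rewrite /size2; move: (size q) (sizeY q) => a b; lia.
case=> h1 h2; have e := size1_polyC h1.
have s0 : (size (q`_0)%R <= 1)%N by apply: leq_trans h2; apply: max_size_coefXY.
apply/unit2P; exists q`_0`_0; last by rewrite [LHS]e; congr (_%:P); apply: size1_polyC.
by apply: contraNneq q0 => z; rewrite e (size1_polyC s0) z.
Qed.

Lemma factorization_exists q : q != 0 -> exists (c : F) (s : seq P2),
  (forall g, g \in s -> irreducible_elt g) /\ q = c%:P%:P * \prod_(g <- s) g.
Proof.
have [n] := ubnP (size2 q); elim: n q => // n IHn q; rewrite ltnS => hn q0.
have [/unit2P [c _ e]|qu] := boolP (q \is a GRing.unit).
  by exists c, [::]; split=> //; rewrite big_nil mulr1.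
have [irr|nirr] := EM (irreducible_elt q).
  exists 1, [:: q]; split=> [g|]; first by rewrite inE => /eqP->.
  by rewrite big_seq1 mul1r.
have [a [b [e au bu]]] : exists a b, [/\ q = a * b, a \isn't a GRing.unit & b \isn't a GRing.unit].
  apply: contrapT => h; apply: nirr; split=> // a b e.
  have [|au] := boolP (a \is a GRing.unit); first by left.
  have [|bu] := boolP (b \is a GRing.unit); first by right.
  by case: h; exists a, b.
have a0 : a != 0 by apply: contraNneq q0 => z; rewrite e z mul0r.
have b0 : b != 0 by apply: contraNneq q0 => z; rewrite e z mulr0.
have := size2M a0 b0; rewrite -e => es.
have := size2_nunit a0 au; have := size2_nunit b0 bu => hb ha.
have [|c [s [hs es1]]] := IHn a _ a0; first by lia.
have [|d [t [ht et1]]] := IHn b _ b0; first by lia.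
exists (c * d), (s ++ t); split=> [g|].
  by rewrite mem_cat => /orP[/hs|/ht].
by rewrite big_cat /= e es1 et1 !polyCM; ring.
Qed.

Lemma multiplicity P q : irreducible_elt P -> q != 0 ->
  exists k r, q = P ^+ k * r /\ ~ dvd2 P r.
Proof.
move=> [P0 Pu _]; have [n] := ubnP (size2 q); elim: n q => // n IHn q.
rewrite ltnS => hn q0; have [[r e]|nd] := EM (dvd2 P q); last first.
  by exists 0%N, q; rewrite expr0 mul1r.
have r0 : r != 0 by apply: contraNneq q0 => z; rewrite e z mulr0.
have := size2M P0 r0; rewrite -e => es; have hP := size2_nunit P0 Pu.
have [|k [s [es1 hs]]] := IHn r _ r0; first by lia.
by exists k.+1, s; rewrite e es1 exprS mulrA.
Qed.

End Factorization.

Section LocalRing.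
Variable F : numClosedFieldType.
Local Notation P2 := {poly {poly F}}.
Variable L : fractions P2.
Local Notation "p %:F" := (embed L p).
Implicit Types (p q P Q : P2) (a b : L).

(** The local ring of F[x, y] at the prime P: the fractions without pole along the
    curve P = 0. *)
Definition loc P a := exists S Z, ~ dvd2 P Z /\ a = S%:F / Z%:F.

Lemma ndvd_neq0 P q : ~ dvd2 P q -> q != 0.
Proof. by move=> h; apply/eqP => z; apply: h; rewrite z; apply: dvd2_0. Qed.

Section Fixed.
Variable P : P2.
Hypothesis irrP : irreducible_elt P.

Lemma prime_ndvdM p q : ~ dvd2 P p -> ~ dvd2 P q -> ~ dvd2 P (p * q).
Proof. by move=> hp hq /irreducible_prime []. Qed.

Lemma ndvd1 : ~ dvd2 P 1.
Proof.
case: irrP => _ /negP Pu _ [r e]; apply: Pu; apply/unitrPr; exists r.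
by rewrite -e.
Qed.

Lemma loc_frac p q : ~ dvd2 P q -> loc P (p%:F / q%:F).
Proof. by move=> h; exists p, q. Qed.

Lemma loc_emb p : loc P p%:F.
Proof. by exists p, 1; rewrite rmorph1 divr1; split=> //; apply: ndvd1. Qed.

Lemma loc_cst c : loc P (cstF L c). Proof. exact: loc_emb. Qed.

Lemma loc0 : loc P 0. Proof. by rewrite -(rmorph0 (embed L)); apply: loc_emb. Qed.

Lemma locD a b : loc P a -> loc P b -> loc P (a + b).
Proof.
move=> [s [z [hz ->]]] [t [w [hw ->]]]; exists (s * w + t * z), (z * w).
split; first exact: prime_ndvdM.
by rewrite addf_div ?emb_eq0 ?(ndvd_neq0 hz) ?(ndvd_neq0 hw) // rmorphD !rmorphM.
Qed.

Lemma locM a b : loc P a -> loc P b -> loc P (a * b).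
Proof.
move=> [s [z [hz ->]]] [t [w [hw ->]]]; exists (s * t), (z * w).
split; first exact: prime_ndvdM.
by rewrite mulf_div !rmorphM.
Qed.

Lemma locN a : loc P a -> loc P (- a).
Proof. by move=> [s [z [hz ->]]]; exists (- s), z; rewrite rmorphN mulNr. Qed.

Lemma locB a b : loc P a -> loc P b -> loc P (a - b).
Proof. by move=> ha hb; apply: locD => //; apply: locN. Qed.

Lemma locX a n : loc P a -> loc P (a ^+ n).
Proof.
move=> ha; elim: n => [|n IHn]; last by rewrite exprS; apply: locM.
by rewrite expr0 -(rmorph1 (embed L)); apply: loc_emb.
Qed.

Lemma loc_sum (I : Type) (r : seq I) (Q : pred I) (f : I -> L) :
  (forall i, Q i -> loc P (f i)) -> loc P (\sum_(i <- r | Q i) f i).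
Proof. by move=> h; elim/big_rec: _ => [|i a Qi]; [apply: loc0 | apply/locD/h]. Qed.

Lemma loc_dL a : loc P a -> loc P (dL a).
Proof.
move=> [s [z [hz ->]]]; rewrite dL_frac ?(ndvd_neq0 hz) //.
by apply: loc_frac; rewrite expr2; apply: prime_ndvdM.
Qed.

(** If p / (P q) = S / Z with P not dividing Z, then P divides p Z, and P is prime. *)
Lemma loc_dvd p q : q != 0 -> loc P (p%:F / (P * q)%:F) -> dvd2 P p.
Proof.
move=> q0 [s [z [hz /eqP]]]; have [P0 _ _] := irrP.
rewrite eqr_div ?emb_eq0 ?mulf_neq0 ?(ndvd_neq0 hz) // -!rmorphM (inj_eq (@emb_inj _ _)).
move=> /eqP e; have : dvd2 P (p * z).
  by rewrite e mulrC -mulrA; exists (q * s).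
by case/irreducible_prime.
Qed.

Lemma loc_pole a : exists j, loc P (P%:F ^+ j * a).
Proof.
have [n [d [d0 ->]]] := fracE a; have [k [r [e hr]]] := multiplicity irrP d0.
exists k; exists n, r; split=> //; have [P0 _ _] := irrP.
have fP : P%:F ^+ k != 0 by rewrite expf_neq0 ?emb_eq0.
by rewrite e rmorphM rmorphXn invfM mulrCA mulVKf.
Qed.

Hypothesis Pnx : ~ like_x P.

(** If P^(j+1) a = s / z with P not dividing z, then comparing [dL] (P^(j+1) a) with
    P^(j+1) [dL] a shows that (j+1) [del] P s / (P z) is regular; P does not divide
    [del] P, so it divides s. *)
Lemma loc_dL_lower a j : loc P (P%:F ^+ j.+1 * dL a) -> loc P (P%:F ^+ j.+1 * a) ->
  loc P (P%:F ^+ j * a).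
Proof.
have [P0 _ _] := irrP; have fP0 : P%:F != 0 by rewrite emb_eq0.
move=> ha hb; have [s [z [hz es]]] := hb.
have : loc P ((j.+1%:R * del P * s)%:F / (P * z)%:F).
  have -> : (j.+1%:R * del P * s)%:F / (P * z)%:F =
    dL (P%:F ^+ j.+1 * a) - P%:F ^+ j.+1 * dL a.
    rewrite dLM dLXn addrK dL_emb [in RHS]/= -mulr_natl.
    have -> : a = (P%:F ^+ j.+1)^-1 * (s%:F / z%:F).
      by rewrite -es mulKf ?expf_neq0.
    rewrite !rmorphM rmorph_nat exprS invfM; field.
    by rewrite expf_neq0 ?fP0 ?emb_eq0 ?(ndvd_neq0 hz).
  by apply: locB => //; apply: loc_dL.
move/(loc_dvd (ndvd_neq0 hz)); rewrite -mulrA => /irreducible_prime [] //.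
  rewrite -polyC_natr -polyC_natr => h; case: ndvd1.
  have [r er] := h; exists (r * (j.+1%:R^-1)%:P%:P).
  by rewrite mulrA -er -!polyCM divff ?pnatr_eq0.
case/irreducible_prime => // [/(ndvd_del irrP Pnx)//|[r er]].
exists r, z; split=> //; apply: (mulfI fP0).
by rewrite mulrA -exprS es er rmorphM mulrA.
Qed.

(** A derivative has no simple pole along P: a pole of order k > 0 of a becomes a pole
    of order k + 1 of [dL] a. *)
Lemma loc_integral a k : loc P (P%:F ^+ k.+1 * dL a) -> loc P (P%:F ^+ k * a).
Proof.
move=> ha; have [j] := loc_pole a.
have [le_jk|/ltnW le_kj] := leqP j k.
  move=> h; rewrite -(subnK le_jk) exprD -mulrA; apply: locM => //.
  by apply: locX; apply: loc_emb.
rewrite -(subnK le_kj); elim: (j - k)%N => [//|m IHm] h; apply: IHm.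
apply: loc_dL_lower => //; rewrite -addnS exprD -mulrA; apply: locM => //.
by apply: locX; apply: loc_emb.
Qed.

Lemma loc_simple_pole a : loc P (P%:F * dL a) -> loc P (dL a).
Proof.
move=> h; have := @loc_integral a 0; rewrite expr1 expr0 mul1r => /(_ h).
exact: loc_dL.
Qed.

End Fixed.

(** Every irreducible factor of a denominator divides the numerator and can be
    cancelled. *)
Lemma loc_all_poly a : (forall P, irreducible_elt P -> loc P a) ->
  exists p, a = p%:F.
Proof.
have [n [d [d0 ->]]] := fracE a; have [c [s [hs e]]] := factorization_exists d0.
have c0 : c%:P%:P != 0 :> P2 by apply: contraNneq d0 => z; rewrite e z mul0r.
move=> h; rewrite e in h *; elim: s n {e} hs h => [|P s IHs] n hs h.
  exists ((c^-1)%:P%:P * n); move: c0; rewrite !polyC_eq0 => c0.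
  apply: (@mulIf _ (c%:P%:P)%:F); first by rewrite emb_eq0 !polyC_eq0.
  rewrite big_nil mulr1 divfK ?emb_eq0 ?polyC_eq0 // -rmorphM.
  by rewrite mulrAC -!polyCM mulVf // mul1r.
have irrP : irreducible_elt P by apply: hs; rewrite mem_head.
have hs' g : g \in s -> irreducible_elt g by move=> hg; apply: hs; rewrite inE hg orbT.
have [P0 _ _] := irrP.
have s0 : \prod_(g <- s) g != 0.
  by rewrite prodf_seq_neq0; apply/allP => g /hs' [].
have := h P irrP; rewrite big_cons mulrCA => /(loc_dvd irrP) [].
  by rewrite mulf_neq0.
move=> r er.
have e2 : n%:F / (P * (c%:P%:P * \prod_(g <- s) g))%:F =
          r%:F / (c%:P%:P * \prod_(g <- s) g)%:F.
  rewrite er ![(P * _)%:F]rmorphM -mulf_div divff ?emb_eq0 //.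
  by rewrite mul1r.
rewrite e2; apply: IHs => // Q irrQ; rewrite -e2.
by have := h Q irrQ; rewrite big_cons mulrCA.
Qed.

(** By [loc_integral] a is regular along every curve other than x = 0, so x^k a is a
    polynomial p for some k, and [del] p = k p.  Then [del_eigen] applies. *)
Lemma dL_eq0 a : dL a = 0 -> exists c, a = cstF L c.
Proof.
move=> h; have [x0 _ _] := X1_irreducible F.
have fx0 : (X1 F)%:F != 0 by rewrite emb_eq0.
have [k hk] := loc_pole (X1_irreducible F) a.
have [P irrP|p ep] := @loc_all_poly ((X1 F)%:F ^+ k * a).
  have [|nx] := EM (like_x P).
    case=> b b0 eP; case: hk => s [z [hz ->]]; exists s, z; split=> // -[r er].
    by apply: hz; exists (b%:P%:P * r); rewrite er eP; ring.
  apply: (locM irrP); first exact/(locX irrP)/(loc_emb irrP).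
  have := @loc_integral P irrP nx a 0; rewrite h mulr0 expr0 mul1r; apply.
  exact: loc0 irrP.
have [p0|p0] := eqVneq p 0.
  exists 0; rewrite rmorph0; apply: (mulfI (expf_neq0 k fx0)).
  by rewrite mulr0 ep p0 rmorph0.
have e : del p = k%:R%:P%:P * p.
  apply: (@emb_inj _ L); rewrite -dL_emb -ep dLM h mulr0 addr0 dLXn dL_emb.
  rewrite del_X1 rmorphM -ep !polyC_natr rmorph_nat mulr_natl mulrnAl.
  by case: k {hk ep} => [|k] //=; rewrite -exprSr.
have [b [m [b0 /eqP hm eb]]] := del_eigen e p0.
rewrite eqr_nat in hm; rewrite -(eqP hm) in eb; exists b.
by apply: (mulfI (expf_neq0 k fx0)); rewrite ep eb rmorphM rmorphXn mulrC.
Qed.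

End LocalRing.

(** * The terms of Liouville form and their residues *)

(** Grouping the entries of the list by key. *)
Lemma sum_by_key (T : Type) (K : eqType) (V : nmodType) (key : T -> K) (a : T -> V) l :
  (forall k, \sum_(t <- l | key t == k) a t = 0) -> \sum_(t <- l) a t = 0.
Proof.
have [n] := ubnP (size l); elim: n l => // n IHn [|t l] hn h; first by rewrite big_nil.
rewrite (bigID (fun s => key s == key t)) /= h add0r -big_filter.
apply: IHn => [|k].
  rewrite /= eqxx /=; apply: leq_ltn_trans (_ : size l < n)%N => //.
  by rewrite size_filter count_size.
rewrite big_filter_cond; have [->|nk] := eqVneq k (key t).
  by rewrite big_pred0 // => s; case: eqP.
rewrite -[RHS](h k); apply: eq_bigl => s; case: (eqVneq (key s) k) => [->|]; rewrite ?andbF //.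
by rewrite nk.
Qed.

Lemma sum_by_key_cond (T : Type) (K : eqType) (V : nmodType) (key : T -> K) (a : T -> V) B l :
  (forall k, \sum_(t <- l | (key t == k) && B t) a t = 0) -> \sum_(t <- l | B t) a t = 0.
Proof.
move=> h; rewrite -big_filter; apply: (sum_by_key (key := key)) => k.
by rewrite big_filter_cond -[RHS](h k); apply: eq_bigl => t; rewrite andbC.
Qed.

(** The rational functions which, up to derivatives of elements of L, span x f for
    integrable f: [TEi] p mu is x^p / (y + mu), from an exponential integral, or from
    ln (y + mu) when p = 0; [TLi] n a is y^n x / (x - a), from polylogarithms, or from
    ln (x - a) when n = 0; [TLog] P is the logarithmic derivative of any other
    irreducible P. *)
Inductive term (F : fieldType) :=
  | TEi of int & F
  | TLi of nat & F
  | TLog of {poly {poly F}}.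

HB.instance Definition _ (F : fieldType) := gen_eqMixin (term F).
HB.instance Definition _ (F : fieldType) := gen_choiceMixin (term F).

Section Terms.
Variable F : numClosedFieldType.
Local Notation P2 := {poly {poly F}}.
Variable L : fractions P2.
Local Notation "p %:F" := (embed L p).
Implicit Types (p q P Q : P2) (a b : L).

Local Notation X := ((X1 F)%:F).
Local Notation Y := (('X : P2)%:F).

Definition yadd (mu : F) : P2 := 'X + mu%:P%:P.

Definition tval (t : term F) : L :=
  match t with
  | TEi p mu => X ^ p / (yadd mu)%:F
  | TLi n al => Y ^+ n * X / (lin al)%:P%:F
  | TLog P => (del P)%:F / P%:F
  end.

(** The curve along which the term has its pole. *)
Definition tprime (t : term F) : P2 :=
  match t with
  | TEi _ mu => yadd mu
  | TLi _ al => (lin al)%:P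
  | TLog P => P
  end.

(** A normalization that singles out one polynomial in each class of associates, so
    that distinct normed irreducible polynomials do not divide one another. *)
Definition normed P := lead_coef (lead_coef P) = 1.

Definition term_ok (t : term F) : Prop :=
  match t with
  | TEi _ _ => True
  | TLi _ al => al != 0
  | TLog P => [/\ irreducible_elt P, normed P, P <> X1 F, forall mu, P <> yadd mu
              & forall al, P <> (lin al)%:P]
  end.

Definition tsum (l : seq (F * term F)) : L := \sum_(t <- l) cstF L t.1 * tval t.2.

Definition all_ok (l : seq (F * term F)) := forall t : F * term F, t \in l -> term_ok t.2.

Lemma normed_yadd mu : normed (yadd mu).
Proof.
by rewrite /normed lead_coefDl ?lead_coefX ?lead_coef1 // size_polyX ltnS size_polyC_leq1.
Qed.

Lemma normed_lin al : normed (lin al)%:P.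
Proof. by rewrite /normed lead_coefC lead_coefXsubC. Qed.

Lemma normed_dvd P Q : irreducible_elt P -> irreducible_elt Q -> normed P -> normed Q ->
  dvd2 P Q -> P = Q.
Proof.
move=> [P0 /negP Pu irrP] [_ _ irrQ] nP nQ [r e].
have [//|/unit2P [c c0 er]] := irrQ _ _ e.
move: nQ; rewrite /normed e er lead_coefM lead_coefC lead_coefM lead_coefC nP mul1r => c1.
by rewrite c1 !polyC1 mulr1.
Qed.

Lemma tprime_irr t : term_ok t -> irreducible_elt (tprime t).
Proof.
by case: t => [p mu|n al|P] //= ok; [apply: yadd_irreducible|apply: lin_irreducible|case: ok].
Qed.

Lemma tprime_normed t : term_ok t -> normed (tprime t).
Proof.
by case: t => [p mu|n al|P] //= ok; [apply: normed_yadd|apply: normed_lin|case: ok].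
Qed.

Lemma size_yadd mu : size (yadd mu) = 2%N.
Proof. by rewrite size_XaddC. Qed.

Lemma normed_X1 : normed (X1 F).
Proof. by rewrite X1E; apply: normed_lin. Qed.

Lemma yadd_neq_lin mu (q : {poly F}) : yadd mu <> q%:P.
Proof.
by move/(congr1 (size \o polyseq)); rewrite /= size_yadd size_polyC; case: (q != 0).
Qed.

Lemma lin_inj : injective (@lin F).
Proof. by move=> a b /addrI /oppr_inj /polyC_inj. Qed.

Lemma tprime_nx t : term_ok t -> tprime t <> X1 F.
Proof.
case: t => [p mu|n al|P] /= ok; last by case: ok.
  exact: yadd_neq_lin.
by rewrite X1E => /polyC_inj /lin_inj al0; rewrite al0 eqxx in ok.
Qed.

Lemma like_x_normed P : normed P -> like_x P -> P = X1 F.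
Proof.
move=> + [a _ e]; rewrite e /normed lead_coefM lead_coefC lead_coefM lead_coefC.
by rewrite normed_X1 mulr1 => ->; rewrite !polyC1 mul1r.
Qed.

Lemma yadd_inj : injective yadd.
Proof. by move=> a b /addrI /polyC_inj /polyC_inj. Qed.

Lemma X_neq0 : X != 0.
Proof. by rewrite emb_eq0; case: (X1_irreducible F). Qed.

(** x is a unit of the local ring of every prime other than x. *)
Lemma loc_Xz P (p : int) : irreducible_elt P -> ~ dvd2 P (X1 F) -> loc P (X ^ p).
Proof.
move=> irrP nd; case: p => n.
  by rewrite -exprnP; apply: locX => //; apply: loc_emb.
rewrite NegzE -exprnN -exprVn; apply: locX => //.
by rewrite -div1r -(rmorph1 (embed L)); apply: loc_frac.
Qed.

Lemma loc_tval P t : irreducible_elt P -> normed P -> P <> X1 F -> term_ok t ->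
  tprime t <> P -> loc P (tval t).
Proof.
move=> irrP nP Px ok ntP.
have nx : ~ dvd2 P (X1 F).
  by move/(normed_dvd irrP (X1_irreducible F) nP normed_X1).
have nd : ~ dvd2 P (tprime t).
  by move/(normed_dvd irrP (tprime_irr ok) nP (tprime_normed ok)) => e; apply: ntP.
case: t ok ntP nd => [p mu|n al|Q] /= _ _ nd.
- apply: (locM irrP); first exact: loc_Xz.
  by rewrite -div1r -(rmorph1 (embed L)); apply: loc_frac.
- apply: (locM irrP); first by rewrite -rmorphXn -rmorphM; apply: loc_emb.
  by rewrite -div1r -(rmorph1 (embed L)); apply: loc_frac.
- exact: loc_frac.
Qed.

Lemma loc_Ptval P t : irreducible_elt P -> normed P -> P <> X1 F -> term_ok t ->
  loc P (P%:F * tval t).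
Proof.
move=> irrP nP Px ok; have [e|ne] := eqVneq (tprime t) P; last first.
  by apply: (locM irrP); [apply: loc_emb | apply: loc_tval => //; apply/eqP].
have fP0 : P%:F != 0 by rewrite emb_eq0; case: irrP.
have nx : ~ dvd2 P (X1 F).
  by move/(normed_dvd irrP (X1_irreducible F) nP normed_X1).
case: t ok e => [p mu|n al|Q] /= ok e; rewrite e mulrCA divff // mulr1.
- exact: loc_Xz.
- by rewrite -rmorphXn -rmorphM; apply: loc_emb.
- exact: loc_emb.
Qed.

(** Terms with the same prime y + mu combine into U(x) / ((y + mu) x^k): the numerator
    is constant in y, so it can only be regular along y + mu when it vanishes.  The
    next two lemmas have the same purpose. *)
Lemma shape_Ei mu (l : seq (F * term F)) :
  (forall t : F * term F, t \in l -> exists p : int, t.2 = TEi p mu) ->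
  exists (U : {poly F}) k, tsum l = U%:P%:F / ((yadd mu) * X1 F ^+ k)%:F.
Proof.
have y0 : (yadd mu)%:F != 0 by rewrite emb_eq0 -size_poly_eq0 size_yadd.
move=> hl; rewrite /tsum big_seq; elim/big_rec: _ => [|t b /hl [p ->] [U [k ->]]].
  by exists 0, 0%N; rewrite polyC0 rmorph0 mul0r.
rewrite /= rmorphM rmorphXn.
have xn m : X ^+ m != 0 by rewrite expf_neq0 ?X_neq0.
case: p => m.
  rewrite -exprnP; exists ((t.1)%:P * 'X ^+ m * 'X^k + U), k.
  have -> : ((t.1)%:P * 'X ^+ m * 'X^k + U)%:P%:F =
      cstF L t.1 * X ^+ m * X ^+ k + U%:P%:F.
    by rewrite !polyCD !polyCM !polyC_exp !rmorphD !rmorphM !rmorphXn.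
  by rewrite rmorphM rmorphXn; field; rewrite y0 xn.
rewrite NegzE -exprnN; exists ((t.1)%:P * 'X^k + U * 'X ^+ m.+1), (k + m.+1)%N.
have -> : ((t.1)%:P * 'X^k + U * 'X ^+ m.+1)%:P%:F =
    cstF L t.1 * X ^+ k + U%:P%:F * X ^+ m.+1.
  by rewrite !polyCD !polyCM !polyC_exp !rmorphD !rmorphM !rmorphXn.
rewrite exprD !rmorphM !rmorphXn.
have e : forall (K : fieldType) (c x z y u : K), x != 0 -> z != 0 -> y != 0 ->
  c * (z^-1 / y) + u / (y * x) = (c * x + u * z) / (y * (x * z)).
  by move=> K c x z y u ? ? ?; field; apply/and3P.
exact: (e _ _ _ _ _ _ (xn k) (xn m.+1) y0).
Qed.

Lemma shape_Li al (l : seq (F * term F)) :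
  (forall t : F * term F, t \in l -> exists n, t.2 = TLi n al) ->
  exists (R : {poly F}), tsum l = (X1 F * map_poly polyC R)%:F / ((lin al)%:P * 1)%:F.
Proof.
move=> hl; rewrite /tsum big_seq; elim/big_rec: _ => [|t b /hl [n ->] [R ->]].
  by exists 0; rewrite !rmorph0 mulr0 rmorph0 mul0r.
exists (t.1 *: 'X^n + R); rewrite /= mulr1.
have -> : map_poly polyC (t.1 *: 'X^n + R) = t.1%:P%:P * 'X^n + map_poly polyC R.
  by rewrite rmorphD /= -mul_polyC rmorphM /= map_polyC map_polyXn.
rewrite mulrDr [X in _ = X / _]rmorphD mulrDl; congr (_ + _).
by rewrite !rmorphM rmorphXn -/(cstF L t.1); ring.
Qed.

Lemma shape_Log P (l : seq (F * term F)) :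
  (forall t : F * term F, t \in l -> t.2 = TLog P) ->
  exists c : F, tsum l = (c%:P%:P * del P)%:F / (P * 1)%:F.
Proof.
move=> hl; rewrite /tsum big_seq; elim/big_rec: _ => [|t b /hl -> [c ->]].
  by exists 0; rewrite !polyC0 mul0r rmorph0 mul0r.
exists (t.1 + c); rewrite !polyCD mulrDl rmorphD mulrDl mulr1; congr (_ + _).
by rewrite rmorphM mulrA.
Qed.

Lemma tsum_filter (B : pred (F * term F)) l :
  tsum (filter B l) = \sum_(t <- l | B t) cstF L t.1 * tval t.2.
Proof. by rewrite /tsum big_filter. Qed.

(** By the three shapes P would divide the numerator, which is U(x) for P = y + mu, x
    R(y) for P = x - a with a nonzero, and c [del] P otherwise; this is only possible
    when the numerator is zero. *)
Lemma shape_vanish P (l : seq (F * term F)) : all_ok l ->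
  (forall t : F * term F, t \in l -> tprime t.2 = P) -> loc P (tsum l) -> tsum l = 0.
Proof.
case el : l => [|t0 l0]; first by rewrite /tsum big_nil.
rewrite -el => ok hl; have h0 : t0 \in l by rewrite el mem_head.
have irrP : irreducible_elt P by rewrite -(hl _ h0); apply/tprime_irr/ok.
have nP : normed P by rewrite -(hl _ h0); apply/tprime_normed/ok.
have Px : P <> X1 F by rewrite -(hl _ h0); apply/tprime_nx/ok.
have nx : ~ dvd2 P (X1 F).
  by move/(normed_dvd irrP (X1_irreducible F) nP normed_X1).
have := hl _ h0; have := ok _ h0; case: t0.2 => [p mu|n al|Q] /= ok0 e0.
- have [|U [k ->]] := @shape_Ei mu l.
    move=> t ht; have := hl _ ht; have := ok _ ht; case: t.2 => [q nu|n al|Q] /= okt.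
    + by rewrite -e0 => /yadd_inj ->; exists q.
    + by rewrite -e0 => /esym /yadd_neq_lin.
    + by case: okt => _ _ _ h _; rewrite -e0 => /h.
  rewrite e0 => /(loc_dvd irrP) [].
    by rewrite expf_neq0 //; case: (X1_irreducible F).
  move=> r er; have [-> |U0] := eqVneq U 0; first by rewrite polyC0 rmorph0 mul0r.
  have r0 : r != 0 by apply: contraNneq U0 => z; rewrite -polyC_eq0 er z mulr0.
  have := congr1 (size \o polyseq) er; rewrite /= size_polyC U0 size_mul //.
    have : (0 < size r)%N by rewrite size_poly_gt0.
    by rewrite -e0 size_yadd; case: (size r) => // m; rewrite addSn addnS.
  by case: irrP.
- have [|R ->] := @shape_Li al l.
    move=> t ht; have := hl _ ht; have := ok _ ht; case: t.2 => [q nu|m be|Q] /= okt.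
    + by rewrite -e0 => /yadd_neq_lin.
    + by rewrite -e0 => /polyC_inj /lin_inj ->; exists m.
    + by case: okt => _ _ _ _ h; rewrite -e0 => /h.
  rewrite e0 => /(loc_dvd irrP); rewrite oner_eq0 => /(_ isT); rewrite -e0 => /atx_eq0P.
  rewrite rmorphM /= /atx map_polyC /= -map_poly_comp.
  have -> : map_poly (horner_eval al \o polyC) R = R.
    by rewrite map_poly_id // => c _ /=; rewrite /horner_eval hornerC.
  rewrite /horner_eval hornerX => /eqP; rewrite mulf_eq0 polyC_eq0 (negPf ok0) /=.
  by move/eqP=> ->; rewrite map_poly0 mulr0 rmorph0 mul0r.
- have [|c ->] := @shape_Log Q l.
    move=> t ht; have := hl _ ht; have := ok _ ht; case: t.2 => [q nu|m be|Q'] /= okt.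
    + by move: ok0 => [_ _ _ h _]; rewrite -e0 => /esym /h.
    + by move: ok0 => [_ _ _ _ h]; rewrite -e0 => /esym /h.
    + by move=> ->; rewrite e0.
  rewrite e0 => /(loc_dvd irrP); rewrite oner_eq0 => /(_ isT).
  case/(irreducible_prime irrP) => [h|]; last first.
    by case/(ndvd_del irrP) => /(like_x_normed nP).
  have [->|c0] := eqVneq c 0; first by rewrite !polyC0 mul0r rmorph0 mul0r.
  case: (ndvd1 irrP); have [r er] := h; exists (r * (c^-1)%:P%:P).
  by rewrite mulrA -er -!polyCM divff.
Qed.

(** The terms have at most simple poles along P, hence so does [dL] H, which is then
    regular by [loc_simple_pole]; the terms attached to P have to be regular as well,
    and [shape_vanish] applies. *)
Theorem terms_vanish P (H : L) l : irreducible_elt P -> normed P -> P <> X1 F ->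
  all_ok l -> loc P (dL H + tsum l) ->
  tsum [seq t <- l | tprime t.2 == P] = 0.
Proof.
move=> irrP nP Px ok hl.
have nx : ~ like_x P by move/(like_x_normed nP).
have okf (B : pred (F * term F)) : all_ok (filter B l).
  by move=> t; rewrite mem_filter => /andP[_]; apply: ok.
have split_l : tsum l = tsum [seq t <- l | tprime t.2 == P] + tsum [seq t <- l | tprime t.2 != P].
  by rewrite !tsum_filter /tsum (bigID (fun t => tprime t.2 == P)).
have loc2 : loc P (tsum [seq t <- l | tprime t.2 != P]).
  rewrite /tsum big_seq; apply: (loc_sum irrP) => t; rewrite mem_filter => /andP[/eqP ht hin].
  by apply: (locM irrP); [apply: loc_cst | apply: loc_tval => //; apply: ok].
have loc1 : loc P (P%:F * tsum l).
  rewrite /tsum big_seq mulr_sumr; apply: (loc_sum irrP) => t ht; rewrite mulrCA.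
  by apply: (locM irrP); [apply: loc_cst | apply: loc_Ptval => //; apply: ok].
have locH : loc P (dL H).
  apply: (loc_simple_pole irrP nx); rewrite -[dL H](addrK (tsum l)) mulrBr.
  by apply: (locB irrP) => //; apply: (locM irrP) => //; apply: loc_emb.
apply: (@shape_vanish P) => //; first by move=> t; rewrite mem_filter => /andP[/eqP].
have -> : tsum [seq t <- l | tprime t.2 == P] =
  (dL H + tsum l) - dL H - tsum [seq t <- l | tprime t.2 != P].
  by rewrite split_l; ring.
by apply: (locB irrP) => //; apply: (locB irrP).
Qed.

Corollary terms_vanish0 (H : L) l : all_ok l -> dL H + tsum l = 0 -> tsum l = 0.
Proof.
move=> ok h; rewrite /tsum; apply: (@sum_by_key _ P2 _ (fun t => tprime t.2)) => P.
have [/hasP [t ht /eqP et]|hn] := boolP (has (fun t => tprime t.2 == P) l); last first.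
  rewrite big_seq_cond big_pred0 // => t; apply/negbTE; apply: contra hn => /andP[h1 h2].
  by apply/hasP; exists t.
rewrite -tsum_filter; apply: (@terms_vanish P H) => //.
- by rewrite -et; apply/tprime_irr/ok.
- by rewrite -et; apply/tprime_normed/ok.
- by rewrite -et; apply/tprime_nx/ok.
- by rewrite h; apply: loc0; rewrite -et; apply/tprime_irr/ok.
Qed.

End Terms.

(** * Order bounds at a place with a uniformizing exponential *)

Section Places.
Variable F : numClosedFieldType.
Local Notation P2 := {poly {poly F}}.
Variable L : fractions P2.
Local Notation "p %:F" := (embed L p).
Implicit Types (p q P Q : P2) (a b : L) (s z : {poly F}).

Local Notation X := ((X1 F)%:F).
Local Notation Y := (('X : P2)%:F).

(** Polynomials in y alone. *)
Definition inY s : P2 := map_poly polyC s.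
HB.instance Definition _ := GRing.RMorphism.copy inY (map_poly (@polyC F)).

Lemma inY_eq0 s : (inY s == 0) = (s == 0).
Proof.
apply/eqP/eqP => [/polyP h|->]; last by rewrite rmorph0.
apply/polyP => i; have := h i; rewrite coef_map !coef0 => /eqP.
by rewrite polyC_eq0 => /eqP.
Qed.

Lemma del_inY s : del (inY s) = inY s^`().
Proof.
apply/polyP => i; rewrite coef_del /inY !coef_map /= derivC mulr0 add0r coef_deriv.
by rewrite polyCMn.
Qed.

(** The elements of F(y), which serve as leading coefficients at the places x = 0 and
    x = oo. *)
Definition homY a := exists s z, z != 0 /\ a = (inY s)%:F / (inY z)%:F.

Lemma homYD a b : homY a -> homY b -> homY (a + b).
Proof.
move=> [s [z [z0 ->]]] [t [w [w0 ->]]]; exists (s * w + t * z), (z * w).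
rewrite mulf_neq0 //; split=> //.
by rewrite addf_div ?emb_eq0 ?inY_eq0 // rmorphD !rmorphM !rmorphD !rmorphM.
Qed.

Lemma homYM a b : homY a -> homY b -> homY (a * b).
Proof.
move=> [s [z [z0 ->]]] [t [w [w0 ->]]]; exists (s * t), (z * w).
by rewrite mulf_neq0 //; split=> //; rewrite mulf_div !rmorphM.
Qed.

Lemma homYc c : homY (cstF L c).
Proof.
exists c%:P, 1; rewrite oner_neq0; split=> //.
by rewrite !rmorph1 divr1 /inY map_polyC.
Qed.

Lemma homY_dL a : homY a -> homY (dL a).
Proof.
move=> [s [z [z0 ->]]]; exists (s^`() * z - s * z^`()), (z ^+ 2).
rewrite expf_neq0 //; split=> //; rewrite dL_frac ?inY_eq0 // !del_inY.
by rewrite !expr2 !rmorphB !rmorphM.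
Qed.

(** [ord m a] reads: the pole of a at the place has order at most m.  The element u
    has a pole of order 1 and [dL] u is a constant multiple of u; an element of order
    m.+1 has a leading term u^(m.+1) h with h in F(y) ([ord_init]), which is unique
    ([ord_uniq]).  The weight w t bounds the order of the term t, which is purely
    leading when w t is positive.  The instances are u = x at x = oo and u = 1/x at x
    = 0. *)
Section AbstractPlace.
Variables (ord : nat -> L -> Prop) (u : L) (eps : F) (w : term F -> nat).
Hypothesis ordD : forall m a b, ord m a -> ord m b -> ord m (a + b).
Hypothesis ordZ : forall m c a, ord m a -> ord m (cstF L c * a).
Hypothesis ordS : forall m a, ord m a -> ord m.+1 a.
Hypothesis ord_dL : forall m a, ord m a -> ord m (dL a).
Hypothesis ord_ex : forall a, exists m, ord m a.
Hypothesis ord_init : forall m a, ord m.+1 a -> exists h, homY h /\ ord m (a - u ^+ m.+1 * h).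
Hypothesis ord_uniq : forall m h, homY h -> ord m (u ^+ m.+1 * h) -> h = 0.
Hypothesis ord_cst : forall c, ord 0 (cstF L c).
Hypothesis du : dL u = cstF L eps * u.
Hypothesis ord_term : forall t, term_ok t -> ord (w t) (tval L t).
Hypothesis hom_term : forall t, term_ok t -> (0 < w t)%N ->
  exists h, homY h /\ tval L t = u ^+ (w t) * h.

Lemma ord_le m n a : (m <= n)%N -> ord m a -> ord n a.
Proof. by move=> /subnK <-; elim: (n - m)%N => // k IHk /IHk /ordS. Qed.

Lemma ordN m a : ord m a -> ord m (- a).
Proof. by move/(@ordZ _ (-1)); rewrite rmorphN rmorph1 mulN1r. Qed.

Lemma ordB m a b : ord m a -> ord m b -> ord m (a - b).
Proof. by move=> ha hb; apply: ordD => //; apply: ordN. Qed.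

Lemma ord0 m : ord m 0.
Proof. by apply: (@ord_le 0) => //; rewrite -(rmorph0 (cstF L)); apply: ord_cst. Qed.

Lemma ord_tsum m (l : seq (F * term F)) : all_ok l ->
  (forall t : F * term F, t \in l -> (w t.2 <= m)%N) -> ord m (tsum L l).
Proof.
move=> ok hm; rewrite /tsum big_seq; elim/big_rec: _ => [|t a ht ha]; first exact: ord0.
by apply: ordD => //; apply/ordZ/(ord_le (hm _ ht))/ord_term/ok.
Qed.

Lemma hom_tsum m (l : seq (F * term F)) : all_ok l ->
  (forall t : F * term F, t \in l -> w t.2 = m.+1) ->
  exists h, homY h /\ tsum L l = u ^+ m.+1 * h.
Proof.
move=> ok hm; rewrite /tsum big_seq; elim/big_rec: _ => [|t a ht [h [hh ->]]].
  by exists (cstF L 0); split; [apply: homYc | rewrite rmorph0 mulr0].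
have [|k [hk ->]] := hom_term (ok _ ht); first by rewrite (hm _ ht).
exists (cstF L t.1 * k + h); split; first by apply: homYD => //; apply: homYM => //; apply: homYc.
by rewrite (hm _ ht); ring.
Qed.

Lemma all_ok_filter (B : pred (F * term F)) l : all_ok l -> all_ok (filter B l).
Proof. by move=> ok t; rewrite mem_filter => /andP[_]; apply: ok. Qed.

Lemma tsum_split (B : pred (F * term F)) l :
  tsum L l = tsum L (filter B l) + tsum L [seq t <- l | ~~ B t].
Proof. by rewrite !tsum_filter /tsum (bigID B). Qed.

(** By descent on m > M: if u^m h is the leading term of H and u^m k that of the sum
    of terms, then [dL] (u^m h) + u^m k = 0 as the total has order at most M.  By
    [terms_vanish0] the terms cancel, so u^m h is a constant by [dL_eq0], which has
    order 0; hence h = 0. *)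
Theorem place_bound M (H : L) l : all_ok l -> ord M (dL H + tsum L l) ->
  ord M H /\ tsum L [seq t <- l | (M < w t.2)%N] = 0.
Proof.
move=> ok hM.
suff [d] : exists d, ord (M + d) H /\ tsum L [seq t <- l | (M + d < w t.2)%N] = 0.
  elim: d => [|d IHd]; first by rewrite addn0.
  rewrite addnS; set m := (M + d)%N => -[hH hs]; apply: IHd; rewrite -/m.
  have [h [hh ord_rest]] := ord_init hH.
  have okf B := @all_ok_filter B _ ok.
  have [|k [hk ek]] := @hom_tsum m [seq t <- l | w t.2 == m.+1] (okf _).
    by move=> t; rewrite mem_filter => /andP[/eqP].
  have etail : tsum L [seq t <- l | (m < w t.2)%N] = u ^+ m.+1 * k.
    rewrite -ek (tsum_split (fun t => w t.2 == m.+1)) -!filter_predI.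
    have -> : [seq t <- l | predI (fun t => w t.2 == m.+1) (fun t => m < w t.2)%N t] =
        [seq t <- l | w t.2 == m.+1].
      by apply: eq_filter => t /=; case: eqP => // ->; rewrite ltnSn.
    rewrite -[RHS]addr0; congr (_ + _); rewrite -[RHS]hs; congr tsum.
    by apply: eq_filter => t /=; rewrite ltn_neqAle [RHS]ltn_neqAle -ltn_neqAle andbC; lia.
  have e0 : dL (u ^+ m.+1 * h) + u ^+ m.+1 * k = 0.
    have -> : dL (u ^+ m.+1 * h) + u ^+ m.+1 * k =
        u ^+ m.+1 * (cstF L (m.+1%:R * eps) * h + dL h + k).
      rewrite dLM dLXn du rmorphM rmorph_nat -mulr_natl /= exprS; ring.
    have hom : homY (cstF L (m.+1%:R * eps) * h + dL h + k).
      apply: homYD => //; apply: homYD; last exact: homY_dL.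
      by apply: homYM => //; apply: homYc.
    rewrite (ord_uniq (m := m) hom) ?mulr0 //.
    have -> : u ^+ m.+1 * (cstF L (m.+1%:R * eps) * h + dL h + k) =
        (dL H + tsum L l) - dL (H - u ^+ m.+1 * h) - tsum L [seq t <- l | ~~ (m < w t.2)%N].
      rewrite [tsum L l](tsum_split (fun t => m < w t.2)%N) etail raddfB /= dLM dLXn du.
      rewrite rmorphM rmorph_nat -mulr_natl /= exprS; ring.
    apply: ordB; last by apply: ord_tsum => // t; rewrite mem_filter -leqNgt => /andP[].
    by apply: ordB; [apply: ord_le hM; apply: leq_addr | apply: ord_dL].
  rewrite -ek in e0; have v0 := terms_vanish0 (okf _) e0.
  rewrite v0 addr0 in e0; have [c ec] := dL_eq0 e0.
  have h0 : h = 0.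
    by apply: (ord_uniq hh (m := m)); rewrite ec; apply: (@ord_le 0).
  split; last by rewrite etail -ek.
  by move: ord_rest; rewrite h0 mulr0 subr0.
(* the order of H and the weights give some bound, from which the descent starts *)
have [d1 hd1] := ord_ex H; exists (d1 + \sum_(t <- l) w t.2)%N; split.
  by apply: ord_le hd1; rewrite addnCA leq_addr.
rewrite (_ : filter _ _ = [::]) /tsum ?big_nil //; apply/eqP; rewrite -size_eq0 size_filter.
rewrite -leqn0 leqNgt -has_count; apply/hasPn => t ht; rewrite -leqNgt addnA.
by apply: leq_trans (leq_addl _ _); rewrite (big_rem t) //= leq_addr.
Qed.

End AbstractPlace.

End Places.

(** * The places x = oo and x = 0 *)

(** Subtracting the leading coefficient of S / Z, in cross-multiplied form. *)
Lemma top_cancel (R : idomainType) (S Z : {poly R}) m :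
  (size S <= size Z + m.+1)%N ->
  (size (S * (lead_coef Z)%:P - 'X^(m.+1) * (S`_(size Z + m))%:P * Z)%R <= size Z + m)%N.
Proof.
move=> hS; apply/leq_sizeP => j hj.
rewrite coefB coefMC -mulrA coefXnM mul_polyC coefZ.
have [ej|nj] := eqVneq j (size Z + m)%N; last first.
  have {hj} hj : (size Z + m < j)%N by rewrite ltn_neqAle eq_sym nj.
  rewrite [S`_j]nth_default; last by apply: leq_trans hS _; rewrite addnS.
  rewrite mul0r sub0r; case: ifP => _; first by rewrite oppr0.
  rewrite [Z`__]nth_default ?mulr0 ?oppr0 //.
  by rewrite leq_subRL; move: (size Z) hj => n; lia.
rewrite ej; have [->|Z0] := eqVneq Z 0.
  by rewrite lead_coef0 mulr0 coef0 mulr0 sub0r; case: ifP; rewrite oppr0.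
have : (0 < size Z)%N by rewrite size_poly_gt0.
rewrite lead_coefE; case: (size Z) => // n _.
by rewrite ifF ?addSnnS ?addnK ?subrr //; lia.
Qed.

Lemma top_unique (R : idomainType) (S Z : {poly R}) m (s z : R) : Z != 0 ->
  (size S <= size Z + m)%N -> 'X^(m.+1) * s%:P * Z = S * z%:P -> s = 0.
Proof.
move=> Z0 hS e; have := congr1 (fun p : {poly R} => p`_(size Z + m)) e.
have : (0 < size Z)%N by rewrite size_poly_gt0.
rewrite -mulrA coefXnM mul_polyC coefZ coefMC [S`__]nth_default // mul0r.
have := Z0; rewrite -lead_coef_eq0 lead_coefE; case: (size Z) => // n lz0 _.
rewrite ifF; last by lia.
by rewrite addSnnS addnK => /eqP; rewrite mulf_eq0 (negPf lz0) orbF => /eqP.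
Qed.

Section DegreePlace.
Variable F : numClosedFieldType.
Local Notation P2 := {poly {poly F}}.
Variable L : fractions P2.
Local Notation "p %:F" := (embed L p).
Implicit Types (p q P Q : P2) (a b : L).

Variable sz : P2 -> nat.
Hypothesis szM : forall p q, p != 0 -> q != 0 -> sz (p * q) = (sz p + sz q).-1.
Hypothesis szD : forall p q, (sz (p + q) <= maxn (sz p) (sz q))%N.
Hypothesis szN : forall p, sz (- p) = sz p.
Hypothesis sz0 : sz 0 = 0%N.
Hypothesis sz_gt0 : forall p, p != 0 -> (0 < sz p)%N.
Hypothesis sz_del : forall p, (sz (del p) <= sz p)%N.
Hypothesis szC : forall c : F, (sz c%:P%:P <= 1)%N.

(** Order at infinity for the degree [sz]: a fraction whose numerator exceeds its
    denominator in degree by at most m. *)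
Definition ordd (m : nat) a :=
  exists S Z, [/\ Z != 0, a = S%:F / Z%:F & (sz S <= sz Z + m)%N].

Lemma szM_le p q : (sz (p * q) <= (sz p + sz q).-1)%N.
Proof.
have [->|p0] := eqVneq p 0; first by rewrite mul0r sz0.
have [->|q0] := eqVneq q 0; first by rewrite mulr0 sz0.
by rewrite szM.
Qed.

Lemma orddD m a b : ordd m a -> ordd m b -> ordd m (a + b).
Proof.
move=> [S [Z [Z0 -> hS]]] [T [W [W0 -> hT]]]; exists (S * W + T * Z), (Z * W).
split; first by rewrite mulf_neq0.
  by rewrite addf_div ?emb_eq0 // rmorphD !rmorphM.
apply: leq_trans (szD _ _) _; rewrite [sz (Z * W)]szM // geq_max.
have h1 := szM_le S W; have h2 := szM_le T Z.
have g1 := sz_gt0 Z0; have g2 := sz_gt0 W0.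
apply/andP; split; [apply: leq_trans h1 _ | apply: leq_trans h2 _]; lia.
Qed.

Lemma orddM m n a b : ordd m a -> ordd n b -> ordd (m + n) (a * b).
Proof.
move=> [S [Z [Z0 -> hS]]] [T [W [W0 -> hT]]]; exists (S * T), (Z * W).
split; first by rewrite mulf_neq0.
  by rewrite mulf_div !rmorphM.
apply: leq_trans (szM_le _ _) _; rewrite [sz (Z * W)]szM //.
have := sz_gt0 Z0; have := sz_gt0 W0; lia.
Qed.

Lemma ordd_le m n a : (m <= n)%N -> ordd m a -> ordd n a.
Proof. by move=> h [S [Z [Z0 -> hS]]]; exists S, Z; split=> //; rewrite (leq_trans hS) ?leq_add2l. Qed.

Lemma ordd_emb p : ordd (sz p) p%:F.
Proof. by exists p, 1; rewrite oner_neq0 rmorph1 divr1; split=> //; apply: leq_addl. Qed.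

Lemma ordd_frac p q m : q != 0 -> (sz p <= sz q + m)%N -> ordd m (p%:F / q%:F).
Proof. by move=> q0 h; exists p, q. Qed.

Lemma ordd_cst c : ordd 0 (cstF L c).
Proof.
exists c%:P%:P, 1; rewrite oner_neq0 rmorph1 divr1; split=> //.
by apply: leq_trans (szC c) _; rewrite addn0; apply/sz_gt0/oner_neq0.
Qed.

Lemma orddZ m c a : ordd m a -> ordd m (cstF L c * a).
Proof. by move=> h; rewrite -[m]add0n; apply: orddM => //; apply: ordd_cst. Qed.

Lemma ordd_dL m a : ordd m a -> ordd m (dL a).
Proof.
move=> [S [Z [Z0 -> hS]]]; rewrite dL_frac //; apply: ordd_frac.
  by rewrite expf_neq0.
apply: leq_trans (szD _ _) _; rewrite szN expr2 [sz (Z * Z)]szM // geq_max.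
have h1 := szM_le (del S) Z; have h2 := szM_le S (del Z).
have := sz_gt0 Z0; have := sz_del S; have := sz_del Z.
move=> h3 h4 h5; apply/andP; split; [apply: leq_trans h1 _ | apply: leq_trans h2 _]; lia.
Qed.

Lemma ordd_ex a : exists m, ordd m a.
Proof.
have [n [d [d0 ->]]] := fracE a; exists (sz n); apply: ordd_frac => //.
exact: leq_addl.
Qed.

Lemma ordd_poly m p : ordd m p%:F -> (sz p <= m.+1)%N.
Proof.
move=> [S [Z [Z0 e hS]]]; have [->|p0] := eqVneq p 0; first by rewrite sz0.
have eS : S = p * Z.
  by apply: (@emb_inj _ L); rewrite rmorphM /= e divfK ?emb_eq0.
have := sz_gt0 Z0; have := sz_gt0 p0; move: hS; rewrite eS szM //; lia.
Qed.

End DegreePlace.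

Section ConcretePlaces.
Variable F : numClosedFieldType.
Local Notation P2 := {poly {poly F}}.
Variable L : fractions P2.
Local Notation "p %:F" := (embed L p).
Implicit Types (p q P Q : P2) (a b : L).
Local Notation X := ((X1 F)%:F).
Local Notation Y := (('X : P2)%:F).

Definition ordI := @ordd F L (@sizeY F).
Definition ordY := @ordd F L (fun p => size p).

Lemma swapM p q : swapXY (p * q) = swapXY p * swapXY q. Proof. exact: rmorphM. Qed.
Lemma swapB p q : swapXY (p - q) = swapXY p - swapXY q. Proof. exact: raddfB. Qed.
Lemma swapX p n : swapXY (p ^+ n) = swapXY p ^+ n. Proof. exact: rmorphXn. Qed.

Lemma sizeYD p q : (sizeY (p + q) <= maxn (sizeY p) (sizeY q))%N.
Proof. by rewrite !sizeYE rmorphD; apply: size_polyD. Qed.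
Lemma sizeYN p : sizeY (- p) = sizeY p.
Proof.
have e : swapXY (- p) = - swapXY p by exact: raddfN.
by rewrite !sizeYE e size_polyN.
Qed.
Lemma sizeY0 : sizeY (0 : P2) = 0%N.
Proof. by apply/eqP; rewrite sizeY_eq0. Qed.
Lemma sizeYgt0 p : p != 0 -> (0 < sizeY p)%N.
Proof. by rewrite sizeY_gt0. Qed.
Lemma sizeYC (c : F) : (sizeY (c%:P%:P) <= 1)%N.
Proof. by rewrite sizeYE swapXY_polyC map_polyC size_polyC_leq1. Qed.
Lemma sizeC (c : F) : (size (c%:P%:P : P2) <= 1)%N.
Proof. exact: size_polyC_leq1. Qed.
Lemma sizeM p q : p != 0 -> q != 0 -> size (p * q) = (size p + size q).-1.
Proof. exact: size_mul. Qed.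
Lemma size_gt0 p : p != 0 -> (0 < size p)%N.
Proof. by rewrite size_poly_gt0. Qed.

Lemma sizeY_X1 n : sizeY (X1 F ^+ n) = n.+1.
Proof. by rewrite sizeYE rmorphXn /= swapXY_Y size_polyXn. Qed.

Lemma sizeY_inY (s : {poly F}) : (sizeY (inY s) <= 1)%N.
Proof. by rewrite sizeYE /inY swapXY_map_polyC size_polyC_leq1. Qed.

Lemma inY_yadd (mu : F) : inY ('X + mu%:P) = yadd mu.
Proof. by rewrite /inY rmorphD /= map_polyX map_polyC. Qed.

Lemma yadd_neq0 (mu : F) : yadd mu != 0 :> P2.
Proof. by rewrite -size_poly_eq0 size_yadd. Qed.

Lemma homY_yadd (mu : F) : homY (L := L) ((yadd mu)%:F^-1).
Proof.
exists 1, ('X + mu%:P); rewrite -inY_eq0 inY_yadd yadd_neq0; split=> //.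
by rewrite !rmorph1 div1r.
Qed.

(** At x = oo only the terms x^p / (y + mu) with p > 0 have a pole. *)
Definition wI (t : term F) : nat := if t is TEi (Posz n) _ then n else 0%N.

Lemma ordI_init m a : ordI m.+1 a -> exists h, homY h /\ ordI m (a - X ^+ m.+1 * h).
Proof.
move=> [S [Z [Z0 -> hS]]]; rewrite !sizeYE in hS.
pose z := lead_coef (swapXY Z); pose s := (swapXY S)`_(size (swapXY Z) + m).
have z0 : z != 0 by rewrite lead_coef_eq0 swapXY_eq0.
exists ((inY s)%:F / (inY z)%:F); split; first by exists s, z.
have -> : S%:F / Z%:F - X ^+ m.+1 * ((inY s)%:F / (inY z)%:F) =
    (S * inY z - X1 F ^+ m.+1 * inY s * Z)%:F / (Z * inY z)%:F.
  rewrite embB !embM embX; field.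
  by rewrite !emb_eq0 inY_eq0 z0.
apply: ordd_frac; first by rewrite mulf_neq0 // inY_eq0.
rewrite !sizeYE swapB !swapM swapX swapXY_Y /inY !swapXY_map_polyC.
apply: leq_trans (top_cancel hS) _; rewrite leq_add2r size_mul ?swapXY_eq0 //.
  by rewrite size_polyC z0 addn1.
by rewrite polyC_eq0.
Qed.

Lemma ordI_uniq m h : homY h -> ordI m (X ^+ m.+1 * h) -> h = 0.
Proof.
move=> [s [z [z0 ->]]] [S [Z [Z0 e hS]]]; rewrite !sizeYE in hS.
suff -> : s = 0 by rewrite rmorph0 rmorph0 mul0r.
apply: (@top_unique _ (swapXY S) (swapXY Z) m s z) => //; first by rewrite swapXY_eq0.
have eP : X1 F ^+ m.+1 * inY s * Z = S * inY z.
  apply: (@emb_inj _ L); apply/eqP; rewrite embM [X in _ == X]embM.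
  by rewrite -eqr_div ?emb_eq0 ?inY_eq0 // embM embX -mulrA e.
have := congr1 (@swapXY F) eP.
by rewrite !swapM swapX swapXY_Y /inY !swapXY_map_polyC.
Qed.

Lemma sizeY_yadd (mu : F) : sizeY (yadd mu : P2) = 1%N.
Proof.
apply/eqP; rewrite eqn_leq sizeYgt0 ?yadd_neq0 // andbT -inY_yadd.
exact: sizeY_inY.
Qed.

Lemma sizeY_Yn n : sizeY ('X^n : P2) = 1%N.
Proof.
rewrite sizeYE rmorphXn /= swapXY_X -polyC_exp size_polyC.
by rewrite expf_neq0 // polyX_eq0.
Qed.

Lemma sizeY_lin (al : F) : sizeY ((lin al)%:P : P2) = 2%N.
Proof.
rewrite sizeYE swapXY_polyC -[RHS](size_lin al).
by rewrite size_map_poly_id0 // polyC_eq0 lead_coef_eq0 lin_neq0.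
Qed.

Lemma ordI_term t : term_ok t -> ordI (wI t) (tval L t).
Proof.
case: t => [[n|n] mu|n al|P] /= ok.
- rewrite -exprnP -embX; apply: ordd_frac; first exact: yadd_neq0.
  by rewrite sizeY_X1 sizeY_yadd add1n.
- rewrite NegzE -exprnN.
  have -> : X ^- n.+1 / (yadd mu)%:F = 1%:F / (yadd mu * X1 F ^+ n.+1)%:F.
    by rewrite emb1 div1r embM embX invfM mulrC.
  have nz : yadd mu * X1 F ^+ n.+1 != 0.
    by rewrite mulf_neq0 ?yadd_neq0 ?expf_neq0 //; case: (X1_irreducible F).
  apply: ordd_frac => //; have := sizeY_Yn 0; rewrite expr0 => ->.
  by rewrite addn0 sizeYgt0.
- rewrite -embX -embM; apply: ordd_frac; first exact: linP_neq0.
  have -> : sizeY ('X^n * X1 F) = 2%N.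
    rewrite sizeYM ?expf_neq0 ?polyX_eq0 //; last by case: (X1_irreducible F).
    by rewrite sizeY_Yn -(expr1 (X1 F)) sizeY_X1.
  by rewrite sizeY_lin.
- by apply: ordd_frac; [case: ok => [[]] | rewrite addn0; apply: sizeY_del].
Qed.

Lemma homI_term t : term_ok t -> (0 < wI t)%N ->
  exists h, homY h /\ tval L t = X ^+ (wI t) * h.
Proof.
case: t => [[n|n] mu|n al|P] //= _ n0; exists ((yadd mu)%:F^-1).
by split; first exact: homY_yadd.
Qed.

Theorem boundI M (H : L) l : all_ok l -> ordI M (dL H + tsum L l) ->
  ordI M H /\ tsum L [seq t <- l | (M < wI t.2)%N] = 0.
Proof.
apply: (@place_bound F L ordI X 1 wI).
- exact: (@orddD F L (@sizeY F) (@sizeYM F) sizeYD sizeY0 sizeYgt0).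
- exact: (@orddZ F L (@sizeY F) (@sizeYM F) sizeY0 sizeYgt0 sizeYC).
- by move=> m a; apply: ordd_le.
- exact: (@ordd_dL F L (@sizeY F) (@sizeYM F) sizeYD sizeYN sizeY0 sizeYgt0 (@sizeY_del F)).
- exact: ordd_ex.
- exact: ordI_init.
- exact: ordI_uniq.
- exact: (@ordd_cst F L (@sizeY F) sizeYgt0 sizeYC).
- by rewrite dL_emb del_X1 rmorph1 mul1r.
- exact: ordI_term.
- exact: homI_term.
Qed.

(** At x = 0 only the terms x^p / (y + mu) with p < 0 have a pole. *)
Definition w0 (t : term F) : nat := if t is TEi (Negz n) _ then n.+1 else 0%N.
Definition ord0x m a := loc (X1 F) (X ^+ m * a).

Let irrX := X1_irreducible F.

Lemma ndvd_inY (z : {poly F}) : z != 0 -> ~ dvd2 (X1 F) (inY z).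
Proof.
move=> z0; rewrite X1E => /atx_eq0P /eqP; rewrite /atx /inY -map_poly_comp.
by rewrite map_poly_id ?(negPf z0) // => c _ /=; rewrite /horner_eval hornerC.
Qed.

Lemma ord0x_init m a : ord0x m.+1 a ->
  exists h, homY h /\ ord0x m (a - X^-1 ^+ m.+1 * h).
Proof.
move=> [S [Z [nZ e]]]; pose s := atx 0 S; pose z := atx 0 Z.
have z0 : z != 0 by apply/eqP => /atx_eq0P; rewrite -X1E.
have Z0 := ndvd_neq0 nZ.
exists ((inY s)%:F / (inY z)%:F); split; first by exists s, z.
have x0 := X_neq0 L.
have [r er] : dvd2 (X1 F) (S * inY z - inY s * Z).
  rewrite X1E; apply/atx_eq0P; rewrite atxB !atxM.
  have eK t : atx 0 (inY t) = t.
    rewrite /atx /inY -map_poly_comp map_poly_id // => c _ /=.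
    by rewrite /horner_eval hornerC.
  by rewrite !eK -/s -/z subrr.
exists r, (Z * inY z); split; first by apply: prime_ndvdM => //; apply: ndvd_inY.
apply: (mulfI x0); rewrite mulrA -exprS mulrBr exprVn mulVKf ?expf_neq0 // e.
rewrite mulrA -embM -er embB !embM; field.
by rewrite !emb_eq0 inY_eq0 z0.
Qed.

Lemma ord0x_uniq m h : homY h -> ord0x m (X^-1 ^+ m.+1 * h) -> h = 0.
Proof.
move=> [s [z [z0 ->]]] hl.
have [->|s0] := eqVneq s 0; first by rewrite rmorph0 rmorph0 mul0r.
suff /(ndvd_inY s0) : dvd2 (X1 F) (inY s) by [].
apply: (@loc_dvd _ L _ irrX _ (inY z)); first by rewrite inY_eq0.
move: hl; rewrite /ord0x; congr loc.
rewrite exprVn exprSr invfM -[X in _ * X = _]mulrA mulVKf ?expf_neq0 ?X_neq0 //.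
by rewrite embM invfM mulrCA.
Qed.

Lemma ord0x_term t : term_ok t -> ord0x (w0 t) (tval L t).
Proof.
move=> ok; rewrite /ord0x.
have nd : ~ dvd2 (X1 F) (tprime t).
  move/(normed_dvd irrX (tprime_irr ok) (normed_X1 F) (tprime_normed ok)) => /esym.
  exact: tprime_nx.
case: t ok nd => [[n|n] mu|n al|P] /= ok nd; rewrite ?expr0 ?mul1r.
- by rewrite -exprnP -embX; apply: loc_frac.
- rewrite NegzE -exprnN mulVKf ?expf_neq0 ?X_neq0 //.
  by rewrite -div1r -(rmorph1 (embed L)); apply: loc_frac.
- by rewrite -embX -embM; apply: loc_frac.
- exact: loc_frac.
Qed.

Lemma hom0x_term t : term_ok t -> (0 < w0 t)%N ->
  exists h, homY h /\ tval L t = X^-1 ^+ (w0 t) * h.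
Proof.
case: t => [[n|n] mu|n al|P] //= _ n0; exists ((yadd mu)%:F^-1).
by split; [exact: homY_yadd | rewrite NegzE -exprnN exprVn].
Qed.

Theorem bound0x M (H : L) l : all_ok l -> ord0x M (dL H + tsum L l) ->
  ord0x M H /\ tsum L [seq t <- l | (M < w0 t.2)%N] = 0.
Proof.
have locXn n : loc (X1 F) (X ^+ n) by apply: locX => //; apply: loc_emb.
apply: (@place_bound F L ord0x X^-1 (-1) w0).
- by move=> m a b; rewrite /ord0x mulrDr; apply: locD.
- by move=> m c a h; rewrite /ord0x mulrCA; apply: locM => //; apply: loc_cst.
- move=> m a h; rewrite /ord0x exprS -mulrA; apply: locM => //; exact: loc_emb.
- move=> m a h; rewrite /ord0x.
  have -> : X ^+ m * dL a = dL (X ^+ m * a) - m%:R * (X ^+ m * a).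
    rewrite dLM dLXn dL_emb del_X1; case: m {h} => [|m] /=; last by rewrite -exprSr; ring.
    by rewrite !mulr0n; ring.
  apply: locB => //; first exact: loc_dL.
  by apply: locM => //; rewrite -(rmorph_nat (embed L)); apply: loc_emb.
- exact: loc_pole.
- exact: ord0x_init.
- exact: ord0x_uniq.
- by move=> c; rewrite /ord0x expr0 mul1r; apply: loc_cst.
- rewrite dLV ?X_neq0 // dL_emb del_X1 rmorphN rmorph1; field; exact: X_neq0.
- exact: ord0x_term.
- exact: hom0x_term.
Qed.

End ConcretePlaces.

(** * The place y = oo *)

Section YPlace.
Variable F : numClosedFieldType.
Local Notation P2 := {poly {poly F}}.
Variable L : fractions P2.
Local Notation "p %:F" := (embed L p).
Implicit Types (p q P Q : P2) (a b k : L) (s z : {poly F}).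
Local Notation X := ((X1 F)%:F).
Local Notation Y := (('X : P2)%:F).
Local Notation ordY := (@ordY F L).

(** The elements of F(x), which serve as leading coefficients at the place y = oo. *)
Definition homX k := exists s z, z != 0 /\ k = s%:P%:F / z%:P%:F.

Lemma homXD a b : homX a -> homX b -> homX (a + b).
Proof.
move=> [s [z [z0 ->]]] [t [w [w0 ->]]]; exists (s * w + t * z), (z * w).
rewrite mulf_neq0 //; split=> //.
by rewrite addf_div ?emb_eq0 ?polyC_eq0 // polyCD !polyCM embD !embM.
Qed.

Lemma homXZ c a : homX a -> homX (cstF L c * a).
Proof.
move=> [s [z [z0 ->]]]; exists (c%:P * s), z; split=> //.
by rewrite polyCM embM mulrA.
Qed.

Lemma homXc c : homX (cstF L c).
Proof. by exists c%:P, 1; rewrite oner_neq0 polyC1 emb1 divr1. Qed.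

Lemma homX_dL a : homX a -> homX (dL a).
Proof.
move=> [s [z [z0 ->]]]; exists ('X * (s^`() * z - s * z^`())), (z ^+ 2).
rewrite expf_neq0 //; split=> //; rewrite dL_frac ?polyC_eq0 //.
have dC t : del t%:P = X1 F * t^`()%:P by rewrite /del map_polyC /= derivC addr0.
rewrite !dC; congr (_ / _); last by rewrite expr2 polyCM -expr2.
by rewrite !polyCM polyCB !polyCM; congr (embed L _); rewrite /X1; ring.
Qed.

Lemma homX_ord a : homX a -> ordY 0 a.
Proof.
move=> [s [z [z0 ->]]]; apply: ordd_frac; first by rewrite polyC_eq0.
by rewrite addn0 size_polyC size_polyC z0; case: (s != 0).
Qed.

Lemma ordY_init m a : ordY m.+1 a -> exists k, homX k /\ ordY m (a - Y ^+ m.+1 * k).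
Proof.
move=> [S [Z [Z0 -> hS]]]; pose z := lead_coef Z; pose s := S`_(size Z + m).
have z0 : z != 0 by rewrite lead_coef_eq0.
exists (s%:P%:F / z%:P%:F); split; first by exists s, z.
have -> : S%:F / Z%:F - Y ^+ m.+1 * (s%:P%:F / z%:P%:F) =
    (S * z%:P - 'X ^+ m.+1 * s%:P * Z)%:F / (Z * z%:P)%:F.
  rewrite embB !embM embX; field.
  by rewrite !emb_eq0 polyC_eq0 z0.
apply: ordd_frac; first by rewrite mulf_neq0 // polyC_eq0.
apply: leq_trans (top_cancel hS) _; rewrite leq_add2r size_mul ?polyC_eq0 //.
by rewrite size_polyC z0 addn1.
Qed.

Lemma ordY_uniq m k : homX k -> ordY m (Y ^+ m.+1 * k) -> k = 0.
Proof.
move=> [s [z [z0 ->]]] [S [Z [Z0 e hS]]].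
suff -> : s = 0 by rewrite polyC0 emb0 mul0r.
apply: (@top_unique _ S Z m s z) => //.
apply: (@emb_inj _ L); apply/eqP; rewrite embM [X in _ == X]embM.
by rewrite -eqr_div ?emb_eq0 ?polyC_eq0 // embM embX -mulrA e.
Qed.

(** At y = oo only the terms y^n x / (x - a) with n > 0 have a pole. *)
Definition wY (t : term F) : nat := if t is TLi n _ then n else 0%N.

Lemma size_X1n n : size (X1 F ^+ n) = 1%N.
Proof. by rewrite /X1 -polyC_exp size_polyC expf_neq0 // polyX_eq0. Qed.

Lemma ordY_term t : term_ok t -> ordY (wY t) (tval L t).
Proof.
case: t => [[n|n] mu|n al|P] /= ok.
- rewrite -exprnP -embX; apply: ordd_frac; first exact: yadd_neq0.
  by rewrite size_X1n size_yadd.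
- rewrite NegzE -exprnN.
  have -> : X ^- n.+1 / (yadd mu)%:F = 1%:F / (yadd mu * X1 F ^+ n.+1)%:F.
    by rewrite emb1 div1r embM embX invfM mulrC.
  have nz : yadd mu * X1 F ^+ n.+1 != 0.
    by rewrite mulf_neq0 ?yadd_neq0 ?expf_neq0 //; case: (X1_irreducible F).
  by apply: ordd_frac => //; rewrite addn0 size_poly1 size_poly_gt0.
- rewrite -embX -embM; apply: ordd_frac; first exact: linP_neq0.
  rewrite size_mul ?expf_neq0 ?polyX_eq0 //; last by case: (X1_irreducible F).
  by rewrite size_polyXn -(expr1 (X1 F)) size_X1n size_polyC lin_neq0 addn1 add1n.
- by apply: ordd_frac; [case: ok => [[]] | rewrite addn0; apply: size_del].
Qed.

Lemma ordYD m a b : ordY m a -> ordY m b -> ordY m (a + b).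
Proof.
exact: (@orddD F L (fun p => size p) (@sizeM F) (@size_polyD _) (@size_poly0 _) (@size_gt0 F)).
Qed.
Lemma ordYZ m c a : ordY m a -> ordY m (cstF L c * a).
Proof.
exact: (@orddZ F L (fun p => size p) (@sizeM F) (@size_poly0 _) (@size_gt0 F) (@sizeC F)).
Qed.
Lemma ordYB m a b : ordY m a -> ordY m b -> ordY m (a - b).
Proof.
move=> ha hb; apply: ordYD => //.
by rewrite -mulN1r -(rmorph1 (cstF L)) -rmorphN; apply: ordYZ.
Qed.
Lemma ordYM m n a b : ordY m a -> ordY n b -> ordY (m + n) (a * b).
Proof.
exact: (@orddM F L (fun p => size p) (@sizeM F) (@size_poly0 _) (@size_gt0 F)).
Qed.
Lemma ordY_dL m a : ordY m a -> ordY m (dL a).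
Proof.
exact: (@ordd_dL F L (fun p => size p) (@sizeM F) (@size_polyD _) (@size_polyN _)
  (@size_poly0 _) (@size_gt0 F) (@size_del F)).
Qed.
Lemma ordY_le m n a : (m <= n)%N -> ordY m a -> ordY n a.
Proof. exact: ordd_le. Qed.
Lemma ordYc c : ordY 0 (cstF L c). Proof. exact/homX_ord/homXc. Qed.
Lemma ordY_Y n : ordY n (Y ^+ n).
Proof.
rewrite -embX -[(_ ^+ _)%:F]divr1 -emb1; apply: ordd_frac; first exact: oner_neq0.
by rewrite size_polyXn size_poly1.
Qed.

Lemma ordY_tsum m (l : seq (F * term F)) : all_ok l ->
  (forall t : F * term F, t \in l -> (wY t.2 <= m)%N) -> ordY m (tsum L l).
Proof.
move=> ok hm; rewrite /tsum big_seq; elim/big_rec: _ => [|t a ht ha].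
  by apply: (@ordY_le 0) => //; rewrite -(cst0 L); apply: ordYc.
by apply: ordYD => //; apply/ordYZ/(ordY_le (hm _ ht))/ordY_term/ok.
Qed.

(** Division of a term y^n x / (x - a) by y^n. *)
Definition strip (t : F * term F) : F * term F :=
  (t.1, if t.2 is TLi _ al then TLi 0 al else t.2).

Lemma strip_tsum m (l : seq (F * term F)) :
  (forall t : F * term F, t \in l -> wY t.2 = m.+1) ->
  tsum L l = Y ^+ m.+1 * tsum L (map strip l).
Proof.
move=> hl; rewrite /tsum big_map mulr_sumr big_seq [RHS]big_seq; apply: eq_bigr => t /hl.
by rewrite /strip; case: t.2 => //= n al ->; rewrite expr0; ring.
Qed.

Lemma strip_homX m (l : seq (F * term F)) :
  (forall t : F * term F, t \in l -> wY t.2 = m.+1) -> homX (tsum L (map strip l)).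
Proof.
move=> hl; rewrite /tsum big_map big_seq; elim/big_rec: _ => [|t a /hl ht ha].
  by rewrite -(cst0 L); apply: homXc.
apply: homXD => //; apply: homXZ; move: ht; rewrite /strip; case: t.2 => //= n al _.
by exists 'X, (lin al); rewrite lin_neq0 expr0 mul1r.
Qed.

(** Here [dL] lowers the order in y by one on constant leading coefficients, so the
    argument of [place_bound] needs one more coefficient: if H begins with c y^(m+2) +
    k y^(m+1), the coefficient of y^(m+1) in the total is (m+2) c + [dL] k + ka, where
    ka collects the terms.  It vanishes; since (m+2) c = [dL] ((m+2) c y), the terms
    cancel by [terms_vanish0], and then k + (m+2) c y is a constant, so c = 0.  This
    is also why H may have order M + 1. *)
Theorem boundY M (H : L) l : all_ok l -> ordY M (dL H + tsum L l) ->
  ordY M.+1 H /\ tsum L [seq t <- l | (M < wY t.2)%N] = 0.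
Proof.
move=> ok hM.
suff [d] : exists d, (exists c, ordY (M + d) (H - cstF L c * Y ^+ (M + d).+1)) /\
    tsum L [seq t <- l | (M + d < wY t.2)%N] = 0.
  elim: d => [|d IHd].
    rewrite addn0 => -[[c hc] ->]; split=> //.
    rewrite -[H](subrK (cstF L c * Y ^+ M.+1)); apply: ordYD; first exact: ordY_le hc.
    exact/ordYZ/ordY_Y.
  rewrite addnS; set m := (M + d)%N => -[[c hH] hs]; apply: IHd; rewrite -/m.
  have [k [hk ord_rest]] := ordY_init hH.
  have okf (B : pred (F * term F)) : all_ok (filter B l).
    by move=> t; rewrite mem_filter => /andP[_]; apply: ok.
  pose l' := [seq t <- l | wY t.2 == m.+1].
  have hl' (t : F * term F) : t \in l' -> wY t.2 = m.+1.
    by rewrite mem_filter => /andP[/eqP].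
  pose ka := tsum L (map strip l').
  have etail : tsum L [seq t <- l | (m < wY t.2)%N] = Y ^+ m.+1 * ka.
    rewrite -(strip_tsum hl') [LHS](tsum_split _ (fun t => wY t.2 == m.+1)) -!filter_predI.
    have -> : [seq t <- l | predI (fun t => wY t.2 == m.+1) (fun t => m < wY t.2)%N t] = l'.
      by apply: eq_filter => t /=; case: eqP => // ->; rewrite ltnSn.
    rewrite -[RHS]addr0; congr (_ + _); rewrite -[RHS]hs; congr tsum.
    by apply: eq_filter => t /=; rewrite ltn_neqAle [RHS]ltn_neqAle -ltn_neqAle andbC; lia.
  have e0 : cstF L (c * m.+2%:R) + dL k + ka = 0.
    apply: (@ordY_uniq m).
      apply: homXD; last exact: (strip_homX hl').
      by apply: homXD; [apply: homXc | apply: homX_dL].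
    have -> : Y ^+ m.+1 * (cstF L (c * m.+2%:R) + dL k + ka) =
       (dL H + tsum L l) - dL (H - cstF L c * Y ^+ m.+2 - Y ^+ m.+1 * k)
       - cstF L m.+1%:R * (Y ^+ m * k) - tsum L [seq t <- l | ~~ (m < wY t.2)%N].
      rewrite [tsum L l](tsum_split _ (fun t => m < wY t.2)%N) etail !dLB dLZ [dL (_ ^+ m.+1 * k)]dLM !dLXn !succnK.
      rewrite dL_emb del_Y emb1 cstM !cst_nat.
      rewrite -[(_ * _) *+ m.+2]mulr_natl -[(_ * _) *+ m.+1]mulr_natl.
      by rewrite !exprS; ring.
    apply: ordYB; last by apply: ordY_tsum => // t; rewrite mem_filter -leqNgt => /andP[].
    apply: ordYB; first apply: ordYB; first by apply: ordY_le hM; apply: leq_addr.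
      exact: ordY_dL.
    by apply: ordYZ; rewrite -[X in ordY X]addn0; apply: ordYM; [apply: ordY_Y | apply: homX_ord].
  have ok' : all_ok (map strip l').
    move=> t /mapP [t' ht' ->]; have := ok t'; have := hl' _ ht'.
    move: ht'; rewrite mem_filter => /andP[_ ->]; rewrite /strip.
    by case: t'.2 => //= n al _ /(_ isT).
  have e1 : dL (k + cstF L (c * m.+2%:R) * Y) + tsum L (map strip l') = 0.
    by rewrite -[RHS]e0 dLD dLM dL_cst dL_emb del_Y emb1 -/ka; ring.
  have v0 := terms_vanish0 ok' e1; rewrite v0 addr0 in e1.
  have [c' ec] := dL_eq0 e1.
  have c0 : cstF L (c * m.+2%:R) = 0.
    apply: (@ordY_uniq 0); first exact: homXc.
    have -> : Y ^+ 1 * cstF L (c * m.+2%:R) = cstF L c' - k by rewrite -ec expr1; ring.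
    by apply: ordYB; [apply: ordYc | apply: homX_ord].
  split; last by rewrite etail /ka v0 mulr0.
  exists c'; move: ord_rest; have -> : c = 0.
    move/eqP: c0; rewrite cst_eq0 mulf_eq0 => /orP[/eqP-> //|].
    by rewrite pnatr_eq0.
  have -> : k = cstF L c' by rewrite -ec c0 mul0r addr0.
  by rewrite cst0 mul0r subr0 mulrC.
(* the order of H and the weights give some bound, from which the descent starts *)
have [d1 hd1] := @ordd_ex F L (fun p => size p) H; exists (d1 + \sum_(t <- l) wY t.2)%N; split.
  exists 0; rewrite cst0 mul0r subr0.
  by apply: ordY_le hd1; rewrite addnCA leq_addr.
rewrite (_ : filter _ _ = [::]) /tsum ?big_nil //; apply/eqP; rewrite -size_eq0 size_filter.
rewrite -leqn0 leqNgt -has_count; apply/hasPn => t ht; rewrite -leqNgt addnA.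
by apply: leq_trans (leq_addl _ _); rewrite (big_rem t) //= leq_addr.
Qed.

End YPlace.

(** * Solutions of bounded degree *)

Section Bounded.
Variable F : numClosedFieldType.
Local Notation P2 := {poly {poly F}}.
Variable L : fractions P2.
Local Notation "p %:F" := (embed L p).
Implicit Types (p q P Q : P2) (a b : L) (s z : {poly F}).
Local Notation X := ((X1 F)%:F).
Local Notation Y := (('X : P2)%:F).

Lemma normalize P : irreducible_elt P -> exists P' (c : F),
  [/\ c != 0, P = c%:P%:P * P', normed P' & irreducible_elt P'].
Proof.
move=> [P0 /negP Pu irr]; pose c := lead_coef (lead_coef P).
have c0 : c != 0 by rewrite !lead_coef_eq0.
have cu : c%:P%:P \is a @GRing.unit P2 by apply/unit2P; exists c.
have eP : P = c%:P%:P * (c^-1%:P%:P * P) by rewrite mulrA -!polyCM divff // mul1r.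
exists (c^-1%:P%:P * P), c; split=> //.
  by rewrite /normed lead_coefM lead_coefC lead_coefM lead_coefC mulVf.
split; first by rewrite mulf_neq0 // !polyC_eq0 invr_eq0.
  by apply/negP => h; apply: Pu; rewrite eP unitrM cu.
move=> p q e; have /irr [u|u] : P = (c%:P%:P * p) * q by rewrite -mulrA -e.
  by left; move: u; rewrite unitrM => /andP[].
by right.
Qed.

Lemma loc_assoc P P' (c : F) a : c != 0 -> P = c%:P%:P * P' -> loc P' a -> loc P a.
Proof.
move=> c0 e [S [Z [nd ->]]]; exists S, Z; split=> // -[r er]; apply: nd.
by exists (c%:P%:P * r); rewrite er e; ring.
Qed.

Lemma loc_normed a : (forall P, irreducible_elt P -> normed P -> loc P a) ->
  exists p, a = p%:F.
Proof.
move=> h; apply: loc_all_poly => P /normalize [P' [c [c0 e nP' irrP']]].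
exact: loc_assoc c0 e (h _ irrP' nP').
Qed.

(** A power of x dividing B is bounded by the degree of B. *)
Lemma X1_multiplicity B k r : B = X1 F ^+ k * r -> B != 0 -> (k < sizeY B)%N.
Proof.
move=> e B0; have r0 : r != 0 by apply: contraNneq B0 => z; rewrite e z mulr0.
have x0 : X1 F ^+ k != 0 by rewrite expf_neq0 //; case: (X1_irreducible F).
rewrite e sizeYM // sizeY_X1; have := sizeYgt0 r0; lia.
Qed.

(** The three place bounds and [terms_vanish] discard from l the terms that cannot
    contribute.  As to H: its poles along P are one less than those of x f, except
    along x where the bound at x = 0 gives at most M; so X1^M * B * H is a polynomial,
    whose degrees are bounded by the places x = oo and y = oo. *)
Theorem bounded_solution (A B : P2) (M : nat) (H : L) l : B != 0 -> all_ok l ->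
  (sizeY (X1 F * A) <= M)%N -> (sizeY B <= M)%N -> (size A <= M)%N -> (size B <= M)%N ->
  X * A%:F / B%:F = dL H + tsum L l ->
  exists N l', [/\ (sizeY N <= 3 * M + 2)%N, (size N <= 3 * M + 2)%N,
    all_ok l',
    forall t : F * term F, t \in l' -> [/\ dvd2 (tprime t.2) B, (wI t.2 <= M)%N, (w0 t.2 <= M)%N
       & (wY t.2 <= M)%N]
   & X * A%:F / B%:F = dL (N%:F / (X1 F ^+ M * B)%:F) + tsum L l'].
Proof.
move=> B0 ok hxA hxB hA hB; set g := X * A%:F / B%:F => e.
have eg : g = (X1 F * A)%:F / B%:F by rewrite embM.
have irrX := X1_irreducible F; have [x0 _ _] := irrX.
have fB0 : B%:F != 0 by rewrite emb_eq0.
have okf (D : pred (F * term F)) l0 : all_ok l0 -> all_ok (filter D l0).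
  by move=> ok0 t; rewrite mem_filter => /andP[_]; apply: ok0.
have tfil (D : pred (F * term F)) l0 : tsum L [seq t <- l0 | ~~ D t] = 0 ->
    tsum L (filter D l0) = tsum L l0.
  by move=> h; rewrite [RHS](tsum_split _ D) h addr0.
pose D1 (t : F * term F) := `[< dvd2 (tprime t.2) B >].
pose l1 := filter D1 l; have ok1 : all_ok l1 by apply: okf.
have e1 : g = dL H + tsum L l1.
  rewrite e -(tfil D1 l) // tsum_filter; apply: (@sum_by_key_cond _ P2 _ (fun t => tprime t.2)) => P.
  have [/hasP [t ht /andP[/eqP et ndt]]|hn] :=
      boolP (has (fun t => (tprime t.2 == P) && ~~ D1 t) l); last first.
    rewrite big_seq_cond big_pred0 // => t; apply/negbTE; apply: contra hn.
    by move=> /andP[h1 /andP[h2 h3]]; apply/hasP; exists t; rewrite // h2 h3.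
  have nd : ~ dvd2 P B by rewrite -et => /asboolP h; move: ndt; rewrite /D1 h.
  have okt := ok _ ht; rewrite -et in nd *.
  have lg : loc (tprime t.2) g by rewrite eg; apply: loc_frac.
  rewrite e in lg.
  rewrite -[RHS](terms_vanish (tprime_irr okt) (tprime_normed okt) (tprime_nx okt) ok lg).
  rewrite tsum_filter; apply: eq_bigl => t'; case: eqP => //= et'.
  by apply/negP => /asboolP; rewrite et'.
(* the place x = oo *)
pose l2 := [seq t <- l1 | (wI t.2 <= M)%N]; have ok2 : all_ok l2 by apply: okf.
have gI : ordI M g.
  by rewrite eg; apply: ordd_frac => //; apply: leq_trans hxA _; apply: leq_addl.
have [HI vI] := boundI ok1 (M := M) (H := H) (L := L) ltac:(by rewrite -e1).
have e2 : g = dL H + tsum L l2.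
  rewrite e1 -(tfil (fun t => (wI t.2 <= M)%N) l1) // -[RHS]vI; congr tsum; by apply: eq_filter => t; rewrite ltnNge.
(* the place x = 0 *)
pose l3 := [seq t <- l2 | (w0 t.2 <= M)%N]; have ok3 : all_ok l3 by apply: okf.
have g0 : ord0x M g.
  have [k [r [er ndr]]] := multiplicity irrX B0.
  have hk : (k <= M)%N by apply: leq_trans (ltnW (X1_multiplicity er B0)) hxB.
  rewrite /ord0x.
  have -> : X ^+ M * g = (X1 F ^+ (M - k) * (X1 F * A))%:F / r%:F.
    rewrite eg er -{1}(subnK hk) exprD [(_ * r)%:F]embM [(_ * (_ * A))%:F]embM !embX.
    rewrite invfM -!mulrA; congr (_ * _); rewrite mulrCA mulVKf //.
    by rewrite expf_neq0 ?X_neq0.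
  exact: loc_frac.
have [H0 v0] := bound0x ok2 (M := M) (H := H) (L := L) ltac:(by rewrite -e2).
have e3 : g = dL H + tsum L l3.
  rewrite e2 -(tfil (fun t => (w0 t.2 <= M)%N) l2) // -[RHS]v0; congr tsum; by apply: eq_filter => t; rewrite ltnNge.
(* the place y = oo *)
pose l4 := [seq t <- l3 | (wY t.2 <= M)%N]; have ok4 : all_ok l4 by apply: okf.
have gY : ordY M g.
  rewrite eg; apply: ordd_frac => //; apply: leq_trans (size_mul_leq _ _) _.
  by rewrite -(expr1 (X1 F)) size_X1n add1n /=; apply: leq_trans hA _; apply: leq_addl.
have [HY vY] := boundY ok3 (M := M) (H := H) (L := L) ltac:(by rewrite -e3).
have e4 : g = dL H + tsum L l4.
  rewrite e3 -(tfil (fun t => (wY t.2 <= M)%N) l3) // -[RHS]vY; congr tsum; by apply: eq_filter => t; rewrite ltnNge.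
(* H has a pole of order at most M along x, and along P one less than the
   multiplicity of P in B *)
have [P irrP nP|N eN] := @loc_normed (X ^+ M * B%:F * H).
  have [->|/eqP Px] := eqVneq P (X1 F).
    rewrite mulrAC; apply: (locM irrX) => //; exact: loc_emb.
  have nx : ~ like_x P by move/(like_x_normed nP).
  have [v [r [er ndr]]] := multiplicity irrP B0.
  have P0 : P%:F != 0 by rewrite emb_eq0; case: irrP.
  have lP n : loc P (P%:F ^+ n) by apply: (locX irrP); apply: loc_emb.
  have hv : (v <= v.-1.+1)%N by case: (v).
  have : loc P (P%:F ^+ v.-1.+1 * dL H).
    have -> : dL H = g - tsum L l4 by rewrite e4 addrK.
    rewrite mulrBr; apply: (locB irrP).
      rewrite -(subnK hv) exprD -mulrA; apply: (locM irrP) => //.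
      have -> : P%:F ^+ v * g = (X1 F * A)%:F / r%:F.
        by rewrite eg er embM [(_ * r)%:F]embM embX invfM mulrCA mulVKf // expf_neq0.
      exact: loc_frac.
    rewrite exprSr -mulrA; apply: (locM irrP) => //.
    rewrite /tsum big_seq mulr_sumr; apply: (loc_sum irrP) => t ht; rewrite mulrCA.
    apply: (locM irrP); first exact: loc_cst.
    by apply: loc_Ptval => //; apply: ok4.
  move/(loc_integral irrP nx) => lH.
  have -> : X ^+ M * B%:F * H = (X1 F ^+ M * P ^+ (v - v.-1) * r)%:F * (P%:F ^+ v.-1 * H).
    rewrite er -{1}(subnK (leq_pred v)) exprD !embM !embX; ring.
  by apply: (locM irrP) => //; apply: loc_emb.
have sizeX : ordI M.+1 (L := L) (X ^+ M).
  rewrite -embX; have := @ordd_emb F L (@sizeY F) (X1 F ^+ M); by rewrite sizeY_X1.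
exists N, l4; split => //.
- have : ordI (M.+1 + M + M)%N N%:F.
    rewrite -eN; do 2 (apply: (@orddM F L (@sizeY F) (@sizeYM F) (@sizeY0 F) (@sizeYgt0 F)) => //).
    by apply: (ordd_le hxB); apply: ordd_emb.
  move/(@ordd_poly F L (@sizeY F) (@sizeYM F) (@sizeY0 F) (@sizeYgt0 F)).
  by move: (sizeY N) => n; lia.
- have : ordY (1 + M + M.+1)%N N%:F.
    rewrite -eN; apply: ordYM => //; apply: ordYM.
      rewrite -embX; have := @ordd_emb F L (fun p => size p) (X1 F ^+ M); by rewrite size_X1n.
    by apply: (ordd_le hB); apply: (@ordd_emb F L (fun p => size p)).
  move/(@ordd_poly F L (fun p => size p) (@sizeM F) (@size_poly0 _) (@size_gt0 F)).
  have : (0 < M)%N by apply: leq_trans hB; rewrite size_poly_gt0.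
  by move: (size N) => n; lia.
- move=> t; rewrite !mem_filter => /andP[h1 /andP[h2 /andP[h3 /andP[h4 _]]]].
  by split=> //; apply/asboolP.
- rewrite e4; congr (dL _ + _); rewrite -eN embM embX; field.
  by rewrite fB0 expf_neq0 ?X_neq0.
Qed.

End Bounded.

(** * Formal derivatives of polylogarithmic sums *)

Section PolylogCombinatorics.
Variable F : numClosedFieldType.
Local Notation P2 := {poly {poly F}}.
Variable L : fractions P2.
Local Notation "p %:F" := (embed L p).
Local Notation key := (nat * nat * F)%type.
Implicit Types (l : seq (key * F)) (k : key).

Definition li_ok l := forall t : key * F, t \in l -> (0 < t.1.1.1)%N /\ t.1.2 != 0.

(** The total coefficient of a key; a list may mention the same key several times. *)
Definition coef l k : F := \sum_(t <- l | t.1 == k) t.2.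

Lemma coef_cons t l k : coef (t :: l) k = (if t.1 == k then t.2 else 0) + coef l k.
Proof. by rewrite /coef big_cons; case: ifP; rewrite ?add0r. Qed.

Lemma coef_cat l1 l2 k : coef (l1 ++ l2) k = coef l1 k + coef l2 k.
Proof. by rewrite /coef big_cat. Qed.

Lemma coef_sum0 (f : key -> F) l : (forall k, coef l k = 0) ->
  \sum_(t <- l) t.2 * f t.1 = 0.
Proof.
move=> h; apply: (sum_by_key (key := fun t : key * F => t.1)) => k.
rewrite (eq_bigr (fun t => t.2 * f k)); last by move=> t /eqP ->.
by rewrite -mulr_suml -/(coef l k) h mul0r.
Qed.

(** x d/dx (y^r Li_p (l x)) = r y^(r-1) Li_p (l x) + y^r Li_(p-1) (l x): the entries
    below are the polylogarithms of this derivative.  When p = 1 the second summand is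
    rational and goes to [li_rat]. *)
Definition step1 (t : key * F) : seq (key * F) :=
  (if t.1.1.2 is r.+1 then [:: ((t.1.1.1, r, t.1.2), r.+1%:R * t.2)] else [::]) ++
  (if t.1.1.1 is p.+2 then [:: ((p.+1, t.1.1.2, t.1.2), t.2)] else [::]).

Definition step l := flatten (map step1 l).

(** The rational part of the derivative, x l / (1 - l x) = - x / (x - 1/l) for Li_1 (l
    x). *)
Definition li_rat l : seq (F * term F) :=
  [seq (- t.2, TLi t.1.1.2 t.1.2^-1) | t <- l & t.1.1.1 == 1%N].

Lemma step_ok l : li_ok l -> li_ok (step l).
Proof.
move=> ok u /flattenP [s /mapP [t /ok [p0 la0] ->]].
rewrite /step1; case: t p0 la0 => [[[p r] la] b] /= p0 la0.
rewrite mem_cat; case: r => [|r]; case: p p0 => [|[|p]] //= _;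
  rewrite ?inE ?in_nil ?orbF //=; try (by move/eqP=> ->).
by case/orP => /eqP ->.
Qed.

Lemma coef_step1 t p r la : (0 < t.1.1.1)%N -> (0 < p)%N ->
  coef (step1 t) (p, r, la) =
  r.+1%:R * coef [:: t] (p, r.+1, la) + coef [:: t] (p.+1, r, la).
Proof.
case: t => [[[q s] mu] b] /= q0 p0; rewrite /step1 coef_cat !coef_cons /coef !big_nil !addr0 /=.
congr (_ + _).
  case: s => [|s] /=.
    by rewrite big_nil; case: eqP => [[]|]; rewrite ?mulr0.
  rewrite big_cons big_nil /= addr0 !xpair_eqE eqSS; case: ifP => [/andP[/andP[_ /eqP->]]|] //.
  by rewrite mulr0.
case: q q0 => [|[|q]] //= _.
  by rewrite big_nil !xpair_eqE eqSS; case: p p0.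
by rewrite big_cons big_nil /= addr0 !xpair_eqE eqSS.
Qed.

Lemma coef_step l p r la : li_ok l -> (0 < p)%N ->
  coef (step l) (p, r, la) = r.+1%:R * coef l (p, r.+1, la) + coef l (p.+1, r, la).
Proof.
move=> ok p0; elim: l ok => [|t l IHl] ok; first by rewrite /coef !big_nil mulr0 addr0.
have okl : li_ok l by move=> u hu; apply: ok; rewrite inE hu orbT.
have [q0 _] := ok t (mem_head _ _).
rewrite /step /= coef_cat coef_step1 // -/(step l) IHl // -[t :: l]cat1s !coef_cat; ring.
Qed.

Lemma li_rat_ok l : li_ok l -> all_ok (li_rat l).
Proof.
by move=> ok u /mapP [t]; rewrite mem_filter => /andP[_ /ok [_ h]] -> /=; rewrite invr_eq0.
Qed.

(** At the prime x - 1/l the terms with argument l are isolated by [terms_vanish], and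
    y is transcendental over F(x). *)
Lemma li_rat_coef l (G : L) : li_ok l -> dL G + tsum L (li_rat l) = 0 ->
  forall r la, coef l (1%N, r, la) = 0.
Proof.
move=> ok e r la; have [-> |la0] := eqVneq la 0.
  rewrite /coef big_seq_cond big_pred0 // => t; apply/negbTE/negP => /andP[/ok [_ h] /eqP h2].
  by move: h; rewrite h2 eqxx.
have irr : irreducible_elt ((lin la^-1)%:P : P2) by apply: lin_irreducible.
have la'0 : la^-1 != 0 by rewrite invr_eq0.
have := @terms_vanish F L (lin la^-1)%:P G (li_rat l) irr (normed_lin _).
move=> /(_ (@tprime_nx _ (TLi 0 la^-1) la'0) (li_rat_ok ok)).
rewrite e => /(_ (loc0 L irr)).
rewrite tsum_filter /li_rat big_map big_filter_cond /=.
pose S : {poly F} := \sum_(t <- l | (t.1.1.1 == 1%N) && (t.1.2 == la)) t.2 *: 'X^(t.1.1.2).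
move=> e2; have {e2} : (inY S)%:F = 0.
  have fl0 : (lin la^-1)%:P%:F != 0 by rewrite emb_eq0 linP_neq0.
  apply: (mulIf (mulf_neq0 (X_neq0 L) (invr_neq0 fl0))); rewrite mul0r -[RHS]oppr0 -e2 -sumrN.
  rewrite /S /inY raddf_sum /= raddf_sum /= mulr_suml.
  apply: eq_big => [t|t /andP[_ /eqP ->]].
    congr (_ && _); apply/eqP/eqP => [->//|/polyC_inj /(@lin_inj F) /invr_inj //].
  rewrite map_polyZ /= map_polyXn -mul_polyC embM embX -/(cstF L t.2) rmorphN; ring.
move/eqP; rewrite emb_eq0 inY_eq0 => /eqP /(congr1 (fun p : {poly F} => p`_r)).
rewrite coef0 coef_sum => <-; rewrite /coef big_mkcond [RHS]big_mkcond.
apply: eq_bigr => -[[[p s] mu] b] _; rewrite /= !xpair_eqE coefZ coefXn [r == s]eq_sym.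
by case: (p == 1%N); case: (s == r); case: (mu == la); rewrite ?mulr1 ?mulr0.
Qed.

End PolylogCombinatorics.

(** * Programs for functions on encoded data *)

Section Computability.
Variable F : fieldType.

(** Booleans and natural numbers are lists of Nil, the latter in unary; polynomials
    are encoded like their coefficient lists, as in [enc_poly]. *)
Class Enc (T : Type) := enc : T -> data F.

Global Instance enc_field : Enc F := @Atom F.
Global Instance enc_unit : Enc unit := fun _ => Nil.
Global Instance enc_nat : Enc nat := fun n => iter n (Cons Nil) Nil.
Global Instance enc_bool : Enc bool := fun b => if b then Cons Nil Nil else Nil.
Global Instance enc_pair A B (eA : Enc A) (eB : Enc B) : Enc (A * B) :=
  fun c => Cons (enc c.1) (enc c.2).
Global Instance enc_list A (eA : Enc A) : Enc (seq A) := enc_seq eA.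
Global Instance enc_polynomial (A : nzRingType) (eA : Enc A) : Enc {poly A} :=
  fun p => enc_seq eA p.

(** The program may call the oracle, but its result must not depend on it; the single
    call of the oracle is added in [integrate_ln_program]. *)
Definition computable A B {eA : Enc A} {eB : Enc B} (f : A -> B) := exists p : prog,
  forall (factor : data F -> data F) a, exec factor p (eA a) (eB (f a)).

Section Basic.
Context {A B C D : Type} {eA : Enc A} {eB : Enc B} {eC : Enc C} {eD : Enc D}.

Lemma comp_ext (f g : A -> B) : f =1 g -> computable f -> computable g.
Proof. by move=> fg [p hp]; exists p => factor a; rewrite -fg. Qed.

Lemma comp_id : computable (fun a : A => a).
Proof. by exists (Prim PId) => factor a; apply: exec_prim. Qed.

Lemma comp_comp (g : B -> C) (f : A -> B) : computable g -> computable f -> computable (fun a => g (f a)).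
Proof.
move=> [q hq] [p hp]; exists (Comp q p) => factor a.
exact: exec_comp (hp _ _) (hq _ _).
Qed.

Lemma comp_pair (f : A -> B) (g : A -> C) : computable f -> computable g -> computable (fun a => (f a, g a)).
Proof.
by move=> [p hp] [q hq]; exists (Pair p q) => factor a; apply: exec_pair.
Qed.

Lemma comp_fst (f : A -> B * C) : computable f -> computable (fun a => (f a).1).
Proof.
move=> [p hp]; exists (Comp (Prim PFst) p) => factor a.
exact: exec_comp (hp _ _) (exec_prim _ PFst _).
Qed.

Lemma comp_snd (f : A -> B * C) : computable f -> computable (fun a => (f a).2).
Proof.
move=> [p hp]; exists (Comp (Prim PSnd) p) => factor a.
exact: exec_comp (hp _ _) (exec_prim _ PSnd _).
Qed.

Lemma comp_if (b : A -> bool) (f g : A -> B) : computable b -> computable f -> computable g ->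
  computable (fun a => if b a then f a else g a).
Proof.
move=> [q hq] [p hp] [r hr]; exists (If q p r) => factor a; have := hq factor a.
case: (b a) => h; last exact: exec_if_false h (hr _ _).
by apply: exec_if_true h _ (hp _ _).
Qed.

Lemma comp_nil : computable (fun _ : A => [::] : seq B).
Proof. by exists (Prim PNil) => factor a; apply: exec_prim. Qed.

Lemma comp_cons (f : A -> B) (g : A -> seq B) : computable f -> computable g ->
  computable (fun a => f a :: g a).
Proof. by move=> [p hp] [q hq]; exists (Pair p q) => factor a; apply: exec_pair. Qed.

Lemma comp_tt : computable (fun _ : A => tt).
Proof. by exists (Prim PNil) => factor a; apply: exec_prim. Qed.

Lemma comp_false : computable (fun _ : A => false).
Proof. by exists (Prim PNil) => factor a; apply: exec_prim. Qed.

Lemma comp_true : computable (fun _ : A => true).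
Proof.
by exists (Pair (Prim PNil) (Prim PNil)) => factor a; apply: exec_pair; apply: exec_prim.
Qed.

Lemma comp_0 : computable (fun _ : A => 0%N).
Proof. by exists (Prim PNil) => factor a; apply: exec_prim. Qed.

Lemma comp_S (f : A -> nat) : computable f -> computable (fun a => (f a).+1).
Proof.
by move=> [p hp]; exists (Pair (Prim PNil) p) => factor a; apply: exec_pair => //; apply: exec_prim.
Qed.

Lemma comp_pred (f : A -> nat) : computable f -> computable (fun a => (f a).-1).
Proof.
move=> [p hp]; exists (Comp (Prim PSnd) p) => factor a.
have := exec_comp (hp factor a) (exec_prim factor PSnd _).
by rewrite /enc_nat; case: (f a).
Qed.

Lemma comp_pos (f : A -> nat) : computable f -> computable (fun a => (0 < f a)%N).
Proof.
move=> [p hp]; exists (If p (Pair (Prim PNil) (Prim PNil)) (Prim PNil)) => factor a.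
have := hp factor a; case: (f a) => [|n] h.
  by apply: exec_if_false h _; apply: exec_prim.
by apply: (exec_if_true _ h) => //; apply: exec_pair; apply: exec_prim.
Qed.

Lemma comp_behead (f : A -> seq B) : computable f -> computable (fun a => behead (f a)).
Proof.
move=> [p hp]; exists (Comp (Prim PSnd) p) => factor a.
have := exec_comp (hp factor a) (exec_prim factor PSnd _).
by case: (f a).
Qed.

Lemma comp_nilp (f : A -> seq B) : computable f -> computable (fun a => nilp (f a)).
Proof.
move=> [p hp]; exists (If p (Prim PNil) (Pair (Prim PNil) (Prim PNil))) => factor a.
have := hp factor a; case: (f a) => [|x s] h.
  by apply: exec_if_false h _; apply: exec_pair; apply: exec_prim.
by apply: (exec_if_true _ h) => //; apply: exec_prim.
Qed.

Lemma comp_head (x : A -> B) (f : A -> seq B) : computable x -> computable f ->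
  computable (fun a => head (x a) (f a)).
Proof.
move=> [q hq] [p hp]; exists (If p (Comp (Prim PFst) p) q) => factor a.
have := hp factor a; case: (f a) => [|y s] h.
  exact: exec_if_false h (hq _ _).
by apply: (exec_if_true _ h) => //; apply: exec_comp h (exec_prim _ PFst _).
Qed.

Lemma comp_F0 : computable (fun _ : A => 0 : F).
Proof. by exists (Prim PZero) => factor a; apply: exec_prim. Qed.
Lemma comp_F1 : computable (fun _ : A => 1 : F).
Proof. by exists (Prim POne) => factor a; apply: exec_prim. Qed.

Lemma comp_prim2 (o : prim) (op : F -> F -> B) (f g : A -> F) :
  (forall factor x y, run_prim factor o (Cons (Atom x) (Atom y)) = eB (op x y)) ->
  computable f -> computable g -> computable (fun a => op (f a) (g a)).
Proof.
move=> ho [p hp] [q hq]; exists (Comp (Prim o) (Pair p q)) => factor a.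
apply: exec_comp (exec_pair (hp _ _) (hq _ _)) _.
by rewrite -(ho factor); apply: exec_prim.
Qed.

Lemma comp_prim1 (o : prim) (op : F -> F) (f : A -> F) :
  (forall factor x, run_prim factor o (Atom x) = Atom (op x)) ->
  computable f -> computable (fun a => op (f a)).
Proof.
move=> ho [p hp]; exists (Comp (Prim o) p) => factor a.
apply: exec_comp (hp _ _) _.
by rewrite /enc_field -(ho factor); apply: exec_prim.
Qed.

End Basic.

Section FieldOps.
Context {A : Type} {eA : Enc A}.
Implicit Types f g : A -> F.

Lemma comp_Fadd f g : computable f -> computable g -> computable (fun a => f a + g a).
Proof. by apply: (@comp_prim2 _ _ _ _ PAdd +%R). Qed.
Lemma comp_Fmul f g : computable f -> computable g -> computable (fun a => f a * g a).
Proof. by apply: (@comp_prim2 _ _ _ _ PMul *%R). Qed.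
Lemma comp_Fopp f : computable f -> computable (fun a => - f a).
Proof. by apply: (@comp_prim1 _ _ POpp -%R). Qed.
Lemma comp_Finv f : computable f -> computable (fun a => (f a)^-1).
Proof. by apply: (@comp_prim1 _ _ PInv GRing.inv). Qed.
Lemma comp_Feq f g : computable f -> computable g -> computable (fun a => f a == g a).
Proof.
by apply: (@comp_prim2 _ _ _ _ PEq eq_op) => factor x y /=; case: (x == y).
Qed.
End FieldOps.

Lemma comp_lift2 (A B C T : Type) (eA : Enc A) (eB : Enc B) (eC : Enc C) (eT : Enc T)
    (g : A -> B -> C) (f1 : T -> A) (f2 : T -> B) :
  computable (fun c : A * B => g c.1 c.2) -> computable f1 -> computable f2 ->
  computable (fun t => g (f1 t) (f2 t)).
Proof.
move=> hg h1 h2.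
exact: (@comp_comp _ _ _ _ _ _ (fun c : A * B => g c.1 c.2) (fun t => (f1 t, f2 t)) hg
          (comp_pair h1 h2)).
Qed.

Section Lists.
Context {A B X Y : Type} {eA : Enc A} {eB : Enc B} {eX : Enc X} {eY : Enc Y}.

(** The loop runs on triples (parameter, remaining list, accumulator) and stops when
    the list is empty; all the other recursions below are folds. *)
Lemma comp_foldl (f : A -> B -> X -> B) (b : A -> B) (s : A -> seq X) :
  computable (fun c : A * (X * B) => f c.1 c.2.2 c.2.1) -> computable b -> computable s ->
  computable (fun a => foldl (f a) (b a) (s a)).
Proof.
move=> hf hb hs.
have [body hbody] : computable (fun c : A * (seq X * B) =>
    (c.1, (behead c.2.1, if c.2.1 is x :: _ then f c.1 c.2.2 x else c.2.2))).
  apply: comp_pair; first exact/comp_fst/comp_id.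
  apply: comp_pair; first exact/comp_behead/comp_fst/comp_snd/comp_id.
  have [q hq] : computable (fun c : A * (seq X * B) => c.2.1).
    exact/comp_fst/comp_snd/comp_id.
  have [r hr] : computable (fun c : A * (seq X * B) => c.2.2).
    exact/comp_snd/comp_snd/comp_id.
  have [t ht] := hf.
  (* a nonempty list is encoded as the pair of its head and tail *)
  pose arg := Pair (Prim PFst) (Pair (Comp (Prim PFst) (Comp (Prim PFst) (Prim PSnd)))
                                     (Comp (Prim PSnd) (Prim PSnd))).
  exists (If q (Comp t arg) r) => factor -[a [[|x s'] b']] /=.
    exact: exec_if_false (hq factor (a, ([::], b'))) (hr factor (a, ([::], b'))).
  apply: (exec_if_true _ (hq factor (a, (x :: s', b')))) => //.
  apply: (exec_comp _ (ht factor (a, (x, b')))).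
  rewrite /arg; apply: exec_pair; first exact: (exec_prim _ PFst).
  apply: exec_pair; last exact: exec_comp (exec_prim _ PSnd _) (exec_prim _ PSnd _).
  apply: (exec_comp (d1 := Cons (eX x) (enc s'))); last exact: (exec_prim _ PFst).
  exact: exec_comp (exec_prim _ PSnd _) (exec_prim _ PFst _).
have [cond hcond] : computable (fun c : A * (seq X * B) => c.2.1).
  exact/comp_fst/comp_snd/comp_id.
have [init hinit] : computable (fun a => (a, (s a, b a))).
  by apply: comp_pair; [apply: comp_id | apply: comp_pair].
exists (Comp (Comp (Prim PSnd) (Prim PSnd)) (Comp (While cond body) init)) => factor a.
apply: (exec_comp (d1 := Cons (eA a)
   (Cons (enc ([::] : seq X)) (enc (foldl (f a) (b a) (s a)))))); last first.
  exact: exec_comp (exec_prim _ PSnd _) (exec_prim _ PSnd _).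
apply: exec_comp (hinit factor a) _.
elim: (s a) (b a) => [|x s' IHs] b' /=.
  exact: exec_while_false (hcond factor (a, ([::], b'))).
apply: exec_while_true (hcond factor (a, (x :: s', b'))) _ (hbody factor (a, (x :: s', b'))) (IHs _).
by [].
Qed.

End Lists.

End Computability.

(** Syntax-directed search for a program: the tactic looks at the head symbol of the
    body of the function and applies the lemma for it.  It is extended below each time
    that new lemmas become available. *)
Ltac program_step1 := lazymatch goal with
  | |- computable (fun a => a) => apply: comp_id
  | |- computable (fun _ => (_, _)) => apply: comp_pair
  | |- computable (fun _ => fst _) => apply: comp_fst
  | |- computable (fun _ => snd _) => apply: comp_snd
  | |- computable (fun _ => if _ then _ else _) => apply: comp_if
  | |- computable (fun _ => [::]) => apply: comp_nil
  | |- computable (fun _ => _ :: _) => apply: comp_cons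
  | |- computable (fun _ => tt) => apply: comp_tt
  | |- computable (fun _ => false) => apply: comp_false
  | |- computable (fun _ => true) => apply: comp_true
  | |- computable (fun _ => 0%N) => apply: comp_0
  | |- computable (fun _ => S _) => apply: comp_S
  | |- computable (fun _ => predn _) => apply: comp_pred
  | |- computable (fun _ => leq 1 _) => apply: comp_pos
  | |- computable (fun _ => behead _) => apply: comp_behead
  | |- computable (fun _ => nilp _) => apply: comp_nilp
  | |- computable (fun _ => head _ _) => apply: comp_head
  | |- computable fst => exact: (comp_fst (comp_id (A := (_ * _)%type)))
  | |- computable snd => exact: (comp_snd (comp_id (A := (_ * _)%type)))
  | |- computable S => exact: (comp_S (comp_id (A := nat)))
  | |- computable predn => exact: (comp_pred (comp_id (A := nat)))
  | |- computable behead => exact: (comp_behead (comp_id (A := seq _)))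
  end.
Ltac program_of_hypothesis := match goal with
  | h : computable ?f |- computable (fun _ => ?f _) => apply: (comp_comp h)
  | h : computable (fun c => ?f c.1 c.2) |- computable (fun _ => ?f _ _) => apply: (comp_lift2 h)
  end.
Ltac write_program := repeat (assumption || program_of_hypothesis || program_step1).

Section Lists.
Variable F : fieldType.
Local Notation Enc := (@Enc F).

Lemma comp_foldr {A B X : Type} {eA : Enc A} {eB : Enc B} {eX : Enc X}
    (f : A -> X -> B -> B) (b : A -> B) (s : A -> seq X) :
  computable (fun c : A * (X * B) => f c.1 c.2.1 c.2.2) -> computable b -> computable s ->
  computable (fun a => foldr (f a) (b a) (s a)).
Proof.
move=> hf hb hs.
apply: (@comp_ext _ _ _ _ _ (fun a => foldl (fun z x => f a x z) (b a) (rev (s a)))).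
  by move=> a; rewrite foldl_rev.
apply: comp_foldl => //.
apply: (@comp_ext _ _ _ _ _ (fun a => foldl (fun t x => x :: t) [::] (s a))).
  move=> a; rewrite /rev; elim: (s a) [::] => //= x l IH t; exact: IH.
by apply: comp_foldl => //; write_program.
Qed.

Lemma comp_map {A X Y : Type} {eA : Enc A} {eX : Enc X} {eY : Enc Y}
    (f : A -> X -> Y) (s : A -> seq X) :
  computable (fun c : A * X => f c.1 c.2) -> computable s -> computable (fun a => [seq f a x | x <- s a]).
Proof.
move=> hf hs; apply: (@comp_ext _ _ _ _ _ (fun a => foldr (fun x t => f a x :: t) [::] (s a))).
  by move=> a; elim: (s a) => //= x t ->.
apply: comp_foldr => //; last by write_program.
apply: comp_cons; last by write_program.
by apply: (comp_lift2 hf); write_program.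
Qed.

Lemma comp_cat {A X : Type} {eA : Enc A} {eX : Enc X} (s t : A -> seq X) :
  computable s -> computable t -> computable (fun a => s a ++ t a).
Proof.
move=> hs ht; apply: (@comp_ext _ _ _ _ _ (fun a => foldr cons (t a) (s a))).
  by move=> a; elim: (s a) => //= x l ->.
by apply: comp_foldr => //; write_program.
Qed.

(** A natural number is encoded as a list, so iteration is a fold. *)
Lemma comp_iter {A B : Type} {eA : Enc A} {eB : Enc B}
    (n : A -> nat) (f : A -> B -> B) (b : A -> B) :
  computable (fun c : A * B => f c.1 c.2) -> computable n -> computable b -> computable (fun a => iter (n a) (f a) (b a)).
Proof.
move=> hf [p hp] hb.
apply: (@comp_ext _ _ _ _ _ (fun a => foldr (fun _ => f a) (b a) (nseq (n a) tt))).
  by move=> a; elim: (n a) => //= m ->.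
apply: comp_foldr => //.
  by apply: (comp_lift2 hf); write_program.
exists p => factor a; have -> : enc_list (enc_unit F) (nseq (n a) tt) = enc_nat F (n a).
  by elim: (n a) => //= m ->.
exact: hp.
Qed.

Lemma comp_rcons {A X : Type} {eA : Enc A} {eX : Enc X} (s : A -> seq X) (x : A -> X) :
  computable s -> computable x -> computable (fun a => rcons (s a) (x a)).
Proof.
move=> hs hx; apply: (@comp_ext _ _ _ _ _ (fun a => s a ++ [:: x a])); last by apply: comp_cat; write_program.
by move=> a; rewrite cats1.
Qed.

Lemma comp_flatten {A X : Type} {eA : Enc A} {eX : Enc X} (s : A -> seq (seq X)) :
  computable s -> computable (fun a => flatten (s a)).
Proof. by move=> hs; apply: comp_foldr => //; [apply: comp_cat; write_program | write_program]. Qed.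

Lemma comp_filter {A X : Type} {eA : Enc A} {eX : Enc X} (p : A -> X -> bool) (s : A -> seq X) :
  computable (fun c : A * X => p c.1 c.2) -> computable s -> computable (fun a => [seq x <- s a | p a x]).
Proof.
move=> hp hs.
apply: (@comp_ext _ _ _ _ _ (fun a => foldr (fun x t => if p a x then x :: t else t) [::] (s a))).
  by move=> a; elim: (s a) => //= x t ->.
apply: comp_foldr => //; last by write_program.
by apply: comp_if; [apply: (comp_lift2 hp); write_program | write_program | write_program].
Qed.

Lemma comp_andb {A : Type} {eA : Enc A} (b c : A -> bool) :
  computable b -> computable c -> computable (fun a => b a && c a).
Proof. by move=> hb hc; apply: (comp_if (f := c) (g := fun=> false)); write_program. Qed.

Lemma comp_negb {A : Type} {eA : Enc A} (b : A -> bool) : computable b -> computable (fun a => ~~ b a).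
Proof. by move=> hb; apply: (comp_if (f := fun=> false) (g := fun=> true)); write_program. Qed.

Lemma comp_orb {A : Type} {eA : Enc A} (b c : A -> bool) :
  computable b -> computable c -> computable (fun a => b a || c a).
Proof. by move=> hb hc; apply: (comp_if (f := fun=> true) (g := c)); write_program. Qed.

Lemma comp_size {A X : Type} {eA : Enc A} {eX : Enc X} (s : A -> seq X) :
  computable s -> computable (fun a => size (s a)).
Proof.
move=> hs; apply: (@comp_ext _ _ _ _ _ (fun a => foldr (fun _ n => n.+1) 0%N (s a))).
  by move=> a; elim: (s a) => //= x t ->.
by apply: comp_foldr => //; write_program.
Qed.

Lemma comp_nth {A X : Type} {eA : Enc A} {eX : Enc X} (x : A -> X) (s : A -> seq X) (n : A -> nat) :
  computable x -> computable s -> computable n -> computable (fun a => nth (x a) (s a) (n a)).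
Proof.
move=> hx hs hn; apply: (@comp_ext _ _ _ _ _ (fun a => head (x a) (iter (n a) behead (s a)))).
  by move=> a; elim: (n a) (s a) => [|m IHm] [|y t] //; rewrite iterSr IHm ?nth_nil.
by apply: comp_head => //; apply: comp_iter => //; write_program.
Qed.

Lemma comp_addn {A : Type} {eA : Enc A} (m n : A -> nat) :
  computable m -> computable n -> computable (fun a => m a + n a)%N.
Proof.
move=> hm hn; apply: (@comp_ext _ _ _ _ _ (fun a => iter (m a) S (n a))).
  by move=> a; rewrite iter_succn addnC.
by apply: comp_iter => //; write_program.
Qed.

Lemma comp_subn {A : Type} {eA : Enc A} (m n : A -> nat) :
  computable m -> computable n -> computable (fun a => m a - n a)%N.
Proof.
move=> hm hn; apply: (@comp_ext _ _ _ _ _ (fun a => iter (n a) predn (m a))).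
  by move=> a; rewrite iter_predn.
by apply: comp_iter => //; write_program.
Qed.

Lemma comp_iota0 {A : Type} {eA : Enc A} (n : A -> nat) :
  computable n -> computable (fun a => iota 0 (n a)).
Proof.
move=> hn; apply: (@comp_ext _ _ _ _ _ (fun a => iter (n a) (fun s => rcons s (size s)) [::])).
  by move=> a; elim: (n a) => // m IHm; rewrite iterS IHm -(addn1 m) iotaD size_iota cats1.
apply: comp_iter => //; last by write_program.
by apply: comp_rcons; [write_program | apply: comp_size; write_program].
Qed.

Definition comp_eqType (X : eqType) (eX : Enc X) := forall B (eB : Enc B) (y z : B -> X),
  computable y -> computable z -> computable (fun b => y b == z b).

Lemma comp_eqType_field : comp_eqType (@enc_field F : Enc (F : eqType)).
Proof. by move=> B eB y z hy hz; apply: comp_Feq. Qed.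

Lemma comp_eqType_bool : comp_eqType (enc_bool F).
Proof.
move=> B eB y z hy hz.
apply: (@comp_ext _ _ _ _ _ (fun b => if y b then z b else if z b then false else true)).
  by move=> b; case: (y b) (z b) => [] [].
by write_program.
Qed.

Lemma comp_eqType_nat : comp_eqType (enc_nat F).
Proof.
move=> B eB y z hy hz.
apply: (@comp_ext _ _ _ _ _ (fun b => if (0 < (y b - z b) + (z b - y b))%N then false else true)).
  move=> b; rewrite lt0n addn_eq0 !subn_eq0 -eqn_leq; by case: eqP.
apply: comp_if; last by write_program.
  by apply: comp_pos; apply: comp_addn; apply: comp_subn.
by write_program.
Qed.

Lemma comp_eqType_pair (X Y : eqType) (eX : Enc X) (eY : Enc Y) :
  comp_eqType eX -> comp_eqType eY -> comp_eqType (X := (X * Y)%type) (enc_pair eX eY).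
Proof.
move=> hX hY B eB y z hy hz.
apply: (@comp_ext _ _ _ _ _ (fun b => ((y b).1 == (z b).1) && ((y b).2 == (z b).2))) => //.
by apply: comp_andb; [apply: hX | apply: hY]; write_program.
Qed.

Lemma comp_mem {A : Type} {X : eqType} {eA : Enc A} {eX : Enc X} (x : A -> X) (s : A -> seq X) :
  comp_eqType eX ->
  computable x -> computable s -> computable (fun a => x a \in s a).
Proof.
move=> hX hx hs.
apply: (@comp_ext _ _ _ _ _ (fun a => foldr (fun y b => (x a == y) || b) false (s a))).
  by move=> a; elim: (s a) => //= y t ->; rewrite inE.
apply: comp_foldr => //; last by write_program.
by apply: comp_orb; last (by write_program); apply: hX; [apply: (comp_comp hx); write_program | write_program].
Qed.

Lemma comp_undup {A : Type} {X : eqType} {eA : Enc A} {eX : Enc X} (s : A -> seq X) :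
  comp_eqType eX ->
  computable s -> computable (fun a => undup (s a)).
Proof.
move=> hX hs.
apply: (@comp_ext _ _ _ _ _ (fun a => foldr (fun x t => if x \in t then t else x :: t) [::] (s a))).
  by move=> a; elim: (s a) => //= x t ->; rewrite mem_undup.
apply: comp_foldr => //; last by write_program.
by apply: comp_if; [apply: comp_mem => //; write_program | write_program | write_program].
Qed.

End Lists.

Ltac program_step2 := first [program_step1 | lazymatch goal with
  | |- computable (fun _ => _ ++ _) => apply: comp_cat
  | |- computable (fun _ => rcons _ _) => apply: comp_rcons
  | |- computable (fun _ => flatten _) => apply: comp_flatten
  | |- computable (fun _ => andb _ _) => apply: comp_andb
  | |- computable (fun _ => negb _) => apply: comp_negb
  | |- computable (fun _ => orb _ _) => apply: comp_orb
  | |- computable (fun _ => size _) => apply: comp_size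
  | |- computable (fun _ => addn _ _) => apply: comp_addn
  | |- computable (fun _ => subn _ _) => apply: comp_subn
  | |- computable (fun _ => iota 0 _) => apply: comp_iota0
  end].
Ltac write_program ::= repeat (assumption || program_of_hypothesis || program_step2).

Section Classes.
Variable F : fieldType.
Local Notation Enc := (@Enc F).

(** Rings whose operations and zero test are computable; the zero test is what keeps
    coefficient lists free of trailing zeros. *)
Class CompRing (R : nzRingType) {eR : Enc R} : Prop := {
  comp_r0 : forall A (eA : Enc A), computable (fun _ : A => 0 : R);
  comp_r1 : forall A (eA : Enc A), computable (fun _ : A => 1 : R);
  comp_rD : forall A (eA : Enc A) (f g : A -> R), computable f -> computable g -> computable (fun a => f a + g a);
  comp_rM : forall A (eA : Enc A) (f g : A -> R), computable f -> computable g -> computable (fun a => f a * g a);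
  comp_rN : forall A (eA : Enc A) (f : A -> R), computable f -> computable (fun a => - f a);
  comp_req0 : forall A (eA : Enc A) (f : A -> R), computable f -> computable (fun a => f a == 0)
}.

Global Instance CompRing_field : @CompRing F (@enc_field F).
Proof.
split=> *; [exact: comp_F0 | exact: comp_F1 | exact: comp_Fadd | exact: comp_Fmul
           | exact: comp_Fopp | by apply: comp_Feq => //; exact: comp_F0].
Qed.

End Classes.

Ltac program_step3 := first [program_step2 | lazymatch goal with
  | |- computable (fun _ => @Algebra.zero _) => apply: comp_r0
  | |- computable (fun _ => @GRing.one _) => apply: comp_r1
  | |- computable (fun _ => @Algebra.add _ _ _) => apply: comp_rD
  | |- computable (fun _ => @GRing.mul _ _ _) => apply: comp_rM
  | |- computable (fun _ => @Algebra.opp _ _) => apply: comp_rN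
  | |- computable (fun _ => eq_op _ (@Algebra.zero _)) => apply: comp_req0
  end].
Ltac write_program ::= repeat (assumption || program_of_hypothesis || program_step3).

Section Polynomials.
Variable F : fieldType.
Local Notation Enc := (@Enc F).
Local Notation CompRing := (@CompRing F).
Context (R : nzRingType) {eR : Enc R} {cR : @CompRing R eR}.

Lemma comp_rX A (eA : Enc A) (f : A -> R) (n : A -> nat) :
  computable f -> computable n -> computable (fun a => f a ^+ n a).
Proof.
move=> hf hn; apply: (@comp_ext _ _ _ _ _ (fun a => iter (n a) (fun y => f a * y) 1)).
  by move=> a; elim: (n a) => [|m IHm]; rewrite ?expr0 // exprS -IHm.
apply: comp_iter; [|by write_program|by write_program].
by apply: comp_rM; [apply: (comp_comp hf); write_program | write_program].
Qed.

Lemma comp_rMn A (eA : Enc A) (f : A -> R) (n : A -> nat) :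
  computable f -> computable n -> computable (fun a => f a *+ n a).
Proof.
move=> hf hn; apply: (@comp_ext _ _ _ _ _ (fun a => iter (n a) (fun y => f a + y) 0)).
  by move=> a; elim: (n a) => [|m IHm]; rewrite ?mulr0n // mulrS -IHm.
apply: comp_iter; [|by write_program|by write_program].
by apply: comp_rD; [apply: (comp_comp hf); write_program | write_program].
Qed.

Lemma comp_sum A X (eA : Enc A) (eX : Enc X) (f : A -> X -> R) (s : A -> seq X) :
  computable (fun c : A * X => f c.1 c.2) -> computable s -> computable (fun a => \sum_(x <- s a) f a x).
Proof.
move=> hf hs; apply: (@comp_ext _ _ _ _ _ (fun a => foldr (fun x y => f a x + y) 0 (s a))).
  by move=> a; elim: (s a) => [|x t IH] /=; rewrite ?big_nil // big_cons IH.
apply: comp_foldr; [|by write_program|by write_program].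
by apply: comp_rD; [apply: (comp_lift2 hf); write_program | write_program].
Qed.

Lemma comp_prod A X (eA : Enc A) (eX : Enc X) (f : A -> X -> R) (s : A -> seq X) :
  computable (fun c : A * X => f c.1 c.2) -> computable s -> computable (fun a => \prod_(x <- s a) f a x).
Proof.
move=> hf hs; apply: (@comp_ext _ _ _ _ _ (fun a => foldr (fun x y => f a x * y) 1 (s a))).
  by move=> a; elim: (s a) => [|x t IH] /=; rewrite ?big_nil // big_cons IH.
apply: comp_foldr; [|by write_program|by write_program].
by apply: comp_rM; [apply: (comp_lift2 hf); write_program | write_program].
Qed.

Lemma comp_polyseq A (eA : Enc A) (p : A -> {poly R}) :
  computable p -> computable (fun a => polyseq (p a)).
Proof. by []. Qed.

(** The list is built from its end, dropping zeros while nothing has been kept. *)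
Lemma comp_Poly A (eA : Enc A) (s : A -> seq R) : computable s -> computable (fun a => Poly (s a)).
Proof.
move=> hs; suff h : @computable F A (seq R) eA (enc_list eR) (fun a => polyseq (Poly (s a))) by exact: h.
apply: (@comp_ext _ _ _ _ _ (fun a =>
    foldr (fun x t => if nilp t && (x == 0) then t else x :: t) [::] (s a))).
  move=> a; elim: (s a) => [|x t IH] /=; first by rewrite polyseq0.
  rewrite IH polyseq_cons; case: nilP => //= e.
  by rewrite polyseqC e; case: eqP.
by apply: comp_foldr => //; write_program.
Qed.

Lemma comp_poly A (eA : Enc A) (n : A -> nat) (f : A -> nat -> R) :
  computable n -> computable (fun c : A * nat => f c.1 c.2) -> computable (fun a => \poly_(i < n a) f a i).
Proof.
move=> hn hf; apply: (@comp_ext _ _ _ _ _ (fun a => Poly [seq f a i | i <- iota 0 (n a)])).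
  move=> a; apply/polyP => i; rewrite coef_Poly coef_poly.
  case: ltnP => h; first by rewrite (nth_map 0%N) ?size_iota // nth_iota.
  by rewrite nth_default // size_map size_iota.
by apply: comp_Poly; apply: comp_map => //; write_program.
Qed.

Lemma comp_coef A (eA : Enc A) (p : A -> {poly R}) (n : A -> nat) :
  computable p -> computable n -> computable (fun a => (p a)`_(n a)).
Proof. by move=> hp hn; apply: comp_nth => //; write_program. Qed.

Lemma comp_polyC A (eA : Enc A) (f : A -> R) : computable f -> computable (fun a => (f a)%:P).
Proof.
move=> hf; apply: (@comp_ext _ _ _ _ _ (fun a => Poly [:: f a])).
  by move=> a; rewrite -(polyseqK (f a)%:P) polyseqC; case: eqP => [->|] //=; rewrite !cons_poly_def mul0r add0r.
by apply: comp_Poly; write_program.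
Qed.

Lemma comp_polyX A (eA : Enc A) : computable (fun _ : A => 'X : {poly R}).
Proof.
apply: (@comp_ext _ _ _ _ _ (fun a => Poly [:: 0; 1])); last by apply: comp_Poly; write_program.
by move=> a; rewrite -(polyseqK 'X) polyseqX.
Qed.

End Polynomials.

Ltac program_step4 := first [lazymatch goal with
  | |- computable (fun _ => @GRing.exp _ _ _) => apply: comp_rX
  | |- computable (fun _ => @Algebra.natmul _ _ _) => apply: comp_rMn
  | |- computable (fun _ => nth (@Algebra.zero _) (@polyseq _ _) _) => apply: comp_coef
  | |- computable (fun _ => @polyseq _ _) => apply comp_polyseq
  | |- computable (fun _ => nth _ _ _) => apply: comp_nth
  | |- computable (fun _ => @polyC _ _) => apply: comp_polyC
  | |- computable (fun _ => @polyX _) => apply: comp_polyX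
  end | program_step3].
Ltac write_program ::= repeat (assumption || program_of_hypothesis || program_step4).

Section PolynomialRings.
Variable F : fieldType.
Local Notation Enc := (@Enc F).
Local Notation CompRing := (@CompRing F).
Context (R : nzRingType) {eR : Enc R} {cR : @CompRing R eR}.

Lemma comp_deriv A (eA : Enc A) (p : A -> {poly R}) : computable p -> computable (fun a => (p a)^`()).
Proof.
move=> hp; apply: comp_poly; first by apply: comp_pred; apply: comp_size.
apply: comp_rMn; last by write_program.
by apply: comp_coef; [apply: (comp_comp hp); write_program | write_program].
Qed.

Lemma comp_map_poly A (eA : Enc A) (f : R -> R) (p : A -> {poly R}) :
  f 0 = 0 -> computable f -> computable p -> computable (fun a => map_poly f (p a)).
Proof.
move=> f0 hf hp; apply: (@comp_ext _ _ _ _ _ (fun a => Poly (map f (p a)))).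
  by move=> a; rewrite map_polyE.
by apply: comp_Poly; apply: comp_map => //; apply: (comp_comp hf); write_program.
Qed.

(** Every operation is given by a formula for its coefficients together with a bound
    on the size, so [comp_poly] applies. *)
Global Instance CompRing_poly : @CompRing {poly R} (enc_polynomial eR).
Proof.
split=> A eA.
- by apply: (@comp_ext _ _ _ _ _ (fun a => Poly [::])) => //; apply: comp_Poly; write_program.
- by apply: (@comp_ext _ _ _ _ _ (fun a => (1 : R)%:P)) => //; write_program.
- move=> f g hf hg.
  apply: (@comp_ext _ _ _ _ _ (fun a => \poly_(i < size (f a) + size (g a)) ((f a)`_i + (g a)`_i))).
    move=> a; apply/polyP => i; rewrite coef_poly coefD; case: ltnP => // h.
    by rewrite !nth_default ?addr0 //; apply: leq_trans h; rewrite ?leq_addr ?leq_addl.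
  apply: comp_poly; first by apply: comp_addn; apply: comp_size.
  by write_program.
- move=> f g hf hg.
  apply: (@comp_ext _ _ _ _ _ (fun a => \poly_(i < size (f a) + size (g a))
     \sum_(j <- iota 0 i.+1) (f a)`_j * (g a)`_(i - j))).
    move=> a; apply/polyP => i; rewrite coef_poly coefM -[iota _ _]/(index_iota 0 i.+1) big_mkord.
    case: ltnP => // h; rewrite -coefM nth_default //.
    by apply: leq_trans (size_polyMleq _ _) (leq_trans (leq_pred _) h).
  apply: comp_poly; first by apply: comp_addn; apply: comp_size.
  apply: comp_sum; last by write_program.
  by write_program.
- move=> f hf; apply: (@comp_ext _ _ _ _ _ (fun a => \poly_(i < size (f a)) - (f a)`_i)).
    by move=> a; apply/polyP => i; rewrite coef_poly coefN; case: ltnP => // h; rewrite nth_default ?oppr0.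
  apply: comp_poly; first exact: comp_size.
  by write_program.
- move=> f hf; apply: (@comp_ext _ _ _ _ _ (fun a => nilp (polyseq (f a)))).
    by move=> a; rewrite /nilp size_poly_eq0.
  exact: comp_nilp.
Qed.

End PolynomialRings.

(** * The algorithm and its program *)

Section Algorithm.
Variable F : numClosedFieldType.
Local Notation P2 := {poly {poly F}}.

(** (s, n, mu) stands for p = n.+1 or p = - n.+1 according to the sign s, and for the
    term x^p / (y + mu).  See [zsgn]. *)
Definition eikey := (bool * nat * F)%type.
Definition likey := (nat * nat * F)%type.
(** A partial answer: lists of Ei terms, of Li terms, of logarithms g with their
    coefficients, and the numerator of the rational part, whose denominator is fixed.
    Linear combinations are formed by concatenation; repeated keys are merged at the
    end by [collect]. *)
Definition outs := (seq (eikey * F) * seq (likey * F) * (seq (P2 * F) * P2))%type.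
(** A polynomial, read as the vector of its coefficients, with its partial answer. *)
Definition row := (P2 * outs)%type.

Definition ei_out (k : eikey) : outs := ([:: (k, 1)], [::], ([::], 0)).
Definition li_out (l : seq (likey * F)) : outs := ([::], l, ([::], 0)).
Definition lg_out (g : P2) : outs := ([::], [::], ([:: (g, 1)], 0)).
Definition rt_out (m : P2) : outs := ([::], [::], ([::], m)).
Definition no_out : outs := ([::], [::], ([::], 0)).

Definition scaled K (r : F) (l : seq (K * F)) := [seq (t.1, r * t.2) | t <- l].

(** w - r b. *)
Definition osub (r : F) (w b : outs) : outs :=
  (w.1.1 ++ scaled (- r) b.1.1, w.1.2 ++ scaled (- r) b.1.2,
   (w.2.1 ++ scaled (- r) b.2.1, w.2.2 - r%:P%:P * b.2.2)).

(** A fraction, numerator and denominator, with a partial answer whose x d/dx it is; x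
    f itself enters with an empty one. *)
Definition item := (P2 * P2 * outs)%type.

Definition ei_items (m : nat) (mus : seq F) : seq item :=
  flatten [seq flatten [seq
    [:: (X1 F ^+ n.+1, yadd mu, ei_out (true, n, mu));
        (1, X1 F ^+ n.+1 * yadd mu, ei_out (false, n, mu))] | n <- iota 0 m] | mu <- mus].

(** A primitive of y^n / (x - a): differentiating y^(n-k) Li_(k+1) (x / a) produces
    (n-k) y^(n-k-1) Li_(k+1) (x / a), which the entry of index k + 1 compensates. *)
Definition li_list n (al : F) : seq (likey * F) :=
  [seq ((k.+1, (n - k)%N, al^-1), - \prod_(j <- iota 0 k) - ((n - j)%N%:R)) | k <- iota 0 n.+1].

Definition li_items (m : nat) (als : seq F) : seq item :=
  flatten [seq [seq ('X^n * X1 F, (lin al)%:P, li_out (li_list n al)) | n <- iota 0 m] | al <- als].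

Definition lg_items (s : seq P2) : seq item := [seq (del g, g, lg_out g) | g <- s].

Definition rt_item (Q m : P2) : item := (del m * Q - m * del Q, Q ^+ 2, rt_out m).

Definition rt_items (m : nat) (Q : P2) : seq item :=
  flatten [seq [seq rt_item Q (X1 F ^+ i * 'X^j) | i <- iota 0 m] | j <- iota 0 m].

Definition clear_item (it : item) (acc : seq row * P2) : seq row * P2 :=
  ((it.1.1 * acc.2, it.2) :: [seq (t.1 * it.1.2, t.2) | t <- acc.1], it.1.2 * acc.2).

Definition clear_denominators (l : seq item) : seq row * P2 := foldr clear_item ([::], 1) l.

(** The leading coefficient of the leading coefficient; its position serves as the
    pivot position. *)
Definition lead2 (b : P2) : F := (b`_(size b).-1)`_(size (b`_(size b).-1)%R).-1.
Definition ratio (b w : P2) : F := (w`_(size b).-1)`_(size (b`_(size b).-1)%R).-1 / lead2 b.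
(** Subtracts from w the multiple of b that kills the coefficient of w at the pivot
    position of b. *)
Definition eliminate (b w : row) : row :=
  (w.1 - (ratio b.1 w.1)%:P%:P * b.1, osub (ratio b.1 w.1) w.2 b.2).

Definition row0 : row := (0, no_out).
Definition pivot (st : seq row * row) : seq row * row :=
  let b := head row0 st.1 in
  if b.1 == 0 then (behead st.1, st.2)
  else ([seq eliminate b w | w <- behead st.1], eliminate b st.2).
Definition solve (st : seq row * row) : row := (iter (size st.1) pivot st).2.

(** Merges the entries with the same key. *)
Definition collect (K : eqType) (l : seq (K * F)) : seq (K * F) :=
  [seq (k, \sum_(t <- [seq t <- l | t.1 == k]) t.2) | k <- undup [seq t.1 | t <- l]].

(** Logarithms with the same coefficient are merged into the logarithm of a product,
    as the indices of an answer have to be distinct. *)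
Definition collect_ln (l : seq (P2 * F)) : seq (F * P2) :=
  [seq (c, \prod_(t <- [seq t <- l | t.2 == c]) t.1) | c <- undup [seq t.2 | t <- l]].

(** Encodes the nonzero integers. *)
Definition zsgn (k : bool * nat) : int := if k.1 then k.2.+1%:Z else - k.2.+1%:Z.

(** The coefficient of Ei (p ln x + l) is a pair (c, - l), meaning c * exp (- l): this
    is the factor that turns exp (p ln x + l) into x^p. *)
Definition expr_of (o : outs) (Q : P2) : expression F :=
  Expression
    [seq ((zsgn t.1.1, (zsgn t.1.1)%:~R * t.1.2), (t.2, - ((zsgn t.1.1)%:~R * t.1.2)))
       | t <- collect o.1.1]
    (collect o.1.2)
    [seq (t.1, Ratio t.2 1) | t <- collect_ln o.2.1]
    (Ratio o.2.2 Q).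

(** A bound on the degree in x that is read off from the coefficient lists. *)
Definition weight (A : P2) : nat := foldr (fun (c : {poly F}) n => (size c + n)%N) 0%N (polyseq A).
Definition bound (A B : P2) : nat :=
  (size A + size B + (weight A + weight B)).+1.

(** If g is a constant multiple of y + mu, the quotient is mu; for other factors g it
    is a harmless extra candidate. *)
Definition mus_of (s : seq P2) : seq F := [seq (g`_0)`_0 / (g`_1)`_0 | g : P2 <- s].
(** If g is a constant multiple of x - a, the quotient is a; for other factors g it is
    a harmless extra candidate. *)
Definition als_of (s : seq P2) : seq F :=
  [seq al <- [seq - ((g`_0)`_0 / (g`_0)`_1) | g : P2 <- s] | al != 0].

(** The candidates for the terms and for the monomials of H allowed by
    [bounded_solution].  The terms with p = 0 are covered by the logarithms of the
    factors of B. *)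
Definition basis_items (A B : P2) (s : seq P2) : seq item :=
  ei_items (bound A B) (mus_of s) ++ li_items (bound A B).+1 (als_of s) ++ lg_items s ++
  rt_items (bound A B + bound A B + bound A B).+2 (X1 F ^+ bound A B * B).

Definition items_of (A B : P2) (s : seq P2) : seq item :=
  (X1 F * A, B, no_out) :: basis_items A B s.

Definition solve_items (l : seq item) : row :=
  let rows := (clear_denominators l).1 in solve (behead rows, head row0 rows).

(** A B are the numerator and denominator of the integrand and s lists the irreducible
    factors of B. *)
Definition integrate_ln (A B : P2) (s : seq P2) : option (expression F) :=
  let t := solve_items (items_of A B s) in
  if t.1 == 0 then Some (expr_of (osub 1 no_out t.2) (X1 F ^+ bound A B * B)) else None.

End Algorithm.

Ltac program_step5 := first [program_step4 | lazymatch goal with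
  | |- computable (fun _ => X1 _) => apply: comp_polyC
  | |- computable (fun _ => @deriv _ _) => apply: comp_deriv
  | |- computable (fun _ => map _ _) => apply: comp_map
  | |- computable (fun _ => filter _ _) => apply: comp_filter
  | |- computable (fun _ => foldr _ _ _) => apply: comp_foldr
  | |- computable (fun _ => iter _ _ _) => apply: comp_iter
  | |- computable (fun _ => @GRing.inv _ _) => apply: comp_Finv
  end].
Ltac write_program ::= repeat (assumption || program_of_hypothesis || program_step5).

Section ComputabilityOfSteps.
Variable F : numClosedFieldType.
Local Notation P1 := {poly F}.
Local Notation P2 := {poly {poly F}}.
Local Notation Enc := (@Enc F).
Context {A : Type} {eA : Enc A}.

Lemma comp_yadd (f : A -> F) : computable f -> computable (fun a => yadd (f a)).
Proof. by rewrite /yadd => hf; write_program. Qed.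

Lemma comp_lin (f : A -> F) : computable f -> computable (fun a => lin (f a)).
Proof. by rewrite /lin => hf; write_program. Qed.

Lemma comp_del (f : A -> P2) : computable f -> computable (fun a => del (f a)).
Proof.
rewrite /del => hf; write_program.
by apply: comp_map_poly; [exact: raddf0 | exact: (comp_deriv (comp_id (A := P1))) | ].
Qed.

Lemma comp_scaled K (eK : Enc K) (r : A -> F) (l : A -> seq (K * F)) :
  computable r -> computable l -> computable (fun a => scaled (r a) (l a)).
Proof. by rewrite /scaled => hr hl; write_program. Qed.

Lemma comp_osub (r : A -> F) (w b : A -> outs F) :
  computable r -> computable w -> computable b -> computable (fun a => osub (r a) (w a) (b a)).
Proof. by rewrite /osub => hr hw hb; write_program; apply: comp_scaled; write_program. Qed.

Lemma comp_lead2 (b : A -> P2) : computable b -> computable (fun a => lead2 (b a)).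
Proof. by rewrite /lead2 => hb; write_program. Qed.

Lemma comp_ratio (b w : A -> P2) : computable b -> computable w -> computable (fun a => ratio (b a) (w a)).
Proof. by rewrite /ratio => hb hw; write_program; apply: comp_lead2. Qed.

Lemma comp_eliminate (b w : A -> row F) : computable b -> computable w -> computable (fun a => eliminate (b a) (w a)).
Proof.
rewrite /eliminate => hb hw; write_program; first by apply: comp_ratio; write_program.
by apply: comp_osub; write_program; apply: comp_ratio; write_program.
Qed.

Lemma comp_no_out : computable (fun _ : A => no_out F).
Proof. by rewrite /no_out; write_program. Qed.

End ComputabilityOfSteps.

Ltac program_step6 := first [program_step5 | lazymatch goal with
  | |- computable (fun _ => yadd _) => apply: comp_yadd
  | |- computable (fun _ => lin _) => apply: comp_lin
  | |- computable (fun _ => del _) => apply: comp_del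
  | |- computable (fun _ => eliminate _ _) => apply: comp_eliminate
  | |- computable (fun _ => osub _ _ _) => apply: comp_osub
  | |- computable (fun _ => no_out _) => apply: comp_no_out
  end].
Ltac write_program ::= repeat (assumption || program_of_hypothesis || program_step6).

Section ComputabilityOfPivot.
Variable F : numClosedFieldType.
Local Notation P1 := {poly F}.
Local Notation P2 := {poly {poly F}}.
Local Notation Enc := (@Enc F).
Context {A : Type} {eA : Enc A}.

Lemma comp_pivot (f : A -> seq (row F) * row F) : computable f -> computable (fun a => pivot (f a)).
Proof. by rewrite /pivot /row0 => hf; write_program. Qed.

End ComputabilityOfPivot.

Section ComputabilityOfSolver.
Variable F : numClosedFieldType.
Local Notation P1 := {poly F}.
Local Notation P2 := {poly {poly F}}.
Local Notation Enc := (@Enc F).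
Context {A : Type} {eA : Enc A}.

Lemma comp_solve_items (f : A -> seq (item F)) : computable f -> computable (fun a => solve_items (f a)).
Proof.
rewrite /solve_items /solve /clear_denominators /clear_item /row0 => hf; write_program.
by apply: comp_pivot; write_program.
Qed.

Lemma comp_ei_items (m : A -> nat) (l : A -> seq F) :
  computable m -> computable l -> computable (fun a => ei_items (m a) (l a)).
Proof. by rewrite /ei_items /ei_out => hm hl; write_program. Qed.

Lemma comp_li_items (m : A -> nat) (l : A -> seq F) :
  computable m -> computable l -> computable (fun a => li_items (m a) (l a)).
Proof.
rewrite /li_items /li_out /li_list => hm hl; write_program.
by apply: comp_prod; write_program.
Qed.

Lemma comp_lg_items (s : A -> seq P2) : computable s -> computable (fun a => lg_items (s a)).
Proof. by rewrite /lg_items /lg_out => hs; write_program. Qed.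

Lemma comp_rt_items (m : A -> nat) (Q : A -> P2) :
  computable m -> computable Q -> computable (fun a => rt_items (m a) (Q a)).
Proof. by rewrite /rt_items /rt_item /rt_out => hm hQ; write_program. Qed.

Lemma comp_bound (p q : A -> P2) : computable p -> computable q -> computable (fun a => bound (p a) (q a)).
Proof. by rewrite /bound /weight => hp hq; write_program. Qed.

Lemma comp_mus_of (s : A -> seq P2) : computable s -> computable (fun a => mus_of (s a)).
Proof. by rewrite /mus_of => hs; write_program. Qed.

Lemma comp_als_of (s : A -> seq P2) : computable s -> computable (fun a => als_of (s a)).
Proof. by rewrite /als_of => hs; write_program. Qed.

Lemma comp_collect (K : eqType) (eK : Enc K) (l : A -> seq (K * F)) : comp_eqType eK ->
  computable l -> computable (fun a => collect (l a)).
Proof.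
rewrite /collect => hK hl; write_program.
  by apply: (comp_sum (R := F)); write_program; apply: hK; write_program.
by apply: comp_undup => //; write_program.
Qed.

Lemma comp_collect_ln (l : A -> seq (P2 * F)) : computable l -> computable (fun a => collect_ln (l a)).
Proof.
rewrite /collect_ln => hl; write_program.
  by apply: comp_prod; write_program; apply: comp_eqType_field; write_program.
by apply: comp_undup; [exact: comp_eqType_field | write_program].
Qed.

End ComputabilityOfSolver.

Ltac program_step7 := first [program_step6 | lazymatch goal with
  | |- computable (fun _ => X1 _ ) => apply: comp_polyC
  | |- computable (fun _ => ei_items _ _) => apply: comp_ei_items
  | |- computable (fun _ => li_items _ _) => apply: comp_li_items
  | |- computable (fun _ => lg_items _) => apply: comp_lg_items
  | |- computable (fun _ => rt_items _ _) => apply: comp_rt_items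
  | |- computable (fun _ => bound _ _) => apply: comp_bound
  | |- computable (fun _ => mus_of _) => apply: comp_mus_of
  | |- computable (fun _ => als_of _) => apply: comp_als_of
  | |- computable (fun _ => collect_ln _) => apply: comp_collect_ln
  end].
Ltac write_program ::= repeat (assumption || program_of_hypothesis || program_step7).

Section MainProgram.
Variable F : numClosedFieldType.
Local Notation P2 := {poly {poly F}}.
Local Notation Enc := (@Enc F).

Definition enc_opt X (eX : Enc X) : Enc (option X) := fun o => if o is Some x then eX x else Nil.

(** The tree that the program builds: an [expression] with pairs for records, field
    elements for integers, and unnormalized fractions. *)
Definition raw_expr :=
  (seq ((F * F) * (F * F)) * seq ((F * F * F) * F) * (seq (F * (P2 * P2)) * (P2 * P2)))%type.

Definition zsgnF (k : bool * nat) : F := if k.1 then k.2.+1%:R else - k.2.+1%:R.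

Definition raw_of (o : outs F) (Q : P2) : raw_expr :=
  ([seq ((zsgnF t.1.1, zsgnF t.1.1 * t.1.2), (t.2, - (zsgnF t.1.1 * t.1.2)))
      | t <- collect o.1.1],
   [seq ((t.1.1.1%:R, t.1.1.2%:R, t.1.2), t.2) | t <- collect o.1.2],
   ([seq (t.1, (t.2, 1)) | t <- collect_ln o.2.1], (o.2.2, Q))).

(** Ratio keeps its arguments when the denominator is not zero, so both sides are the
    same tree. *)
Lemma raw_of_enc o Q : Q != 0 -> enc (raw_of o Q) = enc_expression (expr_of o Q).
Proof.
move=> Q0; rewrite /raw_of /expr_of /enc_expression /=.
move: (collect o.1.1) (collect o.1.2) (collect_ln o.2.1) => l1 l2 l3.
rewrite /enc /enc_pair /enc_list /=.
have frac1 (n d : P2) : d != 0 -> frac (Ratio n d) = (n, d).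
  by move=> d0; rewrite /Ratio insubdK.
congr (Cons (Cons _ _) (Cons _ _)).
- elim: l1 => [|t l IHl] //; apply: (congr2 (@Cons F)); last exact: IHl.
  rewrite /enc_ei /= /zsgn /zsgnF /enc_pair /enc /=.
  by case: t.1.1.1 => /=; rewrite ?mulrNz.
- elim: l2 => [|t l IHl] //; apply: (congr2 (@Cons F)); last exact: IHl.
  by [].
- elim: l3 => [|t l IHl] //; apply: (congr2 (@Cons F)); last exact: IHl.
  by rewrite /enc_ln /enc_ratfun /= frac1 ?oner_neq0.
- by rewrite /enc_ratfun frac1.
Qed.

Definition raw_result (c : P2 * P2 * seq P2) : option raw_expr :=
  let t := solve_items (items_of c.1.1 c.1.2 c.2) in
  if t.1 == 0 then Some (raw_of (osub 1 (no_out F) t.2) (X1 F ^+ bound c.1.1 c.1.2 * c.1.2))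
  else None.

Lemma raw_result_enc (A B : P2) (s : seq P2) : B != 0 ->
  enc_opt (fun x : raw_expr => enc x) (raw_result (A, B, s)) = enc_result (integrate_ln A B s).
Proof.
move=> B0; rewrite /raw_result /integrate_ln /=; case: eqP => //= _.
by rewrite -raw_of_enc // mulf_neq0 ?expf_neq0 // polyC_eq0 polyX_eq0.
Qed.

Lemma comp_raw_of A (eA : Enc A) (o : A -> outs F) (Q : A -> P2) : computable o -> computable Q ->
  computable (fun a => raw_of (o a) (Q a)).
Proof.
rewrite /raw_of /zsgnF => ho hQ; write_program.
- apply: comp_collect; last by write_program.
  by do ![apply: comp_eqType_pair | exact: comp_eqType_bool | exact: comp_eqType_nat
         | exact: comp_eqType_field].
- apply: comp_collect; last by write_program.
  by do ![apply: comp_eqType_pair | exact: comp_eqType_bool | exact: comp_eqType_nat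
         | exact: comp_eqType_field].
Qed.

Lemma comp_raw_result : @computable F _ _ _ (enc_opt (fun x : raw_expr => enc x)) raw_result.
Proof.
have [p hp] : computable (fun c : P2 * P2 * seq P2 => solve_items (items_of c.1.1 c.1.2 c.2)).
  by apply: comp_solve_items; rewrite /items_of /basis_items; write_program.
have [q hq] : computable (fun c : P2 * P2 * seq P2 * row F =>
    raw_of (osub 1 (no_out F) c.2.2) (X1 F ^+ bound c.1.1.1 c.1.1.2 * c.1.1.2)).
  by apply: comp_raw_of; write_program.
have [b hb] : computable (fun c : P2 * P2 * seq P2 * row F => c.2.1 == 0) by write_program.
exists (Comp (If b q (Prim PNil)) (Pair (Prim PId) p)) => factor c.
apply: exec_comp (exec_pair (exec_prim factor PId _) (hp factor c)) _.
rewrite /raw_result; set t := solve_items _.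
have := hb factor (c, t); have := hq factor (c, t); rewrite /=; case: (t.1 == 0) => h1 h2.
  exact: exec_if_true h2 _ h1.
by apply: exec_if_false h2 _; apply: exec_prim.
Qed.

(** One call of the oracle on the denominator, followed by a program without oracle
    calls. *)
Theorem integrate_ln_program : exists p : prog, forall factor (A B : P2) (s : seq P2), B != 0 ->
  factor (enc_poly2 B) = enc_seq (@enc_poly2 F) s ->
  exec factor p (Cons (enc_poly2 A) (enc_poly2 B)) (enc_result (integrate_ln A B s)).
Proof.
have [p hp] := comp_raw_result.
exists (Comp p (Pair (Prim PId) (Comp (Prim PFactor) (Prim PSnd)))) => factor A B s B0 hs.
rewrite -raw_result_enc //; apply: exec_comp (hp factor (A, B, s)).
apply: exec_pair; first exact: exec_prim.
apply: exec_comp; first exact: exec_prim.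
by have := exec_prim factor PFactor (enc_poly2 B); rewrite /= hs.
Qed.

End MainProgram.

(** * Correctness of the elimination *)

Section Solver.
Variable F : numClosedFieldType.
Local Notation P2 := {poly {poly F}}.
Implicit Types (b w : P2) (rs : seq P2).

(** Membership in the span of rs over F, in a recursive form that matches elimination.
    *)
Fixpoint inspan w rs : Prop :=
  if rs is b :: rs' then exists c : F, inspan (w - c%:P%:P * b) rs' else w = 0.

Lemma inspan0 rs : inspan 0 rs.
Proof. by elim: rs => //= b rs IH; exists 0; rewrite mul0r subr0. Qed.

Lemma inspanD w1 w2 rs : inspan w1 rs -> inspan w2 rs -> inspan (w1 + w2) rs.
Proof.
elim: rs w1 w2 => [|b rs IH] w1 w2 /=; first by move=> -> ->; rewrite addr0.
move=> [c1 h1] [c2 h2]; exists (c1 + c2).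
have -> : w1 + w2 - (c1 + c2)%:P%:P * b = (w1 - c1%:P%:P * b) + (w2 - c2%:P%:P * b).
  by rewrite !polyCD; ring.
exact: IH.
Qed.

Lemma inspanZ a w rs : inspan w rs -> inspan (a%:P%:P * w) rs.
Proof.
elim: rs w => [|b rs IH] w /=; first by move=> ->; rewrite mulr0.
move=> [c h]; exists (a * c).
have -> : a%:P%:P * w - (a * c)%:P%:P * b = a%:P%:P * (w - c%:P%:P * b).
  by rewrite !polyCM; ring.
exact: IH.
Qed.

Lemma inspan_mem w rs : w \in rs -> inspan w rs.
Proof.
elim: rs => //= b rs IH; rewrite inE => /orP[/eqP->|/IH h].
  by exists 1; rewrite mul1r subrr; apply: inspan0.
by exists 0; rewrite mul0r subr0.
Qed.

Lemma inspan_map (f : P2 -> P2) w rs :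
  (forall c u v, f (u - c%:P%:P * v) = f u - c%:P%:P * f v) -> f 0 = 0 ->
  inspan w rs -> inspan (f w) (map f rs).
Proof.
move=> hf f0; elim: rs w => [|b rs IH] w /=; first by move=> ->.
by move=> [c h]; exists c; rewrite -hf; apply: IH.
Qed.

Definition eliminate_poly b w : P2 := w - (ratio b w)%:P%:P * b.

Lemma ratio_linear b c u v : ratio b (u - c%:P%:P * v) = ratio b u - c * ratio b v.
Proof. by rewrite /ratio coefB coefCM coefB coefCM mulrBl mulrA. Qed.

Lemma eliminate_poly_linear b c u v : eliminate_poly b (u - c%:P%:P * v) = eliminate_poly b u - c%:P%:P * eliminate_poly b v.
Proof. by rewrite /eliminate_poly ratio_linear !polyCB !polyCM; ring. Qed.

Lemma eliminate_poly0 b : eliminate_poly b 0 = 0.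
Proof. by rewrite /eliminate_poly /ratio !coef0 mul0r !polyC0 mul0r subrr. Qed.

(** The pivot coefficient of b is not zero. *)
Lemma eliminate_poly_self b : b != 0 -> eliminate_poly b b = 0.
Proof.
move=> b0; rewrite /eliminate_poly /ratio divff; first by rewrite mul1r subrr.
by rewrite /lead2 -!lead_coefE !lead_coef_eq0.
Qed.

Lemma solve_cons (b : row F) l t :
  solve (b :: l, t) = if b.1 == 0 then solve (l, t) else solve ([seq eliminate b v | v <- l], eliminate b t).
Proof.
rewrite /solve /= -iterS iterSr {2}/pivot /=.
by case: eqP => _ //=; rewrite size_map.
Qed.

(** Elimination by b is linear and kills b, so if w is a combination of b :: l, its
    reduction is a combination of the reductions of l. *)
Theorem solve_complete (l : seq (row F)) t :
  inspan t.1 [seq v.1 | v <- l] -> (solve (l, t)).1 = 0.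
Proof.
have [n] := ubnP (size l); elim: n l t => // n IHn [|b l] t //= hn.
move=> [c h]; rewrite solve_cons; case: eqP => [b0|/eqP b0].
  by apply: IHn => //; move: h; rewrite b0 mulr0 subr0.
apply: IHn; first by rewrite size_map.
have := inspan_map (@eliminate_poly_linear b.1) (eliminate_poly0 b.1) h.
by rewrite eliminate_poly_linear eliminate_poly_self // mulr0 subr0 -!map_comp.
Qed.

(** Used with [row_ok] for I and T. *)
Lemma solve_ind (I T : row F -> Prop) (l : seq (row F)) t :
  (forall v v', I v -> I v' -> I (eliminate v v')) -> (forall v v', I v -> T v' -> T (eliminate v v')) ->
  (forall n, (n < size l)%N -> I (nth (row0 F) l n)) -> T t -> T (solve (l, t)).
Proof.
move=> hI hT; have [n] := ubnP (size l); elim: n l t => // n IHn [|b l] t //= hn hl ht.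
have hb : I b by apply: (hl 0%N).
rewrite solve_cons; case: eqP => _.
  by apply: IHn => // m hm; apply: (hl m.+1).
apply: IHn; rewrite ?size_map //; last exact: hT.
by move=> m hm; rewrite (nth_map (row0 F)) //; apply: hI => //; apply: (hl m.+1).
Qed.

End Solver.

Section Collect.
(** Partition of a sum by key. *)
Lemma sum_undup_keys (T K : eqType) (V : nmodType) (key : T -> K) (a : T -> V) (l : seq T) :
  \sum_(k <- undup [seq key t | t <- l]) \sum_(t <- l | key t == k) a t = \sum_(t <- l) a t.
Proof.
rewrite (exchange_big_dep predT) //= big_seq [RHS]big_seq; apply: eq_bigr => t ht.
under eq_bigl => k do rewrite eq_sym.
by rewrite -big_filter filter_pred1_uniq ?undup_uniq ?mem_undup ?map_f // big_seq1.
Qed.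
End Collect.

(** * The identity that each row of the linear system records *)

Section Values.
Variable F : numClosedFieldType.
Local Notation P2 := {poly {poly F}}.
Variable L : fractions P2.
Local Notation "p %:F" := (embed L p).
Local Notation X := ((X1 F)%:F).
Local Notation Y := (('X : P2)%:F).
Implicit Types (o : outs F) (r : F).

(** The logarithmic derivative. *)
Definition logd (g : P2) : L := (del g)%:F / g%:F.

Definition eival (l : seq (eikey F * F)) : L :=
  \sum_(t <- l) cstF L t.2 * tval L (TEi (zsgn t.1.1) t.1.2).
Definition lgval (l : seq (P2 * F)) : L := \sum_(t <- l) cstF L t.2 * logd t.1.
(** x d/dx of the partial answer with denominator Q, without the polylogarithms of the
    derivative; [li_null] says that these cancel. *)
Definition oval (Q : P2) o : L :=
  eival o.1.1 + tsum L (li_rat o.1.2) + lgval o.2.1 + dL (o.2.2%:F / Q%:F).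

(** The polylogarithms produced by differentiation have total coefficient zero, see
    [coef_step]. *)
Definition li_null (l : seq (likey F * F)) := forall p (s : nat) la, (0 < p)%N ->
  s.+1%:R * coef l (p, s.+1, la) + coef l (p.+1, s, la) = 0.

Definition out_ok o :=
  [/\ li_ok o.1.2, li_null o.1.2 & forall t, t \in o.2.1 -> t.1 != 0].

Lemma sum_scaled K (f : K -> L) (l1 l2 : seq (K * F)) r :
  \sum_(t <- l1 ++ scaled r l2) cstF L t.2 * f t.1 =
  \sum_(t <- l1) cstF L t.2 * f t.1 + cstF L r * \sum_(t <- l2) cstF L t.2 * f t.1.
Proof.
rewrite big_cat big_map mulr_sumr; congr (_ + _); apply: eq_bigr => t _ /=.
by rewrite cstM mulrA.
Qed.

Lemma li_ratE (l : seq (likey F * F)) : tsum L (li_rat l) = \sum_(t <- l) cstF L t.2 *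
  (if t.1.1.1 == 1%N then - tval L (TLi t.1.1.2 t.1.2^-1) else 0).
Proof.
rewrite /tsum big_map big_filter big_mkcond /=; apply: eq_bigr => t _.
by case: ifP; rewrite ?mulr0 // mulrN raddfN /= mulNr.
Qed.

Lemma coef_scaled (l1 l2 : seq (likey F * F)) r k :
  coef (l1 ++ scaled r l2) k = coef l1 k + r * coef l2 k.
Proof. by rewrite coef_cat /coef big_map mulr_sumr. Qed.

Lemma mem_scaled (K : eqType) (P : K -> Prop) (l1 l2 : seq (K * F)) r :
  (forall t, t \in l1 -> P t.1) -> (forall t, t \in l2 -> P t.1) ->
  forall t, t \in l1 ++ scaled r l2 -> P t.1.
Proof. by move=> h1 h2 t; rewrite mem_cat => /orP[/h1|/mapP[u /h2 h ->]]. Qed.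

Lemma out_ok_osub r w b : out_ok w -> out_ok b -> out_ok (osub r w b).
Proof.
move=> [w1 w2 w3] [b1 b2 b3]; split.
- exact: (mem_scaled (P := fun k : likey F => (0 < k.1.1)%N /\ k.2 != 0)).
- move=> p s la p0; rewrite !coef_scaled mulrDr mulrCA addrACA -mulrDr.
  by rewrite w2 // b2 // mulr0 addr0.
- exact: (mem_scaled (P := fun g : P2 => g != 0)).
Qed.

Lemma oval_osub Q r w b : oval Q (osub r w b) = oval Q w - cstF L r * oval Q b.
Proof.
rewrite /oval /osub /= /eival !li_ratE /lgval !sum_scaled.
rewrite (sum_scaled (fun k : eikey F => tval L (TEi (zsgn k.1) k.2))).
rewrite (sum_scaled (fun k : likey F =>
  if k.1.1 == 1%N then - tval L (TLi k.1.2 k.2^-1) else 0)).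
have -> : (w.2.2 - r%:P%:P * b.2.2)%:F / Q%:F = w.2.2%:F / Q%:F - cstF L r * (b.2.2%:F / Q%:F).
  by rewrite embB embM mulrBl mulrA.
by rewrite dLB dLZ raddfN /=; ring.
Qed.

(** T is x f for the row on the right-hand side of the system, and 0 for the others.
    When the polynomial of the row on the right has been reduced to 0, T + [oval] Q
    w.2 = 0, so that minus the partial answer is an integral of f. *)
Definition row_ok (Q D : P2) (T : L) (w : row F) :=
  out_ok w.2 /\ w.1%:F = D%:F * (T + oval Q w.2).

Lemma row_ok_eliminate Q D T b w : row_ok Q D 0 b -> row_ok Q D T w -> row_ok Q D T (eliminate b w).
Proof.
move=> [b1 b2] [w1 w2]; split; first exact: out_ok_osub.
rewrite /eliminate /= oval_osub embB embM w2 b2 -/(cstF L _); ring.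
Qed.

Definition item_ok Q T (it : item F) :=
  [/\ it.1.2 != 0, out_ok it.2 & it.1.1%:F / it.1.2%:F = T + oval Q it.2].

Definition cleared (D : P2) (it : item F) (w : row F) :=
  w.2 = it.2 /\ w.1%:F = D%:F * (it.1.1%:F / it.1.2%:F).

(** All the rows are multiplied by one common denominator. *)
Lemma clear_spec (l : seq (item F)) : (forall it, it \in l -> it.1.2 != 0) ->
  (clear_denominators l).2 != 0 /\ exists l', [/\ (clear_denominators l).1 = [seq p.2 | p <- l'],
     [seq p.1 | p <- l'] = l & forall p, p \in l' -> cleared (clear_denominators l).2 p.1 p.2].
Proof.
elim: l => [|it l IH] h /=.
  by split; [exact: oner_neq0 | exists [::]].
have d0 : it.1.2 != 0 by apply: h; rewrite mem_head.
have [|D0 [l' [e1 e2 hl]]] := IH; first by move=> x hx; apply: h; rewrite inE hx orbT.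
have fd0 : it.1.2%:F != 0 :> L by rewrite emb_eq0.
split; first by rewrite mulf_neq0.
exists ((it, (it.1.1 * (clear_denominators l).2, it.2)) ::
        [seq (p.1, (p.2.1 * it.1.2, p.2.2)) | p <- l']); split.
- by rewrite /= e1 -!map_comp.
- by rewrite /= -map_comp e2.
- move=> p; rewrite inE => /orP[/eqP ->|/mapP [q /hl [q1 q2] ->]]; split=> //=.
    by rewrite !embM; field.
  by rewrite !embM q2; ring.
Qed.

Lemma eival0 : eival [::] = 0. Proof. exact: big_nil. Qed.
Lemma lgval0 : lgval [::] = 0. Proof. exact: big_nil. Qed.
Lemma li_rat0 : tsum L (li_rat [::]) = 0. Proof. exact: big_nil. Qed.
Lemma frac0 Q : dL (0%:F / Q%:F) = 0 :> L. Proof. by rewrite emb0 mul0r dL0. Qed.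

Lemma li_null0 : li_null [::].
Proof. by move=> p s la _; rewrite /coef !big_nil mulr0 addr0. Qed.

Lemma target_ok Q (A B : P2) : B != 0 -> item_ok Q (X * A%:F / B%:F) (X1 F * A, B, no_out F).
Proof.
move=> B0; split=> //; first by split=> //; exact: li_null0.
by rewrite /oval eival0 lgval0 li_rat0 frac0 embM; ring.
Qed.

Lemma ei_items_ok Q m (mus : seq F) it : it \in ei_items m mus -> item_ok Q 0 it.
Proof.
move=> /flattenP [l1 /mapP [mu _ ->]] /flattenP [l2 /mapP [n _ ->]].
have y0 : yadd mu != 0 by rewrite -size_poly_gt0 size_yadd.
rewrite !inE => /orP[]/eqP ->; split=> //=.
- by split=> //; exact: li_null0.
- rewrite /oval /= /eival big_seq1 lgval0 li_rat0 frac0 /zsgn /= embX cst1.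
  by rewrite mul1r !addr0 add0r.
- by rewrite mulf_neq0 // expf_neq0 // polyC_eq0 polyX_eq0.
- by split=> //; exact: li_null0.
- rewrite /oval /= /eival big_seq1 lgval0 li_rat0 frac0 /zsgn /= embM embX cst1 emb1.
  by rewrite !mul1r !addr0 add0r invfM.
Qed.

Lemma lg_items_ok Q (l : seq P2) it : (forall g, g \in l -> g != 0) ->
  it \in lg_items l -> item_ok Q 0 it.
Proof.
move=> h /mapP [g /h g0 ->]; split=> //=.
  by split=> //; [exact: li_null0 | move=> t; rewrite inE => /eqP ->].
by rewrite /oval /= eival0 /lgval big_seq1 li_rat0 frac0 cst1 /logd; ring.
Qed.

Lemma rt_items_ok Q m it : Q != 0 -> it \in rt_items m Q -> item_ok Q 0 it.
Proof.
move=> Q0 /flattenP [l1 /mapP [j _ ->]] /mapP [i _ ->]; split; rewrite /rt_item /=.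
- by rewrite expf_neq0.
- by split=> //; exact: li_null0.
- rewrite /oval /= eival0 lgval0 li_rat0 dL_frac //; ring.
Qed.

Definition li_coef (n k : nat) : F := - \prod_(j <- iota 0 k) - ((n - j)%N%:R).

(** This recurrence is the cancellation of the polylogarithms in the derivative of
    [li_list]. *)
Lemma li_coefS n k : li_coef n k.+1 = - (n - k)%N%:R * li_coef n k.
Proof.
rewrite /li_coef -(addn1 k) iotaD add0n big_cat big_seq1 /=; ring.
Qed.

Lemma coef_li_list n al p s la : coef (li_list n al) (p.+1, s, la) =
  if (la == al^-1) && (p + s == n)%N then li_coef n p else 0.
Proof.
rewrite /coef big_map; move: (iota 0 n.+1) (mem_iota 0 n.+1) (iota_uniq 0 n.+1) => r hr ur /=.
case: ifP => [/andP[/eqP -> /eqP e]|/negP h].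
  rewrite -(big_seq1 +%R p (li_coef n)) -(@filter_pred1_uniq _ r p) //.
    rewrite big_filter; apply: eq_bigl => k.
    rewrite !xpair_eqE eqSS eqxx andbT /=; case: (eqVneq k p) => [->|_] //.
    by rewrite -e addKn !eqxx.
  by rewrite hr add0n ltnS -e leq_addr.
rewrite big_seq_cond big_pred0 // => k; apply/negbTE/negP => /andP[].
rewrite hr add0n ltnS => hk; rewrite !xpair_eqE eqSS => /andP[/andP[/eqP e1 /eqP e2] /eqP e3].
by apply: h; rewrite -e3 eqxx -e1 -e2 /= (subnKC hk).
Qed.

Lemma li_rat_li_list n al : tsum L (li_rat (li_list n al)) = tval L (TLi n al).
Proof.
have -> : li_list n al = (1%N, n, al^-1, -1) :: [seq ((k.+1, (n - k)%N, al^-1), li_coef n k) | k <- iota 1 n].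
  by rewrite /li_list /= subn0 big_nil.
move: (iota 1 n) (mem_iota 1 n) => r hr.
rewrite li_ratE big_cons big_map big1_seq /=.
  by rewrite invrK raddfN /= cst1; ring.
by move=> k; rewrite hr => /andP[k0 _]; rewrite eqSS eqn0Ngt k0 mulr0.
Qed.

Lemma li_items_ok Q m (als : seq F) it : (forall al, al \in als -> al != 0) ->
  it \in li_items m als -> item_ok Q 0 it.
Proof.
move=> h /flattenP [l1 /mapP [al /h al0 ->]] /mapP [n _ ->]; split=> /=.
- exact: linP_neq0.
- split=> //=; first by move=> t /mapP [k _ ->]; rewrite /= invr_eq0.
  move=> [|p] s la // _; rewrite !coef_li_list addSnnS.
  case: ifP => [/andP[_ /eqP e]|_]; last by rewrite mulr0 addr0.
  by rewrite li_coefS -e addKn; ring.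
- rewrite /oval /= eival0 lgval0 frac0 li_rat_li_list embM embX.
  by rewrite !addr0 !add0r.
Qed.

End Values.

(** * The linear system contains every bounded solution *)

Section Correctness.
Variable F : numClosedFieldType.
Local Notation P2 := {poly {poly F}}.
Variable L : fractions P2.
Local Notation "p %:F" := (embed L p).
Local Notation X := ((X1 F)%:F).
Local Notation Y := (('X : P2)%:F).

Definition frspan (D : P2) (rs : seq P2) (a : L) := exists w, a = w%:F / D%:F /\ inspan w rs.

Lemma frspan0 D rs : frspan D rs 0.
Proof. by exists 0; rewrite emb0 mul0r; split=> //; exact: inspan0. Qed.

Lemma frspanD D rs a b : frspan D rs a -> frspan D rs b -> frspan D rs (a + b).
Proof.
move=> [u [-> hu]] [v [-> hv]]; exists (u + v); split; last exact: inspanD.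
by rewrite embD mulrDl.
Qed.

Lemma frspanZ D rs c a : frspan D rs a -> frspan D rs (cstF L c * a).
Proof.
move=> [u [-> hu]]; exists (c%:P%:P * u); split; last exact: inspanZ.
by rewrite embM mulrA.
Qed.

Lemma frspan_sum D rs (I : eqType) (r : seq I) (f : I -> L) :
  (forall i, i \in r -> frspan D rs (f i)) -> frspan D rs (\sum_(i <- r) f i).
Proof.
move=> h; rewrite big_seq; apply: big_ind => //; first exact: frspan0.
by move=> a b; apply: frspanD.
Qed.

(** The first item is the right-hand side.  [solve_ind] propagates [row_ok] along the
    elimination, and [solve_complete] gives the last clause. *)
Theorem solve_items_spec Q (T : L) it0 l : item_ok Q T it0 ->
  (forall it, it \in l -> item_ok Q (0 : L) it) ->
  exists D rs, [/\ D != 0, row_ok Q D T (solve_items (it0 :: l)),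
    forall it, it \in l -> frspan D rs (it.1.1%:F / it.1.2%:F)
    & frspan D rs (it0.1.1%:F / it0.1.2%:F) -> (solve_items (it0 :: l)).1 = 0].
Proof.
move=> [d0 ok0 e0] hl.
have [|D0 [l' [e1 e2 hc]]] := @clear_spec F L (it0 :: l).
  by move=> it; rewrite inE => /orP[/eqP ->//|/hl []].
rewrite /solve_items; set D := (clear_denominators _).2 in D0 hc *.
have fD0 : D%:F != 0 by rewrite emb_eq0.
case: l' e1 e2 hc => [|[i0 r0] l'] // e1 [ei el] hc; rewrite e1 /=.
have [c1 c2] : cleared L D it0 r0 by rewrite -ei; apply: (hc (i0, r0)); rewrite mem_head.
exists D, [seq p.2.1 | p <- l']; split=> //.
- apply: (@solve_ind F (row_ok Q D (0 : L)) (row_ok Q D T)).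
  + by move=> v v'; apply: row_ok_eliminate.
  + by move=> v v'; apply: row_ok_eliminate.
  + move=> n; rewrite size_map => hn.
    rewrite (nth_map (it0, row0 F)) //; set p := nth _ _ _.
    have hp : p \in l' by apply: mem_nth.
    have [p1 p2] : cleared L D p.1 p.2 by apply: hc; rewrite inE hp orbT.
    have [_ q2 q3] : item_ok Q (0 : L) p.1 by apply: hl; rewrite -el map_f.
    by split; rewrite p1 // p2 q3.
  + by split; rewrite c1 // c2 e0.
- move=> it; rewrite -el => /mapP [p hp ->].
  have [p1 p2] : cleared L D p.1 p.2 by apply: hc; rewrite inE hp orbT.
  exists p.2.1; split; first by rewrite p2 [RHS]mulrAC divff // mul1r.
  by apply: inspan_mem; apply/mapP; exists p.
- move=> [w [ew hw]]; apply: solve_complete.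
  have -> : r0.1 = w by apply: (@emb_inj F L); rewrite c2 ew mulrCA divff ?mulr1.
  by rewrite -map_comp.
Qed.

Section Items.
Variables (A B : P2) (c : F) (s : seq P2).
Hypotheses (B0 : B != 0) (irrs : forall g, g \in s -> irreducible_elt g).
Hypothesis factB : B = c%:P%:P * \prod_(g <- s) g.
Local Notation M := (bound A B).
Local Notation Q := (X1 F ^+ M * B).

Lemma denom_neq0 : Q != 0.
Proof. by rewrite mulf_neq0 // expf_neq0 // polyC_eq0 polyX_eq0. Qed.

Lemma als_of_neq0 al : al \in als_of s -> al != 0.
Proof. by rewrite mem_filter => /andP[]. Qed.

Lemma mem_basis it : (it \in basis_items A B s) =
  [|| it \in ei_items M (mus_of s), it \in li_items M.+1 (als_of s), it \in lg_items s
    | it \in rt_items (M + M + M).+2 Q].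
Proof. by rewrite /basis_items; move: (rt_items _ _) (li_items _ _) => r l; rewrite !mem_cat. Qed.

Lemma items_of_ok it : it \in basis_items A B s -> item_ok Q (0 : L) it.
Proof.
have s0 g : g \in s -> g != 0 by case/irrs.
rewrite mem_basis => /orP[/ei_items_ok h|/orP[h|/orP[h|h]]]; first exact: h.
- exact: li_items_ok als_of_neq0 h.
- exact: lg_items_ok s0 h.
- exact: (@rt_items_ok F L Q _ _ denom_neq0 h).
Qed.

Lemma const_ndvd P (a : F) : irreducible_elt P -> a != 0 -> ~ dvd2 P a%:P%:P.
Proof.
move=> [_ /negP Pu _] a0 [r e]; apply: Pu.
have : a%:P%:P \is a @GRing.unit P2 by apply/unit2P; exists a.
by rewrite e unitrM => /andP[].
Qed.

Lemma dvd2_prod P (l : seq P2) : irreducible_elt P -> dvd2 P (\prod_(g <- l) g) ->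
  exists2 g, g \in l & dvd2 P g.
Proof.
move=> irrP; elim: l => [|g l IH].
  by rewrite big_nil -[1]/(1%:P%:P) => /(const_ndvd irrP (oner_neq0 _)).
rewrite big_cons => /(irreducible_prime irrP) [h|/IH [g' h1 h2]].
  by exists g; rewrite ?mem_head.
by exists g'; rewrite ?inE ?h1 ?orbT.
Qed.

(** Irreducible divisors of B are prime, so they occur in the list s up to a constant.
    *)
Lemma prime_factor P : irreducible_elt P -> dvd2 P B ->
  exists2 g, g \in s & exists2 a : F, a != 0 & g = a%:P%:P * P.
Proof.
move=> irrP hd; have [P0 /negP Pu _] := irrP.
have c0 : c != 0 by apply: contraNneq B0 => z; rewrite factB z !polyC0 mul0r.
have : dvd2 P (\prod_(g <- s) g).
  by move: hd; rewrite factB => /(irreducible_prime irrP) [/(const_ndvd irrP c0)|].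
case/(dvd2_prod irrP) => g gs [r er]; exists g => //.
have [_ _ /(_ _ _ er) [//|/unit2P [a a0 ea]]] := irrs gs.
by exists a; rewrite // er ea mulrC.
Qed.

Lemma logd_const P a : a != 0 -> P != 0 -> logd L (a%:P%:P * P) = logd L P.
Proof.
move=> a0 P0; rewrite /logd delZ !embM; field.
by rewrite !emb_eq0 P0 !polyC_eq0 a0.
Qed.

Lemma yadd_in_mus mu a g : g \in s -> a != 0 -> g = a%:P%:P * yadd mu -> mu \in mus_of s.
Proof.
move=> gs a0 e; apply/mapP; exists g => //.
rewrite e !coefCM /yadd !coefD !coefX !(coefC, coef0, coef1, coefD, coefX) /=.
by rewrite add0r addr0 mulr1 mulrC mulKf.
Qed.

Lemma lin_in_als al a g : g \in s -> a != 0 -> al != 0 -> g = a%:P%:P * (lin al)%:P ->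
  al \in als_of s.
Proof.
move=> gs a0 al0 e; rewrite mem_filter al0; apply/mapP; exists g => //.
rewrite e !coefCM coefC /= /lin !coefB !coefX !coefC /=.
by rewrite sub0r subr0 mulr1 mulrN mulNr opprK mulrC mulKf.
Qed.

Section Spanned.
Variables (D : P2) (rs : seq P2).
Hypothesis span : forall it, it \in basis_items A B s ->
  frspan D rs (it.1.1%:F / it.1.2%:F).

Lemma span_logd P : irreducible_elt P -> dvd2 P B -> frspan D rs (logd L P).
Proof.
move=> irrP /(prime_factor irrP) [g gs [a a0 e]].
have <- : logd L g = logd L P by rewrite e logd_const //; case: irrP.
apply: (span (it := (del g, g, lg_out g))); rewrite mem_basis.
by apply/orP; right; apply/orP; right; apply/orP; left; apply/mapP; exists g.
Qed.

(** The candidate lists contain every allowed term; a term with p = 0, or a [TLog]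
    term, is the logarithmic derivative of a factor of B. *)
Lemma span_term t : term_ok t -> dvd2 (tprime t) B -> (wI t <= M)%N -> (w0 t <= M)%N ->
  (wY t <= M)%N -> frspan D rs (tval L t).
Proof.
move=> ok hd hI h0 hY; have irr := tprime_irr ok.
have [g gs [a a0 eg]] := prime_factor irr hd.
case: t ok hd hI h0 hY irr eg => [p mu|n al|P] /= ok hd hI h0 hY irr eg; last exact: span_logd.
- have hm := yadd_in_mus gs a0 eg.
  case: p hI h0 => [[|n]|n] hI h0.
  + have -> : X ^ 0 / (yadd mu)%:F = logd L (yadd mu).
      by rewrite /logd /yadd delD del_Y del_const addr0 expr0z emb1.
    exact: span_logd.
  + have := span (it := (X1 F ^+ n.+1, yadd mu, ei_out (true, n, mu))).
    rewrite /= embX; apply; rewrite mem_basis; apply/orP; left.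
    apply/flattenP; eexists; first by apply/mapP; exists mu.
    apply/flattenP; eexists; first by apply/mapP; exists n; rewrite ?mem_iota.
    by rewrite mem_head.
  + have := span (it := (1, X1 F ^+ n.+1 * yadd mu, ei_out (false, n, mu))).
    rewrite /= embM embX emb1 div1r invfM; apply; rewrite mem_basis; apply/orP; left.
    apply/flattenP; eexists; first by apply/mapP; exists mu.
    apply/flattenP; eexists; first by apply/mapP; exists n; rewrite ?mem_iota.
    by rewrite !inE eqxx orbT.
- have hm := lin_in_als gs a0 ok eg.
  have := span (it := ('X^n * X1 F, (lin al)%:P, li_out (li_list n al))).
  rewrite /= embM embX; apply; rewrite mem_basis; apply/orP; right; apply/orP; left.
  apply/flattenP; eexists; first by apply/mapP; exists al.
  by apply/mapP; exists n; rewrite ?mem_iota.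
Qed.

Lemma span_monomial i j : (i < (M + M + M).+2)%N -> (j < (M + M + M).+2)%N ->
  frspan D rs (dL ((X1 F ^+ i * 'X^j)%:F / Q%:F)).
Proof.
move=> hi hj; have := span (it := rt_item Q (X1 F ^+ i * 'X^j)).
rewrite /= dL_frac; last exact: denom_neq0.
rewrite embX; apply; rewrite mem_basis; do 3 (apply/orP; right).
apply/flattenP; eexists; first by apply/mapP; exists j; rewrite ?mem_iota.
by apply/mapP; exists i; rewrite ?mem_iota.
Qed.

(** By linearity it suffices to consider monomials. *)
Lemma span_exact N : (sizeY N <= (M + M + M).+2)%N -> (size N <= (M + M + M).+2)%N ->
  frspan D rs (dL (N%:F / Q%:F)).
Proof.
move=> hY hX.
have -> : N = \sum_(0 <= j < size N) \sum_(0 <= i < size (N`_j)%R)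
    ((N`_j)%R`_i)%R%:P%:P * (X1 F ^+ i * 'X^j).
  rewrite -{1}[N]coefK poly_def big_mkord; apply: eq_bigr => j _.
  rewrite -mul_polyC -{1}[(N`_j)%R]coefK poly_def big_mkord.
  rewrite raddf_sum mulr_suml; apply: eq_bigr => i _.
  by rewrite /= -mul_polyC polyCM /X1 -polyC_exp mulrA.
rewrite raddf_sum mulr_suml raddf_sum; apply: frspan_sum => j; rewrite mem_index_iota => /andP[_ hj].
rewrite raddf_sum mulr_suml raddf_sum; apply: frspan_sum => i; rewrite mem_index_iota => /andP[_ hi].
rewrite /= [X in X / _]embM -/(cstF L _) -[X in dL X]mulrA dLZ; apply/frspanZ/span_monomial.
  by apply: leq_trans hi (leq_trans (max_size_coefXY _ _) hY).
exact: leq_trans hj hX.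
Qed.

Lemma span_all N l : (sizeY N <= 3 * M + 2)%N -> (size N <= 3 * M + 2)%N -> all_ok l ->
  (forall t : F * term F, t \in l -> [/\ dvd2 (tprime t.2) B, (wI t.2 <= M)%N, (w0 t.2 <= M)%N
       & (wY t.2 <= M)%N]) ->
  frspan D rs (dL (N%:F / Q%:F) + tsum L l).
Proof.
have -> : (3 * M + 2 = (M + M + M).+2)%N by lia.
move=> hY hX ok h; apply: frspanD; first exact: span_exact.
apply: frspan_sum => t ht; have [h1 h2 h3 h4] := h t ht.
by apply/frspanZ/span_term => //; apply: ok.
Qed.

End Spanned.
End Items.
End Correctness.

(** * Liouville form of logarithmic derivatives, size bounds, collected lists *)

Section ElementaryValues.
Variable F : numClosedFieldType.
Local Notation P2 := {poly {poly F}}.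
Variable L : fractions P2.
Local Notation "p %:F" := (embed L p).
Local Notation X := ((X1 F)%:F).
Local Notation Y := (('X : P2)%:F).

(** The form to which [bounded_solution] applies. *)
Definition representable (a : L) := exists H l, all_ok l /\ a = dL H + tsum L l.

Lemma rep_dL H : representable (dL H).
Proof. by exists H, [::]; rewrite /tsum big_nil addr0. Qed.

Lemma repD a b : representable a -> representable b -> representable (a + b).
Proof.
move=> [H [l [ok ->]]] [H' [l' [ok' ->]]]; exists (H + H'), (l ++ l'); split.
  by move=> t; rewrite mem_cat => /orP[/ok|/ok'].
by rewrite dLD /tsum big_cat /= addrACA.
Qed.

Lemma repZ c a : representable a -> representable (cstF L c * a).
Proof.
move=> [H [l [ok ->]]]; exists (cstF L c * H), [seq (c * t.2.1, t.2.2) | t <- [seq (tt, t) | t <- l]].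
split; first by move=> u /mapP [[[] t] /mapP [t' /ok h [->]] ->].
rewrite dLZ mulrDr /tsum !big_map mulr_sumr; congr (_ + _).
by apply: eq_bigr => t _; rewrite cstM mulrA.
Qed.

Lemma rep_sum (I : eqType) (r : seq I) (f : I -> L) :
  (forall i, i \in r -> representable (f i)) -> representable (\sum_(i <- r) f i).
Proof.
move=> h; rewrite big_seq; apply: big_ind => //; last by move=> a b; apply: repD.
by rewrite -(@dL0 F L); apply: rep_dL.
Qed.

Lemma rep_term t : term_ok t -> representable (tval L t).
Proof.
move=> ok; exists 0, [:: (1, t)]; split; first by move=> u; rewrite inE => /eqP ->.
by rewrite dL0 /tsum big_seq1 cst1 mul1r add0r.
Qed.

Lemma logdM p q : p != 0 -> q != 0 -> logd L (p * q) = logd L p + logd L q.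
Proof.
move=> p0 q0; rewrite /logd delM embD !embM; field.
by rewrite !emb_eq0 p0 q0.
Qed.

Lemma logd1 : logd L 1 = 0.
Proof. by rewrite /logd del1 emb0 mul0r. Qed.

Lemma logd_prod (s : seq P2) : (forall g, g \in s -> g != 0) ->
  logd L (\prod_(g <- s) g) = \sum_(g <- s) logd L g.
Proof.
elim: s => [|g s IH] h; first by rewrite !big_nil logd1.
have hs g' : g' \in s -> g' != 0 by move=> hg; apply: h; rewrite inE hg orbT.
have p0 : \prod_(g' <- s) g' != 0 by rewrite prodf_seq_neq0; apply/allP => g' /hs.
by rewrite !big_cons logdM // ?IH // h ?mem_head.
Qed.

(** The four kinds of normed irreducible polynomials: x itself, whose logarithmic
    derivative is 1 = [dL] y, y + mu, x - a, and all others. *)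
Lemma rep_logd_irreducible P : irreducible_elt P -> normed P -> representable (logd L P).
Proof.
move=> irr nP; have [->|nx] := eqVneq P (X1 F).
  have -> : logd L (X1 F) = dL Y.
    by rewrite /logd del_X1 dL_emb del_Y emb1 divff // X_neq0.
  exact: rep_dL.
have [[mu e]|ny] := pselect (exists mu, P = yadd mu).
  have -> : logd L P = tval L (TEi 0 mu).
    by rewrite e /logd /yadd delD del_Y del_const addr0 /= expr0z emb1.
  exact: rep_term.
have [[al e]|nl] := pselect (exists al, P = (lin al)%:P).
  have al0 : al != 0 by apply: contraNneq nx => z; rewrite e z -X1E.
  have -> : logd L P = tval L (TLi 0 al).
    rewrite e /logd /= expr0 mul1r; congr (_%:F / _).
    by rewrite /lin polyCB delB del_X1 del_const subr0.
  exact: rep_term.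
apply: (@rep_term (TLog P)); split=> //; first exact/eqP.
  by move=> mu e; apply: ny; exists mu.
by move=> al e; apply: nl; exists al.
Qed.

(** Factor q and use that [logd] is additive on products. *)
Lemma rep_logd q : q != 0 -> representable (logd L q).
Proof.
move=> q0; have [c [s [irr e]]] := factorization_exists q0.
have c0 : c != 0 by apply: contraNneq q0 => z; rewrite e z !polyC0 mul0r.
have s0 g : g \in s -> g != 0 by case/irr.
rewrite e logd_const //; last by apply: contraNneq q0 => z; rewrite e z mulr0.
rewrite logd_prod //; apply: rep_sum => g /irr /normalize [P [d [d0 -> nP irrP]]].
rewrite logd_const //; last by case: irrP.
exact: rep_logd_irreducible.
Qed.

Lemma logderiv n d : n != 0 -> d != 0 ->
  dL (n%:F / d%:F) / (n%:F / d%:F) = logd L n - logd L d.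
Proof.
move=> n0 d0; rewrite dL_frac // /logd embB !embM; field.
by rewrite !emb_eq0 n0 d0.
Qed.

End ElementaryValues.

Section Bounds.
Variable F : numClosedFieldType.
Local Notation P2 := {poly {poly F}}.
Implicit Types A B : P2.

Lemma weight_ge A i : (size (A`_i)%R <= weight A)%N.
Proof.
rewrite /weight; have [h|h] := ltnP i (size A); last by rewrite nth_default ?size_poly0.
elim: (polyseq A) i h => //= c s IH [|i] /= h; first exact: leq_addr.
by apply: leq_trans (IH _ _) (leq_addl _ _).
Qed.

Lemma sizeY_weight A : (sizeY A <= weight A)%N.
Proof. by apply/bigmax_leqP => i _; apply: weight_ge. Qed.

Lemma bound_size A B : [/\ (sizeY (X1 F * A) <= bound A B)%N, (sizeY B <= bound A B)%N,
  (size A <= bound A B)%N & (size B <= bound A B)%N].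
Proof.
have hA := sizeY_weight A; have hB := sizeY_weight B.
have hx : (sizeY (X1 F * A) <= (sizeY A).+1)%N.
  have [->|A0] := eqVneq A 0; first by rewrite mulr0 sizeY0.
  by rewrite sizeYM // ?polyC_eq0 ?polyX_eq0 // -[X1 F]expr1 sizeY_X1.
rewrite /bound; move: hA hB hx; move: (sizeY _) (sizeY A) (sizeY B) (size A) (size B).
by move=> a b c d e; split; lia.
Qed.
End Bounds.

Section Collecting.
Variable F : numClosedFieldType.
Local Notation P2 := {poly {poly F}}.
Variable L : fractions P2.

Lemma collect_uniq (K : eqType) (l : seq (K * F)) : uniq [seq t.1 | t <- collect l].
Proof. by rewrite -map_comp map_id undup_uniq. Qed.

Lemma collect_keys (K : eqType) (l : seq (K * F)) t : t \in collect l ->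
  exists2 t', t' \in l & t'.1 = t.1.
Proof.
by move=> /mapP [k]; rewrite mem_undup => /mapP [t' h ->] ->; exists t'.
Qed.

Lemma sum_collect (K : eqType) (f : K -> L) (l : seq (K * F)) :
  \sum_(t <- collect l) cstF L t.2 * f t.1 = \sum_(t <- l) cstF L t.2 * f t.1.
Proof.
rewrite -[RHS](sum_undup_keys (fun t => t.1)) big_map; apply: eq_bigr => k _ /=.
rewrite big_filter raddf_sum mulr_suml; by apply: eq_bigr => t /eqP ->.
Qed.

Lemma coef_collect (l : seq (likey F * F)) k : coef (collect l) k = coef l k.
Proof.
rewrite /coef big_map big_mkcond [RHS]big_mkcond /= -[RHS](sum_undup_keys (fun t => t.1)).
apply: eq_bigr => k' _; rewrite big_filter; case: (eqVneq k' k) => [->|ne].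
  by apply: eq_bigr => t ->.
by rewrite big1 // => t /eqP ->; rewrite (negPf ne).
Qed.

End Collecting.

From mathcomp Require Import all_classical all_reals all_analysis.
From mathcomp Require Import complex.
Import numFieldNormedType.Exports.
(** * Complex derivatives by epsilon estimates *)

Local Open Scope classical_set_scope.
Local Open Scope ring_scope.
Section DeriveEps.
Variable K : numFieldType.

Lemma is_deriveP (f : K -> K) (x d : K) : is_derive x 1 f d <->
  forall e, 0 < e -> \forall h \near (0 : K), `|f (h + x) - f x - d * h| <= e * `|h|.
Proof.
split=> [[df dE] e e0|h].
  have : (fun h => h^-1 *: ((f \o shift x) (h *: 1) - f x)) @ 0^' --> d.
    by rewrite -dE; exact: df.
  move/cvgrPdist_le => /(_ e e0); rewrite /= near_withinE; apply: filterS => h hh.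
  have [->|h0] := eqVneq h 0; first by rewrite add0r subrr mulr0 subr0 normr0 mulr0.
  have := hh h0; rewrite [h *: 1]mulr1 => {}hh.
  have -> : f (h + x) - f x - d * h = - ((d - h^-1 *: (f (h + x) - f x)) * h).
    by rewrite mulrBl [_ *: _]mulrC mulfVK // opprB.
  by rewrite normrN normrM ler_wpM2r.
suff c : (fun h => h^-1 *: ((f \o shift x) (h *: 1) - f x)) @ 0^' --> d.
  split; first by apply/cvg_ex; exists d.
  exact/cvg_lim.
apply/cvgrPdist_le => e e0; rewrite near_withinE; have := h e e0; apply: filterS => t ht t0.
rewrite /= [t *: 1]mulr1 -(ler_pM2r (x := `|t|)) ?normr_gt0 // -normrM.
apply: le_trans ht; rewrite mulrBl [_ *: _]mulrC mulfVK //.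
by rewrite -normrN opprB.
Qed.

Lemma is_derive_continuous (f : K -> K) (x d : K) : is_derive x 1 f d -> {for x, continuous f}.
Proof.
move=> [df _]; apply: differentiable_continuous; exact/derivable1_diffP.
Qed.

Lemma near_increment (f : K -> K) (x : K) (P : K -> Prop) : {for x, continuous f} ->
  (\forall k \near (0 : K), P k) -> \forall h \near (0 : K), P (f (h + x) - f x).
Proof.
move=> cf hP; have h1 : \forall w \near f x, P (w - f x).
  by apply/nbhs0P; apply: filterS hP => k; rewrite addrAC subrr add0r.
have /nbhs0P h2 : \forall t \near x, P (f t - f x) by exact: cf h1.
by apply: filterS h2 => h /=; rewrite [h + x]addrC.
Qed.

Lemma is_derive_comp (f g : K -> K) (x df dg : K) : is_derive x 1 f df ->
  is_derive (f x) 1 g dg -> is_derive x 1 (g \o f) (dg * df).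
Proof.
move=> hf /is_deriveP hg; have cf := is_derive_continuous hf.
move/is_deriveP: hf => hf; apply/is_deriveP => e e0.
pose A := `|df| + 1; pose B := `|dg| + 1.
have A0 : 0 < A by rewrite ltr_wpDl.
have B0 : 0 < B by rewrite ltr_wpDl.
have cA : 0 < e / 2 / A by rewrite !divr_gt0.
have cB : 0 < e / 2 / B by rewrite !divr_gt0.
have near1 := near_increment cf (hg _ cA).
apply: filterS3 near1 (hf _ ltr01) (hf _ cB) => h /=; rewrite subrK mul1r.
set k := f (h + x) - f x => h1 h2 h3.
have hk : `|k| <= A * `|h|.
  have -> : k = (k - df * h) + df * h by ring.
  by apply: le_trans (ler_normD _ _) _; rewrite normrM mulrDl mul1r addrC lerD2l.
have -> : g (f (h + x)) - g (f x) - dg * df * h =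
    (g (f (h + x)) - g (f x) - dg * k) + dg * (k - df * h) by ring.
apply: le_trans (ler_normD _ _) _; rewrite normrM.
have -> : e * `|h| = e / 2 / A * (A * `|h|) + B * (e / 2 / B * `|h|).
  by field; rewrite !gt_eqF.
apply: lerD; first by apply: le_trans h1 _; rewrite ler_pM2l.
by apply: ler_pM => //; rewrite lerDl.
Qed.

Lemma is_derive_unique (f : K -> K) (x d d' : K) : is_derive x 1 f d -> is_derive x 1 f d' -> d = d'.
Proof. by move=> [_ <-] [_ <-]. Qed.

(** The difference quotient of f is the inverse of that of g at f x. *)
Lemma is_derive_inverse (f g : K -> K) (x d : K) : d != 0 -> {for x, continuous f} ->
  (\forall t \near x, g (f t) = t) -> is_derive (f x) 1 g d -> is_derive x 1 f d^-1.
Proof.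
move=> d0 cf gf /is_deriveP dg; apply/is_deriveP => e e0.
have ad0 : 0 < `|d| by rewrite normr_gt0.
have c1 : 0 < e * `|d| / 2 * `|d| by rewrite mulr_gt0 // divr_gt0 // mulr_gt0.
have c2 : 0 < `|d| / 2 by rewrite divr_gt0.
have near1 := near_increment cf (dg _ c1); have near2 := near_increment cf (dg _ c2).
have near3 : \forall h \near (0 : K), g (f (h + x)) = h + x.
  by move/nbhs0P: gf => h1; apply: filterS h1 => h /=; rewrite [h + x]addrC.
have gx := nbhs_singleton gf.
apply: filterS3 near1 near2 near3 => h; set k := f (h + x) - f x.
rewrite /k subrK -/k gx => + + e3; rewrite e3 addrK => h1 h2.
have hk : `|d| * `|k| <= 2 * `|h|.
  have : `|d| * `|k| <= `|h| + `|d| / 2 * `|k|.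
    rewrite -normrM; have -> : d * k = h - (h - d * k) by ring.
    by apply: le_trans (ler_normB _ _) _; rewrite lerD2l.
  rewrite -lerBlDr => h3; have -> : `|d| * `|k| = 2 * (`|d| * `|k| - `|d| / 2 * `|k|) by field.
  by rewrite ler_pM2l.
rewrite -(ler_pM2l ad0) -normrM mulrBr mulrA divff // mul1r distrC.
apply: le_trans h1 _.
have -> : e * `|d| / 2 * `|d| * `|k| = e * `|d| / 2 * (`|d| * `|k|) by ring.
have -> : `|d| * (e * `|h|) = e * `|d| / 2 * (2 * `|h|) by field.
by rewrite ler_pM2l // divr_gt0 // mulr_gt0.
Qed.

End DeriveEps.

(** * The complex exponential and logarithm *)

Local Open Scope complex_scope.
Section ComplexTopology.
Variable R : realType.
Local Notation C := (CC R).
Implicit Types (z w : C) (a b e : R).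

Definition cabs z : R := complex.Re `|z|.
Definition cre z : R := complex.Re z.
Definition cim z : R := complex.Im z.

Lemma normCE z : `|z| = (cabs z)%:C :> C.
Proof. by rewrite /cabs normc_def. Qed.

Lemma cabsE z : cabs z = Num.sqrt (cre z ^+ 2 + cim z ^+ 2).
Proof. by rewrite /cabs normc_def. Qed.

Lemma leCR a b : ((a%:C : C) <= b%:C) = (a <= b). Proof. exact: lecR. Qed.
Lemma ltCR a b : ((a%:C : C) < b%:C) = (a < b). Proof. exact: ltcR. Qed.

Lemma posC (e : C) : 0 < e -> exists2 e' : R, 0 < e' & e = e'%:C.
Proof. by case: e => a b; rewrite ltcE /= => /andP[/eqP -> h]; exists a. Qed.

Lemma cabs_re z : `|cre z| <= cabs z.
Proof. by rewrite cabsE -sqrtr_sqr ler_wsqrtr // lerDl sqr_ge0. Qed.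

Lemma cabs_im z : `|cim z| <= cabs z.
Proof. by rewrite cabsE -sqrtr_sqr ler_wsqrtr // lerDr sqr_ge0. Qed.

Lemma cabs_le z : cabs z <= `|cre z| + `|cim z|.
Proof.
rewrite cabsE -(ler_sqr (x := Num.sqrt _)) ?nnegrE ?sqrtr_ge0 ?addr_ge0 //.
rewrite sqr_sqrtr ?addr_ge0 ?sqr_ge0 // sqrrD !real_normK ?num_real //.
by rewrite addrAC lerDl mulrn_wge0 // mulr_ge0.
Qed.

Lemma cabs_ge0 z : 0 <= cabs z. Proof. by rewrite cabsE sqrtr_ge0. Qed.

Lemma nearC (P : C -> Prop) z : (\forall w \near z, P w) <->
  exists2 e : R, 0 < e & forall w, cabs (w - z) < e -> P w.
Proof.
split=> [/nbhs_normP [e /= /posC [e' e'0 ->] h]|[e e0 h]].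
  by exists e' => // w hw; apply: h; rewrite /ball_ /= distrC normCE ltCR.
apply/nbhs_normP; exists e%:C => /=; first by rewrite -[0]/(0%:C : C) ltCR.
by move=> w /=; rewrite distrC normCE ltCR; apply: h.
Qed.

Lemma nearR (P : R -> Prop) a : (\forall b \near a, P b) <->
  exists2 e : R, 0 < e & forall b, `|b - a| < e -> P b.
Proof.
split=> [/nbhs_normP [e /= e0 h]|[e e0 h]].
  by exists e => // w hw; apply: h; rewrite /ball_ /= distrC.
by apply/nbhs_normP; exists e => // w /=; rewrite distrC; apply: h.
Qed.

Lemma cre_continuous : continuous cre.
Proof.
move=> z; apply/(@cvgrPdist_lt _ _ _ (nbhs z)) => e e0; apply/nearC; exists e => // w hw.
apply: le_lt_trans hw; rewrite distrC; have -> : cre w - cre z = cre (w - z).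
  by case: w; case: z.
exact: cabs_re.
Qed.

Lemma cim_continuous : continuous cim.
Proof.
move=> z; apply/(@cvgrPdist_lt _ _ _ (nbhs z)) => e e0; apply/nearC; exists e => // w hw.
apply: le_lt_trans hw; rewrite distrC; have -> : cim w - cim z = cim (w - z).
  by case: w; case: z.
exact: cabs_im.
Qed.

Lemma contRP (g : C -> R) z : {for z, continuous g} <->
  forall e, 0 < e -> \forall w \near z, `|g z - g w| < e.
Proof. exact: (@cvgrPdist_lt _ _ _ (nbhs z)). Qed.

Lemma contCP (g : C -> C) z : {for z, continuous g} <->
  forall e : C, 0 < e -> \forall w \near z, `|g z - g w| < e.
Proof. exact: (@cvgrPdist_lt _ _ _ (nbhs z)). Qed.

Lemma complex_cvg (f : C -> C) z : {for z, continuous (cre \o f)} ->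
  {for z, continuous (cim \o f)} -> {for z, continuous f}.
Proof.
move=> /contRP h1 /contRP h2; apply/contCP => e /posC [e' e'0 ->].
have e2 : 0 < e' / 2 by rewrite divr_gt0.
have {}h1 := h1 _ e2; have {}h2 := h2 _ e2.
apply: filterS2 h1 h2 => w /= h1 h2; rewrite normCE ltCR.
apply: le_lt_trans (cabs_le _) _; rewrite [e']splitr.
have -> : cre (f z - f w) = cre (f z) - cre (f w) by case: (f z); case: (f w).
have -> : cim (f z - f w) = cim (f z) - cim (f w) by case: (f z); case: (f w).
by apply: ltrD.
Qed.

Lemma complexP z w : cre z = cre w -> cim z = cim w -> z = w.
Proof. by case: z w => a b [c d] /= -> ->. Qed.

Lemma CexpD z w : Cexp (z + w) = Cexp z * Cexp w.
Proof.
case: z w => [a b] [c d]; apply: complexP; rewrite /= expRD ?cosD ?sinD; ring.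
Qed.

Lemma Cexp0 : Cexp (0 : C) = 1.
Proof. by apply: complexP; rewrite /= expR0 ?cos0 ?sin0 mul1r. Qed.

Lemma Cexp_neq0 z : Cexp z != 0.
Proof.
apply/eqP => h; have := CexpD z (- z); rewrite h mul0r subrr Cexp0 => /eqP.
by rewrite oner_eq0.
Qed.

Lemma CexpN z : Cexp (- z) = (Cexp z)^-1.
Proof.
apply: (mulfI (Cexp_neq0 z)); rewrite -CexpD subrr Cexp0 divff //.
exact: Cexp_neq0.
Qed.

Lemma CexpMn z n : Cexp (z *+ n) = Cexp z ^+ n.
Proof.
elim: n => [|n IHn]; first by rewrite mulr0n Cexp0 expr0.
by rewrite mulrS CexpD IHn exprS.
Qed.

Lemma real_derive_eps (f : R -> R) (d e : R) : is_derive (0 : R) 1 f d -> 0 < e ->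
  exists2 t : R, 0 < t & forall h, `|h| < t -> `|f h - f 0 - d * h| <= e * `|h|.
Proof.
move=> /is_deriveP h e0; have /nearR [t t0 ht] := h e e0; exists t => // k hk.
by have := ht k; rewrite subr0 addr0; apply.
Qed.

Lemma is_derive_Cexp0 : is_derive (0 : C) 1 (@Cexp R) 1.
Proof.
apply/is_deriveP => _ /posC [e e0 ->]; apply/nearC.
(* the errors of exp, cos and sin enter below with factors that add up to at most 12 *)
have e4 : 0 < e / 12 by rewrite divr_gt0.
have [t1 t10 h1] := real_derive_eps (is_derive_expR 0) e4.
have [t2 t20 h2] := real_derive_eps (is_derive_cos 0) e4.
have [t3 t30 h3] := real_derive_eps (is_derive_sin 0) e4.
have [t4 t40 h4] := real_derive_eps (is_derive_expR 0) ltr01.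
pose m := Num.min (Num.min t1 t2) (Num.min (Num.min t3 t4) (Num.min 1 (e / 12))).
exists m; first by rewrite !lt_min t10 t20 t30 t40 ltr01 divr_gt0.
move=> [a b]; rewrite subr0 !lt_min => /andP[/andP[k1 k2] /andP[/andP[k3 k4] /andP[k5 k6]]].
have ha := cabs_re (a +i* b : C); have hb := cabs_im (a +i* b : C).
rewrite /= in ha hb; set r := cabs _ in ha hb k1 k2 k3 k4 k5 k6 *.
have {}h1 := h1 a (le_lt_trans ha k1); have {}h2 := h2 b (le_lt_trans hb k2).
have {}h3 := h3 b (le_lt_trans hb k3); have {}h4 := h4 a (le_lt_trans ha k4).
move: h1 h2 h3 h4; rewrite expR0 cos0 sin0 !mul1r oppr0 mul0r !subr0 ?addr0 => h1 h2 h3 h4.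
have r0 : 0 <= r by apply: cabs_ge0.
have k5' := ltW k5; have k6' := ltW k6.
have aE : `|expR a - 1| <= 2 * r.
  have -> : expR a - 1 = (expR a - 1 - a) + a by ring.
  by apply: le_trans (ler_normD _ _) _; rewrite mulr_natl; apply: lerD => //; apply: le_trans ha.
have bE : `|expR a| <= 3.
  have -> : expR a = (expR a - 1) + 1 by ring.
  apply: le_trans (ler_normD _ _) _; rewrite normr1; lra.
have er0 : 0 <= e / 12 * r by rewrite mulr_ge0 // ltW.
have h1' : `|expR a - 1 - a| <= e / 12 * r by apply: le_trans h1 _; rewrite ler_pM2l.
have h2' : `|cos b - 1| <= e / 12 * r by apply: le_trans h2 _; rewrite ler_pM2l.
have h3' : `|sin b - b| <= e / 12 * r by apply: le_trans h3 _; rewrite ler_pM2l.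
have re : `|expR a * cos b - 1 - a| <= e / 4 * r.
  have -> : expR a * cos b - 1 - a = (expR a - 1 - a) * cos b + (1 + a) * (cos b - 1) by ring.
  apply: le_trans (ler_normD _ _) _; rewrite !normrM.
  have -> : e / 4 * r = e / 12 * r * 1 + 2 * (e / 12 * r) by field.
  apply: lerD; apply: ler_pM => //; first exact: cos_max.
  by apply: le_trans (ler_normD _ _) _; rewrite normr1; lra.
have im : `|expR a * sin b - b| <= e / 2 * r.
  have -> : expR a * sin b - b = expR a * (sin b - b) + b * (expR a - 1) by ring.
  apply: le_trans (ler_normD _ _) _; rewrite !normrM.
  have -> : e / 2 * r = 3 * (e / 12 * r) + r * (e / 4) by field.
  apply: lerD; apply: ler_pM => //; apply: le_trans aE _; lra.
rewrite normCE; have -> : `|a +i* b : C| = r%:C by rewrite normCE.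
rewrite -[X in _ <= X](rmorphM (real_complex R)) leCR; apply: le_trans (cabs_le _) _.
set D := (X in `|cre X| + _).
have -> : cre D = expR a * cos b - 1 - a by rewrite /D /cre /= expR0 cos0; ring.
have -> : cim D = expR a * sin b - b by rewrite /D /cim /= expR0 sin0; ring.
have : 0 <= e * r by rewrite mulr_ge0 // ltW.
lra.
Qed.

Lemma is_derive_Cexp z : is_derive z 1 (@Cexp R) (Cexp z).
Proof.
apply/is_deriveP => e e0; have := is_derive_Cexp0 => /is_deriveP h.
have c0 : 0 < e / `|Cexp z| by rewrite divr_gt0 // normr_gt0 Cexp_neq0.
have := h _ c0; apply: filterS => w hw.
have -> : Cexp (w + z) - Cexp z - Cexp z * w = Cexp z * (Cexp (w + 0) - Cexp 0 - 1 * w).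
  by rewrite CexpD addr0 Cexp0; ring.
rewrite normrM; have -> : e * `|w| = `|Cexp z| * (e / `|Cexp z| * `|w|).
  by rewrite mulrA [`|_| * _]mulrC divfK // normr_eq0 Cexp_neq0.
by rewrite ler_pM2l // normr_gt0 Cexp_neq0.
Qed.

(** The sine of acos (a / r) is |b| / r, and the sign chosen in [Carg] restores that
    of b. *)
Lemma Cexp_ln z : cim z != 0 -> Cexp (Cln z) = z.
Proof.
case: z => a b; rewrite /cim /= => b0; rewrite /Carg.
set r := Num.sqrt _; set t := acos _.
have s0 : 0 < a ^+ 2 + b ^+ 2.
  by rewrite ltr_wpDl ?sqr_ge0 // lt_neqAle eq_sym sqrf_eq0 b0 sqr_ge0.
have r0 : 0 < r by rewrite sqrtr_gt0.
have r2 : r ^+ 2 = a ^+ 2 + b ^+ 2 by rewrite sqr_sqrtr // ltW.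
have ar : -1 <= a / r <= 1.
  rewrite -ler_norml normrM normfV (gtr0_norm r0) ler_pdivrMr // mul1r.
  by rewrite -(ler_pXn2r (n := 2)) ?nnegrE ?(ltW r0) // real_normK ?num_real // r2 lerDl sqr_ge0.
have ct : cos t = a / r by rewrite /t acosK // in_itv.
have st : sin t = `|b| / r.
  rewrite /t sin_acos //; have -> : 1 - (a / r) ^+ 2 = (b / r) ^+ 2.
    have -> : b ^+ 2 = r ^+ 2 - a ^+ 2 -> 1 - (a / r) ^+ 2 = (b / r) ^+ 2.
      by move=> h; rewrite !expr_div_n h; field; rewrite gt_eqF.
    by [].
    by rewrite r2 addrAC subrr add0r.
  by rewrite sqrtr_sqr normrM normfV (gtr0_norm r0).
have er : expR (ln r) = r by apply: lnK; rewrite posrE.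
apply: complexP; rewrite /= er; case: ifP => hb; rewrite ?cosN ?sinN ?ct ?st.
- by rewrite mulrC divfK // gt_eqF.
- by rewrite mulrC divfK // gt_eqF.
- by rewrite mulrC divfK ?gt_eqF // ger0_norm.
- by rewrite mulrC mulNr divfK ?gt_eqF // ltr0_norm ?opprK // ltNge hb.
Qed.

Lemma cim_near z : cim z != 0 ->
  \forall w \near z, cim w != 0 /\ (0 <= cim w) = (0 <= cim z).
Proof.
move=> h; have /contRP /(_ `|cim z|) := @cim_continuous z; rewrite normr_gt0 => /(_ h).
apply: filterS => w; move: (cim w) (cim z) h => p q q0.
case: (ltrgt0P q) q0 => // q0 _; rewrite ltr_norml => /andP[h1 h2].
  by have p0 : 0 < p by [lra]; rewrite gt_eqF // !ltW.
have p0 : p < 0 by lra.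
by rewrite lt_eqF // leNgt p0.
Qed.

Lemma cabs_continuous : continuous cabs.
Proof.
move=> z; apply/contRP => e e0; apply/nearC; exists e => // w hw.
apply: le_lt_trans hw; rewrite -leCR -normCE -[w - z]opprB normrN.
have -> : `|cabs z - cabs w|%:C = `| `|z| - `|w| | :> C.
  rewrite [`|z|]normCE [`|w|]normCE -rmorphB normCE; congr _%:C.
  by rewrite [RHS]cabsE /cim /= expr0n addr0 sqrtr_sqr.
exact: ler_dist_dist.
Qed.

Lemma cont_near_eq (f g : C -> R) z : (\forall w \near z, f w = g w) ->
  {for z, continuous g} -> {for z, continuous f}.
Proof.
move=> fg /contRP cg; apply/contRP => e /cg h; rewrite (nbhs_singleton fg).
by apply: filterS2 fg h => w ->.
Qed.

Lemma cim_neq0_cabs z : cim z != 0 -> 0 < cabs z.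
Proof. by move=> h; apply: lt_le_trans (cabs_im z); rewrite normr_gt0. Qed.

(** Off the real axis the sign in [Carg] is locally constant. *)
Lemma Cln_continuous z : cim z != 0 -> {for z, continuous (@Cln R)}.
Proof.
move=> h; have r0 := cim_neq0_cabs h; apply: complex_cvg.
  have -> : cre \o (@Cln R) = (@ln R) \o cabs.
    by apply/funext => -[a b] /=; rewrite /cabs normc_def.
  by apply: (@continuous_comp _ _ _ cabs (@ln R)); [exact: cabs_continuous | exact: continuous_ln].
pose q w := cre w / cabs w.
have cq : {for z, continuous q}.
  have cn0 : cabs z != 0 by rewrite gt_eqF.
  exact: (cvgM (@cre_continuous z) (cvgV cn0 (@cabs_continuous z))).
have q1 : -1 < q z < 1.
  rewrite -ltr_norml normrM normfV (gtr0_norm r0) ltr_pdivrMr // mul1r.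
  rewrite -(ltr_pXn2r (n := 2)) ?nnegrE ?(ltW r0) // real_normK ?num_real //.
  rewrite cabsE sqr_sqrtr ?addr_ge0 ?sqr_ge0 // ltrDl.
  by rewrite lt_neqAle eq_sym sqrf_eq0 h sqr_ge0.
have cacos : {for z, continuous (@acos R \o q)}.
  by apply: (@continuous_comp _ _ _ q (@acos R)) => //; exact: continuous_acos.
have eC w : cim (Cln w) = if 0 <= cim w then acos (q w) else - acos (q w).
  by case: w => a b; rewrite /q /cabs normc_def.
have [hz|hz] := boolP (0 <= cim z).
  apply: (@cont_near_eq _ (@acos R \o q)) => //.
  by apply: filterS (cim_near h) => w [_ e]; rewrite /= eC e hz.
apply: (@cont_near_eq _ (fun w => - acos (q w))); last exact: (cvgN cacos).
by apply: filterS (cim_near h) => w [_ e]; rewrite /= eC e (negPf hz).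
Qed.

(** Cln is a continuous local inverse of Cexp. *)
Lemma is_derive_Cln z : cim z != 0 -> is_derive z 1 (@Cln R) z^-1.
Proof.
move=> h; apply: (@is_derive_inverse _ _ (@Cexp R)).
- by apply: contraNneq h => ->.
- exact: Cln_continuous.
- by apply: filterS (cim_near h) => w [hw _]; apply: Cexp_ln.
- by rewrite -{2}(Cexp_ln h); apply: is_derive_Cexp.
Qed.

(** For a small real t, both d t and d i t are real up to o(t), so both parts of d
    vanish. *)
Lemma derive_of_real (f : C -> C) z d : is_derive z 1 f d ->
  (\forall w \near z, cim (f w) = 0) -> d = 0.
Proof.
move=> /is_deriveP hf /nearC [t0 t00 hr].
have small e : 0 < e -> `|cim d| <= e /\ `|cre d| <= e.
  move=> e0; have ec : (0 : C) < e%:C by rewrite -[0]/(0%:C : C) ltCR.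
  have /nearC [t1 t10 h1] := hf _ ec.
  pose t := Num.min t0 t1 / 2; have m0 : 0 < Num.min t0 t1 by rewrite lt_min t00.
  have t_gt0 : 0 < t by rewrite divr_gt0.
  have /andP[tt0 tt1] : (t < t0) && (t < t1) by rewrite -lt_min ltr_pdivrMr // ltr_pMr // ltr1n.
  have fz : cim (f z) = 0 by apply: hr; rewrite subrr cabsE /= expr0n addr0 sqrtr0.
  have key (h : C) : cabs h = t -> `|cim (d * h)| <= e * t.
    move=> ht; have := h1 h; rewrite subr0 ht => /(_ tt1).
    rewrite normCE [`|h|]normCE ht -[X in _ <= X](rmorphM (real_complex R)) leCR.
    apply: le_trans; apply: le_trans (cabs_im _).
    have -> : cim (f (h + z) - f z - d * h) = cim (f (h + z)) - cim (f z) - cim (d * h).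
      by case: (f (h + z)); case: (f z); case: (d * h).
    by rewrite fz hr ?subr0 ?sub0r ?normrN // addrK ht.
  have tn : `|t| = t by rewrite gtr0_norm.
  split.
    have := key (t +i* 0); rewrite cabsE /cre /cim /= expr0n addr0 sqrtr_sqr tn => /(_ erefl).
    by case: d {hf h1 key} => p q /=; rewrite mulr0 add0r normrM tn ler_pM2r.
  have := key (0 +i* t); rewrite cabsE /cre /cim /= expr0n add0r sqrtr_sqr tn => /(_ erefl).
  by case: d {hf h1 key} => p q /=; rewrite mulr0 addr0 normrM tn ler_pM2r.
have z0 (x : R) : (forall e, 0 < e -> `|x| <= e) -> x = 0.
  move=> hx; apply/eqP; rewrite -normr_le0; apply/ler_addgt0Pr => e /hx.
  by rewrite add0r.
by apply: complexP; apply: z0 => e /small [].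
Qed.

End ComplexTopology.

Local Close Scope complex_scope.

(** * Algebraic independence of x and ln x *)

Section Generic.
Variable R : realType.
Local Notation C := (CC R).
Implicit Types (P Q : C -> Prop) (x y z : C).

(** P holds on a dense open set.  Generic properties are stable under conjunction,
    which lets the exceptional points of branches and denominators be ignored. *)
Definition generic P := forall U : set C, open U -> U !=set0 ->
  exists2 x, U x & \forall y \near x, P y.

Definition somewhere P := exists x, \forall y \near x, P y.

Lemma generic_sub P Q : (forall x, P x -> Q x) -> generic P -> generic Q.
Proof.
by move=> PQ gP U oU U0; have [x Ux h] := gP U oU U0; exists x => //; apply: filterS h.
Qed.

Lemma generic_somewhere P Q : generic P -> somewhere Q -> somewhere (fun x => P x /\ Q x).
Proof.
move=> gP [x hx]; have [||y Uy hy] := gP (interior Q); first exact: open_interior.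
  by exists x.
by exists y; apply: filterS2 hy Uy.
Qed.

Lemma open_near (U : set C) x : open U -> U x -> \forall y \near x, U y.
Proof. by move=> oU Ux; apply: open_nbhs_nbhs. Qed.

Lemma genericI P Q : generic P -> generic Q -> generic (fun x => P x /\ Q x).
Proof.
move=> gP gQ U oU U0; have [x Ux hx] := gP U oU U0.
have [||y [Vy Uy] hy] := gQ (interior P `&` U).
- by apply: openI => //; exact: open_interior.
- by exists x; split.
- by exists y => //; apply: filterS2 Vy hy.
Qed.

Lemma generic_near P : generic P -> generic (fun x => \forall y \near x, P y).
Proof.
move=> gP U oU U0; have [x Ux hx] := gP U oU U0; exists x => //.
exact: (nbhs_interior hx).
Qed.

Lemma genericT P : (forall x, P x) -> generic P.
Proof. by move=> h U _ [x Ux]; exists x => //; apply: filterE. Qed.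

Lemma somewhere_sub P Q : (forall x, P x -> Q x) -> somewhere P -> somewhere Q.
Proof. by move=> PQ [x hx]; exists x; apply: filterS hx. Qed.

Lemma somewhere_near P : somewhere P -> somewhere (fun x => \forall y \near x, P y).
Proof. by move=> [x hx]; exists x; exact: (nbhs_interior hx). Qed.

Lemma generic_witness P : generic P -> exists2 U : set C, open U /\ U !=set0 &
  forall x, U x -> P x.
Proof.
move=> gP; have [||x _ hx] := gP setT; [exact: openT | by exists 0 |].
exists (interior P); first by split; [exact: open_interior | exists x].
by move=> y /interior_subset.
Qed.

Lemma open_somewhere (U : set C) P : open U -> U !=set0 -> (forall x, U x -> P x) -> somewhere P.
Proof. by move=> oU [x Ux] h; exists x; apply: filterS (open_near oU Ux). Qed.

Lemma generic_im : generic (fun x => cim x != 0).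
Proof.
move=> U oU [x Ux]; apply: contrapT => h.
have real y : U y -> cim y = 0.
  move=> Uy; apply: contrapT => /eqP hy; apply: h; exists y => //.
  by apply: filterS (cim_near hy) => w [].
have : (1 : C) = 0.
  apply: (@derive_of_real R id x) => //.
  by apply: filterS (open_near oU Ux).
by move/eqP; rewrite oner_eq0.
Qed.

(** If f were real near a point, its derivative would vanish there.  This is what
    makes the values of f avoid the branch cuts of Cln, Ei and Li on a dense open set.
    *)
Lemma generic_nonreal (f df : C -> C) :
  generic (fun x => is_derive x 1 f (df x) /\ df x != 0) ->
  generic (fun x => cim (f x) != 0).
Proof.
move=> gf U oU U0; have [x Ux hx] := gf U oU U0.
apply: contrapT => h; have [_ /negP] := nbhs_singleton hx; apply; apply/eqP.
have hxd := (nbhs_singleton hx).1.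
apply: (derive_of_real hxd); apply: filterS2 (nbhs_interior hx) (open_near oU Ux) => y hy Uy.
apply: contrapT => /eqP hi; apply: h; exists y => //.
have cf : {for y, continuous f} := is_derive_continuous (nbhs_singleton hy).1.
have h2 : \forall w \near y, cim (f w) != 0 /\ (0 <= cim (f w)) = (0 <= cim (f y)).
  exact: (cf _ (cim_near hi)).
by apply: filterS h2 => w [].
Qed.

Lemma near_neq0 (f : C -> C) x : {for x, continuous f} -> f x != 0 ->
  \forall y \near x, f y != 0.
Proof.
move=> /contCP h fx; have /h : 0 < `|f x| by rewrite normr_gt0.
apply: filterS => y; apply: contraTneq => ->; by rewrite subr0 ltxx.
Qed.

End Generic.

Section Evaluation.
Variable R : realType.
Local Notation C := (CC R).
Local Notation P2 := {poly {poly C}}.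
Implicit Types (p q : P2) (x y z : C).

Definition evq q x : C := eval2 q x (Cln x).

Lemma evqD p q x : evq (p + q) x = evq p x + evq q x.
Proof. by rewrite /evq /eval2 !hornerD. Qed.
Lemma evqB p q x : evq (p - q) x = evq p x - evq q x.
Proof. by rewrite /evq /eval2 !hornerD !hornerN. Qed.
Lemma evqM p q x : evq (p * q) x = evq p x * evq q x.
Proof. by rewrite /evq /eval2 !hornerM. Qed.
Lemma evqC c x : evq c%:P%:P x = c. Proof. by rewrite /evq /eval2 !hornerC. Qed.
Lemma evq_X1 x : evq (X1 C) x = x.
Proof. by rewrite /evq /eval2 /X1 hornerC hornerX. Qed.
Lemma evq_Y x : evq 'X x = Cln x.
Proof. by rewrite /evq /eval2 hornerX hornerC. Qed.
Lemma evqX q n x : evq (q ^+ n) x = evq q x ^+ n.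
Proof.
by elim: n => [|n IHn]; [rewrite !expr0 -(evqC 1 x) | rewrite !exprS evqM IHn].
Qed.

Lemma im_neq0 x : cim x != 0 -> x != 0.
Proof. by apply: contraNneq => ->. Qed.

Lemma is_derive_evq q x : cim x != 0 -> is_derive x 1 (evq q) (evq (del q) x / x).
Proof.
move=> hx; have x0 := im_neq0 hx.
pose D q := is_derive x 1 (evq q) (evq (del q) x / x).
have DD p r : D p -> D r -> D (p + r).
  move=> hp hr; rewrite /D delD evqD mulrDl.
  have -> : evq (p + r) = evq p + evq r by apply/funext => y; rewrite evqD.
  exact: is_deriveD.
have DM p r : D p -> D r -> D (p * r).
  move=> hp hr; rewrite /D delM evqD !evqM mulrDl.
  have -> : evq (p * r) = evq p * evq r by apply/funext => y; rewrite evqM.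
  apply: (is_derive_eq (is_deriveM hp hr)); rewrite /GRing.scale /=; ring.
have DC c : D c%:P%:P.
  rewrite /D del_const evqC mul0r.
  have -> : evq c%:P%:P = (fun=> c) by apply/funext => y; rewrite evqC.
  exact: is_derive_cst.
have DX : D (X1 C).
  rewrite /D del_X1 evq_X1 divff //.
  have -> : evq (X1 C) = id by apply/funext => y; rewrite evq_X1.
  exact: is_derive_id.
have DY : D 'X.
  rewrite /D del_Y (evqC 1) div1r.
  have -> : evq 'X = @Cln R by apply/funext => y; rewrite evq_Y.
  exact: is_derive_Cln.
have DP (p : {poly C}) : D p%:P.
  elim/poly_ind: p => [|p c IH]; first exact: DC 0.
  by rewrite polyCD polyCM; apply: (DD) => //; apply: DM.
rewrite -/(D q); elim/poly_ind: q => [|q p IH]; first exact: DP.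
by apply: (DD) => //; apply: DM.
Qed.

(** Functions that agree on an open set have equal derivatives there. *)
Lemma somewhere_derive (f g df dg : C -> C) :
  somewhere (fun x => f x = g x) -> generic (fun x => is_derive x 1 f (df x)) ->
  generic (fun x => is_derive x 1 g (dg x)) -> somewhere (fun x => df x = dg x).
Proof.
move=> fg hf hg; apply: somewhere_sub (generic_somewhere (genericI hf hg) (somewhere_near fg)).
move=> x [[h1 h2] h3]; apply: (is_derive_unique _ h2).
exact: near_eq_is_derive h3 h1.
Qed.

Lemma generic_derive_evq q : generic (fun x => is_derive x 1 (evq q) (evq (del q) x / x)).
Proof. by apply: generic_sub (@generic_im R) => x; apply: is_derive_evq. Qed.

(** x and ln x are algebraically independent.  Let d be the degree of the leading
    coefficient of q, as a polynomial in x: then [del] q - d q is a smaller relation,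
    hence zero by induction, and q is an eigenvector of [del], that is c x^k, which
    does not vanish off the real axis. *)
Theorem evq_somewhere0 q : somewhere (fun x => evq q x = 0) -> q = 0.
Proof.
have [n] := ubnP (size q); elim: n q => // n IHn q; rewrite ltnS.
have [m] := ubnP (size (q`_n.-1)%R); elim: m q => // m IHm q; rewrite ltnS => hm hn hq.
have [//|q0] := eqVneq q 0.
have sp : (0 < size q)%N by rewrite size_poly_gt0.
have n0 : (0 < n)%N by apply: leq_trans hn.
have [sq|sq] := ltnP (size q) n; first exact: IHn.
have sqn : size q = n by apply/eqP; rewrite eqn_leq hn.
have ln0 : q`_n.-1 != 0 by rewrite -sqn -/(lead_coef q) lead_coef_eq0.
pose d := (size (q`_n.-1)%R).-1.
pose q1 := del q - d%:R%:P%:P * q.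
have hq1 : somewhere (fun x => evq q1 x = 0).
  apply: somewhere_sub (generic_somewhere (genericI (@generic_im R) (generic_derive_evq q))
    (somewhere_near hq)) => x [[hx h1] h2].
  have h3 : is_derive x 1 (evq q) 0.
    have h0 : is_derive x 1 (fun _ : C => 0 : C) 0 by exact: is_derive_cst.
    by apply: near_eq_is_derive h0; apply: filterS h2 => y ->.
  have := is_derive_unique h1 h3 => /eqP; rewrite mulf_eq0 invr_eq0 (negPf (im_neq0 hx)) orbF.
  by move=> /eqP h4; rewrite /q1 evqB evqM h4 (nbhs_singleton h2) mulr0 subr0.
have s1 : (size q1 <= n)%N.
  apply: leq_trans (size_polyD _ _) _; rewrite size_polyN geq_max.
  rewrite (leq_trans (size_del q)) //= mul_polyC.
  by apply: leq_trans (size_scale_leq _ _) _.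
have c1 : (size (q1`_n.-1)%R <= d)%N.
  apply/leq_sizeP => j hj; rewrite coefB coef_del mul_polyC coefZ prednK //.
  rewrite (nth_default _ hn) mul0rn addr0 mul_polyC coefB coefXM coefZ.
  move: hj; rewrite leq_eqVlt => /orP[/eqP <-|hj].
    case: (d) => [|k] /=; first by rewrite mul0r subrr.
    by rewrite coef_deriv mulr_natl subrr.
  have cj : (q`_n.-1)`_j = 0 by apply: nth_default; move: hj; rewrite /d; case: (size _).
  by rewrite cj mulr0 subr0; case: j hj cj => //= j hj cj; rewrite coef_deriv cj mul0rn.
have e1 : q1 = 0.
  apply: IHm => //; apply: leq_trans hm.
  by apply: leq_ltn_trans c1 _; rewrite /d prednK // size_poly_gt0.
have [a [k [a0 _ ea]]] := del_eigen (subr0_eq e1) q0.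
have [x hx] := generic_somewhere (@generic_im R) hq.
have [ix] := nbhs_singleton hx; rewrite ea evqM evqC evqX evq_X1 => /eqP.
by rewrite mulf_eq0 (negPf a0) expf_eq0 (negPf (im_neq0 ix)) andbF.
Qed.

Lemma generic_evq q : q != 0 -> generic (fun x => evq q x != 0).
Proof.
move=> q0 U oU U0; apply: contrapT => h; move/eqP: q0; apply.
apply: evq_somewhere0; have [x Ux hx] := generic_derive_evq q oU U0.
exists x; apply: filterS2 hx (open_near oU Ux) => y hy Uy.
apply: contrapT => /eqP hn; apply: h; exists y => //.
exact: near_neq0 (is_derive_continuous hy) hn.
Qed.

Variable L : fractions P2.
Local Notation "p %:F" := (embed L p).
Implicit Types a b : L.

(** The value of a fraction at y = ln x, through its chosen representative. *)
Definition ev a x : C := evq (numer a) x / evq (denom a) x.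

Lemma ev_frac n d : d != 0 -> generic (fun x => ev (n%:F / d%:F) x = evq n x / evq d x).
Proof.
move=> d0; set a := n%:F / d%:F; have [d'0 ea] := reprE a.
apply: generic_sub (genericI (generic_evq d0) (generic_evq d'0)) => x [h1 h2].
have e : n * denom a = numer a * d.
  apply: (@emb_inj _ L); rewrite !embM; apply/eqP; rewrite -eqr_div ?emb_eq0 //.
  by apply/eqP.
by apply/eqP; rewrite /ev eqr_div // -!evqM e.
Qed.

Lemma ev_emb p : generic (fun x => ev p%:F x = evq p x).
Proof.
apply: generic_sub (ev_frac p (oner_neq0 _)) => x.
by rewrite emb1 divr1 => ->; rewrite (evqC 1) divr1.
Qed.

Lemma ev_cst c : generic (fun x => ev (cstF L c) x = c).
Proof. by apply: generic_sub (ev_emb c%:P%:P) => x ->; rewrite evqC. Qed.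

Lemma evD a b : generic (fun x => ev (a + b) x = ev a x + ev b x).
Proof.
have [n [d [d0 ->]]] := fracE a; have [m [e [e0 ->]]] := fracE b.
have -> : n%:F / d%:F + m%:F / e%:F = (n * e + m * d)%:F / (d * e)%:F.
  by rewrite embD !embM addf_div ?emb_eq0.
apply: generic_sub (genericI (genericI (ev_frac n d0) (ev_frac m e0))
  (genericI (ev_frac (n * e + m * d) (mulf_neq0 d0 e0)) (genericI (generic_evq d0) (generic_evq e0)))).
by move=> x [[-> ->] [-> [h1 h2]]]; rewrite evqD !evqM addf_div.
Qed.

Lemma evM a b : generic (fun x => ev (a * b) x = ev a x * ev b x).
Proof.
have [n [d [d0 ->]]] := fracE a; have [m [e [e0 ->]]] := fracE b.
have -> : n%:F / d%:F * (m%:F / e%:F) = (n * m)%:F / (d * e)%:F.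
  by rewrite !embM mulf_div.
apply: generic_sub (genericI (genericI (ev_frac n d0) (ev_frac m e0))
  (ev_frac (n * m) (mulf_neq0 d0 e0))).
by move=> x [[-> ->] ->]; rewrite !evqM mulf_div.
Qed.

Lemma ev_somewhere0 a : somewhere (fun x => ev a x = 0) -> a = 0.
Proof.
have [d0 ea] := reprE a; move=> h.
suff -> : numer a = 0 -> a = 0.
  by [].
  apply: evq_somewhere0; apply: somewhere_sub (generic_somewhere (generic_evq d0) h) => x [h1].
  by rewrite /ev => /eqP; rewrite mulf_eq0 invr_eq0 (negPf h1) orbF => /eqP.
by rewrite {2}ea => ->; rewrite emb0 mul0r.
Qed.

Lemma generic_ev a : a != 0 -> generic (fun x => ev a x != 0).
Proof.
have [d0 ea] := reprE a => a0.
have n0 : numer a != 0 by apply: contraNneq a0 => z; rewrite ea z emb0 mul0r.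
apply: generic_sub (genericI (generic_evq d0) (generic_evq n0)) => x [h1 h2].
by rewrite mulf_neq0 ?invr_eq0.
Qed.

(** [dL] is x d/dx. *)
Lemma ev_derive a : generic (fun x => is_derive x 1 (ev a) (ev (dL a) x / x)).
Proof.
have [d0 ea] := reprE a; set n := numer a in ea *; set d := denom a in d0 ea *.
have dd0 : d ^+ 2 != 0 by rewrite expf_neq0.
have gd := ev_frac (del n * d - n * del d) dd0.
apply: generic_sub (genericI gd (genericI (generic_evq d0) (@generic_im R))) => x [e [hd hx]].
have -> : dL a = (del n * d - n * del d)%:F / (d ^+ 2)%:F by [].
rewrite e; have hn := is_derive_evq n hx; have [dv ev'] := is_derive_evq d hx.
have hV : is_derive x 1 (fun y => (evq d y)^-1) (- (evq d x) ^- 2 *: (evq (del d) x / x)).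
  by split; [apply: derivableV | rewrite deriveV // ev'].
have -> : ev a = evq n * (fun y => (evq d y)^-1) by [].
apply: (is_derive_eq (is_deriveM hn hV)).
rewrite /GRing.scale /= evqB !evqM; field.
by rewrite hd (im_neq0 hx).
Qed.

End Evaluation.

(** * Generic derivatives of sums and composites *)

Section GenericSums.
Variable R : realType.
Local Notation C := (CC R).
Local Notation P2 := {poly {poly C}}.
Variable L : fractions P2.
Local Notation "p %:F" := (embed L p).
Local Notation X := ((X1 C)%:F).
Local Notation Y := (('X : P2)%:F).

Lemma ev_sum (T : eqType) (s : seq T) (a : T -> L) :
  generic (fun x => ev (\sum_(t <- s) a t) x = \sum_(t <- s) ev (a t) x).
Proof.
elim: s => [|t s IHs].
  by apply: generic_sub (ev_cst L 0) => x; rewrite !big_nil cst0.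
apply: generic_sub (genericI IHs (evD (a t) (\sum_(t <- s) a t))) => x [h1 h2].
by rewrite !big_cons h2 h1.
Qed.

Lemma evZ c a : generic (fun x => ev (cstF L c * a) x = c * ev a x).
Proof.
by apply: generic_sub (genericI (ev_cst L c) (evM (cstF L c) a)) => x [h1 ->]; rewrite h1.
Qed.

Lemma derive_sum_list (T : eqType) (s : seq T) (f df : T -> C -> C) :
  (forall t, t \in s -> generic (fun x => is_derive x 1 (f t) (df t x))) ->
  generic (fun x => is_derive x 1 (fun y => \sum_(t <- s) f t y) (\sum_(t <- s) df t x)).
Proof.
elim: s => [|t s IHs] h.
  apply: genericT => x; rewrite big_nil.
  have -> : (fun y => \sum_(t <- [::]) f t y) = (fun _ : C => 0 : C).
    by apply/funext => y; rewrite big_nil.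
  exact: is_derive_cst.
have {}IHs := IHs (fun t' ht' => h t' (mem_behead (s := t :: s) ht')).
apply: generic_sub (genericI (h t (mem_head _ _)) IHs) => x [h1 h2].
rewrite big_cons; have -> : (fun y => \sum_(u <- t :: s) f u y) = f t + (fun y => \sum_(u <- s) f u y).
  by apply/funext => y; rewrite big_cons.
exact: is_deriveD.
Qed.

Lemma derive_scale (c : C) (f df : C -> C) : generic (fun x => is_derive x 1 f (df x)) ->
  generic (fun x => is_derive x 1 (fun y => c * f y) (c * df x)).
Proof.
apply: generic_sub => x h.
have -> : (fun y => c * f y) = c *: f by [].
have := is_deriveZ c h; exact.
Qed.

Lemma generic_derive_eq (f df dg : C -> C) : generic (fun x => is_derive x 1 f (df x)) ->
  generic (fun x => df x = dg x) -> generic (fun x => is_derive x 1 f (dg x)).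
Proof. by move=> h1 h2; apply: generic_sub (genericI h1 h2) => x [h <-]. Qed.

Lemma generic_derive_congr (f g df : C -> C) : generic (fun x => is_derive x 1 f (df x)) ->
  generic (fun x => f x = g x) -> generic (fun x => is_derive x 1 g (df x)).
Proof.
move=> h1 /generic_near h2; apply: generic_sub (genericI h1 h2) => x [h e].
exact: near_eq_is_derive e h.
Qed.

Lemma generic_chain (f g df dg : C -> C) :
  generic (fun x => is_derive x 1 f (df x) /\ is_derive (f x) 1 g (dg (f x))) ->
  generic (fun x => is_derive x 1 (fun y => g (f y)) (dg (f x) * df x)).
Proof. by apply: generic_sub => x [h1 h2]; apply: (is_derive_comp h1 h2). Qed.

Lemma generic_neq0 : generic (fun x : C => x != 0).
Proof. by apply: generic_sub (@generic_im R) => x; apply: im_neq0. Qed.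

Lemma generic_derive_ln : generic (fun x : C => is_derive x 1 (@Cln R) x^-1).
Proof. by apply: generic_sub (@generic_im R) => x; apply: is_derive_Cln. Qed.

Lemma derive_mul (la : C) : generic (fun x : C => is_derive x 1 (fun y => la * y) la).
Proof.
have h : generic (fun x : C => is_derive x 1 (fun y : C => y) 1).
  by apply: genericT => x; exact: is_derive_id.
by have := derive_scale la h; apply: generic_sub => x; rewrite mulr1.
Qed.

Lemma mul_nonreal (la : C) : la != 0 -> generic (fun x : C => cim (la * x) != 0).
Proof.
move=> la0; apply: (@generic_nonreal R (fun y => la * y) (fun=> la)).
by apply: generic_sub (derive_mul la).
Qed.

Lemma derive_affine_ln (p la : C) :
  generic (fun x : C => is_derive x 1 (fun y => p * Cln y + la) (p / x)).
Proof.
apply: generic_sub (derive_scale p generic_derive_ln) => x h.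
have h0 : is_derive x 1 (fun _ : C => la) 0 by exact: is_derive_cst.
have -> : (fun y => p * Cln y + la) = (fun y => p * Cln y) + (fun=> la) by [].
by apply: (is_derive_eq (is_deriveD h h0)); rewrite addr0.
Qed.

Lemma affine_ln_nonreal (p la : C) : p != 0 ->
  generic (fun x : C => cim (p * Cln x + la) != 0).
Proof.
move=> p0; apply: (@generic_nonreal R _ (fun x => p / x)).
apply: generic_sub (genericI (derive_affine_ln p la) generic_neq0) => x [h1 h2]; split=> //.
by rewrite mulf_neq0 ?invr_eq0.
Qed.

Lemma nonreal_nle0 (z : C) : cim z != 0 -> ~~ (z <= 0).
Proof. by apply: contraNN; rewrite lecE eq_sym => /andP[]. Qed.
Lemma nonreal_nge1 (z : C) : cim z != 0 -> ~~ (1 <= z).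
Proof. by apply: contraNN; rewrite lecE => /andP[]. Qed.

Lemma Cexp_int (p : int) (x : C) : cim x != 0 -> Cexp (p%:~R * Cln x) = x ^ p.
Proof.
move=> hx; case: p => n.
  by rewrite -pmulrn mulr_natl CexpMn Cexp_ln.
by rewrite NegzE mulrNz mulNr CexpN -pmulrn mulr_natl CexpMn Cexp_ln.
Qed.

Lemma evq_yadd mu (x : C) : evq (yadd mu) x = Cln x + mu.
Proof. by rewrite /yadd evqD evq_Y evqC. Qed.

Lemma evq_lin al (x : C) : evq (lin al)%:P x = x - al.
Proof. by rewrite /lin polyCB evqB (evq_X1 x) evqC. Qed.

Lemma ev_TEi p mu : generic (fun x : C => ev (tval L (TEi p mu)) x = x ^ p / (Cln x + mu)).
Proof.
case: p => n /=.
  rewrite -exprnP -embX; have nz : yadd mu != 0 :> P2 by rewrite -size_poly_eq0 size_yadd.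
  by apply: generic_sub (ev_frac L (X1 C ^+ n) nz) => x ->; rewrite evqX evq_X1 evq_yadd.
rewrite NegzE -exprnN.
have -> : X ^- n.+1 / (yadd mu)%:F = 1%:F / (yadd mu * X1 C ^+ n.+1)%:F.
  by rewrite emb1 div1r embM embX invfM mulrC.
have nz : yadd mu * X1 C ^+ n.+1 != 0.
  rewrite mulf_neq0 ?expf_neq0 //; last by case: (X1_irreducible C).
  by rewrite -size_poly_eq0 size_yadd.
apply: generic_sub (ev_frac L 1 nz) => x ->; rewrite evqM evqX evq_X1 evq_yadd (evqC 1).
by rewrite div1r invfM mulrC -exprnN.
Qed.

Lemma ev_TLi n al :
  generic (fun x : C => ev (tval L (TLi n al)) x = Cln x ^+ n * x / (x - al)).
Proof.
rewrite /= -embX -embM; apply: generic_sub (ev_frac L ('X ^+ n * X1 C) (linP_neq0 al)) => x ->.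
by rewrite evqM evqX evq_X1 evq_Y evq_lin.
Qed.

End GenericSums.

(** * Independence of polylogarithms over C(x, ln x) *)

Section Polylogs.
Variables (R : realType) (Ei : CC R -> CC R) (Li : nat -> CC R -> CC R).
Hypotheses (HEi : is_Ei Ei) (HLi : is_polylog Li).
Local Notation C := (CC R).
Local Notation P2 := {poly {poly C}}.
Variable L : fractions P2.
Local Notation "p %:F" := (embed L p).
Local Notation key := (nat * nat * C)%type.
Implicit Types (l : seq (key * C)).

Definition sLi l (x : C) : C := \sum_(t <- l) t.2 * Cln x ^+ t.1.1.2 * Li t.1.1.1 (t.1.2 * x).

(** z times the derivative of Li_p. *)
Definition Lib (p : nat) (z : C) : C := if p is p'.+2 then Li p'.+1 z else z / (1 - z).

Lemma derive_Li p (z : C) : (0 < p)%N -> cim z != 0 -> is_derive z 1 (Li p) (Lib p z / z).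
Proof.
case: HLi => H1 H2 _; have z0 := @im_neq0 R z.
case: p => [|[|p]] // _ hz; have {}z0 := z0 hz.
  have hz1 : cim (1 - z) != 0.
    by move: hz; case: (z) => a b; rewrite /cim /= sub0r oppr_eq0.
  have h0 : is_derive z 1 (fun y : C => 1 - y) (-1).
    have h1 : is_derive z 1 (fun _ : C => 1 : C) 0 by exact: is_derive_cst.
    have h2 : is_derive z 1 (fun y : C => y) 1 by exact: is_derive_id.
    by have := is_deriveB h1 h2; rewrite sub0r.
  have h2 := is_deriveN (is_derive_comp h0 (is_derive_Cln hz1)).
  have hn : \forall y \near z, - (@Cln R \o (fun y => 1 - y)) y = Li 1%N y.
    by apply: filterS (cim_near hz) => y [hy _]; rewrite H1 // nonreal_nge1.
  have z1 := im_neq0 hz1.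
  apply: (near_eq_is_derive hn); apply: (is_derive_eq h2).
  by rewrite /=; field; rewrite z0 z1.
have [h1 h2] := H2 p.+1 z isT (nonreal_nge1 hz).
by split=> //; rewrite /= -h2 mulrC mulKf.
Qed.

Lemma derive_Li_scaled p (la : C) : (0 < p)%N -> la != 0 ->
  generic (fun x => is_derive x 1 (fun y => Li p (la * y)) (Lib p (la * x) / x)).
Proof.
move=> p0 la0.
apply: generic_sub (genericI (derive_mul la) (genericI (mul_nonreal la0) (@generic_neq0 R))).
move=> x [h1 [h2 x0]]; apply: (is_derive_eq (is_derive_comp h1 (derive_Li p0 h2))).
by field; rewrite la0 x0.
Qed.

Lemma sLi_cons t l x : sLi (t :: l) x =
  t.2 * Cln x ^+ t.1.1.2 * Li t.1.1.1 (t.1.2 * x) + sLi l x.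
Proof. by rewrite /sLi big_cons. Qed.

Lemma sLi_cat l1 l2 x : sLi (l1 ++ l2) x = sLi l1 x + sLi l2 x.
Proof. by rewrite /sLi big_cat. Qed.

Lemma sLi_coef0 l : (forall k, coef l k = 0) -> forall x, sLi l x = 0.
Proof.
move=> h x; rewrite /sLi -[RHS](coef_sum0 (fun k => Cln x ^+ k.1.2 * Li k.1.1 (k.2 * x)) h).
by apply: eq_bigr => t _; rewrite mulrA.
Qed.

Lemma derive_Cln_power r : generic (fun x : C => is_derive x 1 (fun y => Cln y ^+ r)
  (r%:R * Cln x ^+ r.-1 / x)).
Proof.
apply: generic_sub (@generic_derive_ln R) => x h.
have -> : (fun y : C => Cln y ^+ r) = (@Cln R) ^+ r.
  apply/funext => y; elim: r => [|r IHr]; first by rewrite !expr0.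
  by rewrite !exprS IHr.
by apply: (is_derive_eq (is_deriveX r h)); rewrite /GRing.scale /=; ring.
Qed.

Lemma li_term_derive (t : key * C) : (0 < t.1.1.1)%N -> t.1.2 != 0 ->
  generic (fun x => is_derive x 1
    (fun y => t.2 * Cln y ^+ t.1.1.2 * Li t.1.1.1 (t.1.2 * y))
    ((sLi (step1 t) x + ev (tsum L (li_rat [:: t])) x) / x)).
Proof.
case: t => [[[p r] la] b] /= p0 la0.
have g1 := derive_scale b (derive_Cln_power r).
have g2 := derive_Li_scaled p0 la0.
have g3 : generic (fun x => ev (tsum L (li_rat [:: ((p, r, la), b)])) x =
    if p == 1%N then b * Cln x ^+ r * (la * x / (1 - la * x)) else 0).
  rewrite /li_rat /tsum /=; case: eqP => _ /=; last first.
    by apply: generic_sub (ev_cst L 0) => x; rewrite big_nil cst0.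
  rewrite big_seq1 /=; have nr := mul_nonreal la0.
  apply: generic_sub (genericI nr (genericI (evZ (- b) (tval L (TLi r la^-1))) (ev_TLi L r la^-1))).
  move=> x [hn [-> ->]]; have h1 : 1 - la * x != 0.
    by apply: contraNneq hn => /subr0_eq <-.
  have h2 : x - la^-1 = - (1 - la * x) / la by field.
  by rewrite h2; field; rewrite h1 la0.
apply: generic_sub (genericI (genericI g1 g2) (genericI g3 (@generic_neq0 R))).
move=> x [[h1 h2] [-> x0]].
have -> : (fun y => b * Cln y ^+ r * Li p (la * y)) =
    (fun y => b * Cln y ^+ r) * (fun y => Li p (la * y)) by [].
apply: (is_derive_eq (is_deriveM h1 h2)); rewrite /GRing.scale /= /step1 sLi_cat /=.
case: r {g1 g3 h1} => [|r] /=; case: p p0 g2 h2 => [|[|p]] //= _ _ _;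
  rewrite /sLi ?big_seq1 ?big_nil /=; ring.
Qed.

Lemma sLi_derive l : li_ok l -> generic (fun x => is_derive x 1 (sLi l)
  ((sLi (step l) x + ev (tsum L (li_rat l)) x) / x)).
Proof.
elim: l => [|t l IHl] ok.
  apply: generic_sub (ev_cst L 0) => x; rewrite cst0 => h.
  rewrite /li_rat /tsum /sLi /= !big_nil h addr0 mul0r.
  have -> : (fun y : C => \sum_(t <- [::]) t.2 * Cln y ^+ t.1.1.2 * Li t.1.1.1 (t.1.2 * y)) =
    (fun _ : C => 0 : C) by apply/funext => y; rewrite big_nil.
  exact: is_derive_cst.
have okl : li_ok l by move=> u hu; apply: ok; rewrite inE hu orbT.
have [p0 la0] := ok t (mem_head _ _).
have gsum : generic (fun x => ev (tsum L (li_rat (t :: l))) x =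
    ev (tsum L (li_rat [:: t])) x + ev (tsum L (li_rat l)) x).
  have -> : tsum L (li_rat (t :: l)) = tsum L (li_rat [:: t]) + tsum L (li_rat l).
    by rewrite /li_rat -cat1s filter_cat map_cat /tsum big_cat.
  exact: evD.
apply: generic_sub (genericI gsum (genericI (li_term_derive p0 la0) (IHl okl))) => x [-> [h1 h2]].
have -> : sLi (t :: l) = (fun y => t.2 * Cln y ^+ t.1.1.2 * Li t.1.1.1 (t.1.2 * y)) + sLi l.
  by apply/funext => y; rewrite sLi_cons.
apply: (is_derive_eq (is_deriveD h1 h2)).
have -> : step (t :: l) = step1 t ++ step l by [].
rewrite sLi_cat; ring.
Qed.

(** Induction on the largest p + r: differentiating G = sum gives a relation for [step
    l], which has smaller p + r, so its coefficients vanish; what remains is rational,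
    and [li_rat_coef] gives the coefficients of Li_1.  By [coef_step] those of the
    other polylogarithms follow by induction on p. *)
Theorem sLi_independent l (G : L) : li_ok l -> somewhere (fun x => sLi l x = ev G x) ->
  forall k, coef l k = 0.
Proof.
suff H n : forall l (G : L), li_ok l ->
    (forall t : key * C, t \in l -> (t.1.1.1 + t.1.1.2 < n)%N) ->
    somewhere (fun x => sLi l x = ev G x) -> forall k, coef l k = 0.
  move=> ok; apply: (H (\sum_(t <- l) (t.1.1.1 + t.1.1.2)).+1 l G ok) => t ht.
  by rewrite ltnS (big_rem t) //= leq_addr.
elim: n => [|n IHn] {}l {}G ok hn hs.
  by case: l {ok hs} hn => [|t l] hn k; [rewrite /coef big_nil | have := hn t (mem_head _ _)].
have hd : somewhere (fun x => sLi (step l) x = ev (dL G - tsum L (li_rat l)) x).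
  have h1 := somewhere_derive hs (sLi_derive ok) (ev_derive G).
  have ge : generic (fun x => ev (dL G) x =
      ev (dL G - tsum L (li_rat l)) x + ev (tsum L (li_rat l)) x).
    have := evD (dL G - tsum L (li_rat l)) (tsum L (li_rat l)); rewrite subrK; exact.
  apply: somewhere_sub (generic_somewhere (genericI ge (@generic_neq0 R)) h1) => x [[e x0] h2].
  have := congr1 (fun z => z * x) h2; rewrite !divfK // e; exact: addIr.
have ok' := step_ok ok.
have c0 : forall k, coef (step l) k = 0.
  apply: (IHn _ _ ok' _ hd) => u /flattenP [s /mapP [t /[dup] ht /ok [p0 _] ->]].
  have := hn t ht; rewrite /step1 mem_cat; case: t {ht} p0 => [[[p r] la] b] /=.
  case: r => [|r]; case: p => [|[|p]] //= _ hh; rewrite ?inE ?in_nil ?orbF //=;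
    try (by move/eqP=> -> /=; lia).
  by case/orP => /eqP -> /=; lia.
have e0 : dL G - tsum L (li_rat l) = 0.
  apply: (@ev_somewhere0 R L); apply: somewhere_sub hd => x.
  by rewrite (sLi_coef0 c0) => <-.
have c1 := @li_rat_coef _ L l (- G) ok.
have {}c1 : forall r la, coef l (1%N, r, la) = 0.
  by apply: c1; rewrite dLN -[RHS]oppr0 -e0 opprB addrC.
case=> [[p r] la]; elim: p r => [|[|p] IHp] r.
- rewrite /coef big_seq_cond big_pred0 // => t; apply/negbTE/negP.
  by move=> /andP[/ok [h _] /eqP e]; move: h; rewrite e.
- exact: c1.
- have := @coef_step _ l p.+1 r la ok isT.
  by rewrite c0 IHp mulr0 add0r.
Qed.

End Polylogs.

(** * The derivative of an expression *)

Section ValueDerivative.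
Variables (R : realType) (Ei : CC R -> CC R) (Li : nat -> CC R -> CC R).
Hypotheses (HEi : is_Ei Ei) (HLi : is_polylog Li).
Local Notation C := (CC R).
Local Notation P2 := {poly {poly C}}.
Variable L : fractions P2.
Local Notation "p %:F" := (embed L p).

Definition rL (r : ratfun C) : L := (frac r).1%:F / (frac r).2%:F.

Definition ei_part (s : seq ((int * C) * (C * C))) : L :=
  \sum_(t <- s) cstF L (t.2.1 * Cexp t.2.2 * Cexp t.1.2) * tval L (TEi t.1.1 (t.1.2 / t.1.1%:~R)).

Definition ln_part (s : seq (C * ratfun C)) : L :=
  \sum_(t <- s) cstF L t.1 * (dL (rL t.2) / rL t.2).

(** The rational part of x times the derivative of e. *)
Definition value_rat (e : expression C) : L :=
  ei_part (ei_terms e) + tsum L (li_rat (li_terms e)) + ln_part (ln_terms e)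
  + dL (rL (rat_part e)).

Definition expr_ok (e : expression C) :=
  [/\ forall t, t \in ei_terms e -> t.1.1 != 0, li_ok (li_terms e)
    & forall t, t \in ln_terms e -> (frac t.2).1 != 0].

Lemma evalr_ev (r : ratfun C) : generic (fun x => evalr r x (Cln x) = ev (rL r) x).
Proof. by apply: generic_sub (ev_frac L (frac r).1 (denom_ratioP r)) => x ->. Qed.

Lemma evalr_derive (r : ratfun C) :
  generic (fun x => is_derive x 1 (fun y => evalr r y (Cln y)) (ev (dL (rL r)) x / x)).
Proof.
apply: generic_derive_congr (ev_derive (rL r)) _.
by apply: generic_sub (evalr_ev r).
Qed.

Lemma ev_div (a b : L) : b != 0 -> generic (fun x => ev (a / b) x = ev a x / ev b x).
Proof.
move=> b0; apply: generic_sub (genericI (generic_ev b0) (evM (a / b) b)) => x [h].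
by rewrite divfK // => ->; rewrite mulfK.
Qed.

(** If K is not constant, its values are generically not real, so they avoid the cut
    of Cln; a constant K contributes nothing. *)
Lemma ln_term_derive (K : ratfun C) : (frac K).1 != 0 ->
  generic (fun x => is_derive x 1 (fun y => Cln (evalr K y (Cln y)))
                      (ev (dL (rL K) / rL K) x / x)).
Proof.
move=> n0; have k0 : rL K != 0.
  by rewrite mulf_neq0 ?invr_eq0 ?emb_eq0 ?denom_ratioP.
have [e|d0] := eqVneq (dL (rL K)) 0.
  have [c ec] := dL_eq0 e.
  have h0 : generic (fun x : C => is_derive x 1 (fun _ : C => Cln c) 0).
    by apply: genericT => x; exact: is_derive_cst.
  have h1 : generic (fun x => Cln c = Cln (evalr K x (Cln x))).
    apply: generic_sub (genericI (evalr_ev K) (ev_cst L c)) => x [-> h].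
    by rewrite ec h.
  apply: generic_derive_eq (generic_derive_congr h0 h1) _.
  by apply: generic_sub (ev_cst L 0) => x h; rewrite e mul0r -(cst0 L) h mul0r.
have nr : generic (fun x => cim (evalr K x (Cln x)) != 0).
  apply: (@generic_nonreal R _ (fun x => ev (dL (rL K)) x / x)).
  apply: generic_sub (genericI (evalr_derive K) (genericI (generic_ev d0) (@generic_neq0 R))).
  by move=> x [h [h1 h2]]; split=> //; rewrite mulf_neq0 ?invr_eq0.
apply: generic_sub (genericI (genericI (evalr_derive K) nr)
  (genericI (evalr_ev K) (ev_div (dL (rL K)) k0))) => x [[h1 h2] [h3 h4]].
apply: (is_derive_eq (is_derive_comp h1 (is_derive_Cln h2))).
by rewrite h3 h4; ring.
Qed.

Lemma ei_term_derive (p : int) (la c : C) : p != 0 ->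
  generic (fun x => is_derive x 1 (fun y => c * Ei (p%:~R * Cln y + la))
    (ev (cstF L (c * Cexp la) * tval L (TEi p (la / p%:~R))) x / x)).
Proof.
move=> p0; have pc0 : p%:~R != 0 :> C by rewrite intr_eq0.
apply: generic_derive_eq (derive_scale c (generic_chain (df := fun x => p%:~R / x)
  (dg := fun z => Cexp z / z) (f := fun y => p%:~R * Cln y + la) _)) _.
  apply: generic_sub (genericI (derive_affine_ln p%:~R la) (affine_ln_nonreal la pc0)).
  by move=> x [h1 h2]; split=> //; apply/HEi/nonreal_nle0.
apply: generic_sub (genericI (genericI (evZ (c * Cexp la) (tval L (TEi p (la / p%:~R))))
   (ev_TEi L p (la / p%:~R))) (genericI (@generic_im R) (affine_ln_nonreal la pc0))).
move=> x [[-> ->] [hx /im_neq0 h0]]; rewrite CexpD Cexp_int //.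
have e : Cln x + la / p%:~R = (p%:~R * Cln x + la) / p%:~R by field.
by rewrite e; field; rewrite h0 (im_neq0 hx) pc0.
Qed.

(** The derivative is the sum of polylogarithms [sLi (step ...)] and a rational part.
    *)
Theorem value_derive (e : expression C) : expr_ok e ->
  generic (fun x => is_derive x 1 (value Ei Li e)
    ((sLi Li (step (li_terms e)) x + ev (value_rat e) x) / x)).
Proof.
move=> [ok1 ok2 ok3].
have g1 : generic (fun x => is_derive x 1
    (fun y => \sum_(t <- ei_terms e) (t.2.1 * Cexp t.2.2) * Ei (t.1.1%:~R * Cln y + t.1.2))
    (ev (ei_part (ei_terms e)) x / x)).
  have h := derive_sum_list (s := ei_terms e) (f := fun t y =>
    (t.2.1 * Cexp t.2.2) * Ei (t.1.1%:~R * Cln y + t.1.2))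
    (fun t ht => @ei_term_derive t.1.1 t.1.2 (t.2.1 * Cexp t.2.2) (ok1 t ht)).
  apply: generic_derive_eq h _.
  apply: generic_sub (ev_sum (ei_terms e) (fun t => cstF L (t.2.1 * Cexp t.2.2 * Cexp t.1.2) *
     tval L (TEi t.1.1 (t.1.2 / t.1.1%:~R)))) => x h.
  by rewrite /ei_part h mulr_suml.
have g3 : generic (fun x => is_derive x 1
    (fun y => \sum_(t <- ln_terms e) t.1 * Cln (evalr t.2 y (Cln y)))
    (ev (ln_part (ln_terms e)) x / x)).
  have h := derive_sum_list (s := ln_terms e) (f := fun t y => t.1 * Cln (evalr t.2 y (Cln y)))
    (fun t ht => derive_scale t.1 (ln_term_derive (ok3 t ht))).
  apply: generic_derive_eq h _.
  have hz : generic (fun x => \sum_(t <- ln_terms e) t.1 * (ev (dL (rL t.2) / rL t.2) x / x) =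
     \sum_(t <- ln_terms e) ev (cstF L t.1 * (dL (rL t.2) / rL t.2)) x / x).
    elim: (ln_terms e) => [|t s IHs]; first by apply: genericT => x; rewrite !big_nil.
    apply: generic_sub (genericI IHs (evZ t.1 (dL (rL t.2) / rL t.2))) => x [h1 h2].
    by rewrite !big_cons h1 h2 mulrA.
  apply: generic_sub (genericI hz (ev_sum (ln_terms e)
    (fun t => cstF L t.1 * (dL (rL t.2) / rL t.2)))) => x [-> h1].
  by rewrite /ln_part h1 mulr_suml.
have g2 := sLi_derive HLi L ok2; have g4 := evalr_derive (rat_part e).
have gE : generic (fun x => ev (value_rat e) x = ev (ei_part (ei_terms e)) x
    + ev (tsum L (li_rat (li_terms e))) x + ev (ln_part (ln_terms e)) x
    + ev (dL (rL (rat_part e))) x).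
  rewrite /value_rat; set a := ei_part _; set b := tsum L _; set c := ln_part _; set d := dL _.
  apply: generic_sub (genericI (evD (a + b + c) d) (genericI (evD (a + b) c) (evD a b))).
  by move=> x [-> [-> ->]].
apply: generic_sub (genericI (genericI g1 g2) (genericI (genericI g3 g4) gE)).
move=> x [[h1 h2] [[h3 h4] ->]].
have -> : value Ei Li e =
   (fun y => \sum_(t <- ei_terms e) (t.2.1 * Cexp t.2.2) * Ei (t.1.1%:~R * Cln y + t.1.2))
   + sLi Li (li_terms e) + (fun y => \sum_(t <- ln_terms e) t.1 * Cln (evalr t.2 y (Cln y)))
   + (fun y => evalr (rat_part e) y (Cln y)) by [].
apply: (is_derive_eq (is_deriveD (is_deriveD (is_deriveD h1 h2) h3) h4)); ring.
Qed.

Lemma wf_ok (e : expression C) : wf_expression e -> expr_ok e.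
Proof.
case/and5P => _ /allP h1 _ /allP h2 /andP[_ /allP h3].
by split=> // t /h2 /andP[].
Qed.

(** By [sLi_independent] the polylogarithms of the derivative cancel, and an identity
    on an open set is an identity in L. *)
Theorem integral_rational (e : expression C) (f : ratfun C) :
  expresses_integral Ei Li e f -> (X1 C)%:F * rL f = value_rat e.
Proof.
move=> [/wf_ok ok [U [oU U0] hU]].
have h : somewhere (fun x => sLi Li (step (li_terms e)) x =
    ev ((X1 C)%:F * rL f - value_rat e) x).
  have hs := open_somewhere oU U0 hU.
  have gE := evD ((X1 C)%:F * rL f - value_rat e) (value_rat e).
  apply: somewhere_sub (generic_somewhere (genericI (genericI (value_derive ok) gE)
    (genericI (genericI (evM (X1 C)%:F (rL f)) (ev_emb L (X1 C)))
       (genericI (evalr_ev f) (@generic_neq0 R)))) hs).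
  move=> x [[[h1 h2] [[h3 h4] [h5 x0]]] h6].
  have := is_derive_unique h1 h6; rewrite h5 => /(congr1 (fun z => z * x)).
  rewrite divfK // => h7; move: h2; rewrite subrK h3 h4 evq_X1 [x * _]mulrC -h7.
  by move/addIr.
have okl : li_ok (step (li_terms e)) by case: ok => _ /step_ok.
have c0 := sLi_independent HLi okl h.
apply/eqP; rewrite -subr_eq0; apply/eqP; apply: (@ev_somewhere0 R L).
by apply: somewhere_sub h => x; rewrite (sLi_coef0 Li c0) => <-.
Qed.

Theorem rational_integral (e : expression C) (f : ratfun C) : wf_expression e ->
  (forall k, coef (step (li_terms e)) k = 0) -> (X1 C)%:F * rL f = value_rat e ->
  expresses_integral Ei Li e f.
Proof.
move=> wf c0 eG; split=> //; apply: generic_witness.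
apply: generic_sub (genericI (value_derive (wf_ok wf))
    (genericI (genericI (evM (X1 C)%:F (rL f)) (ev_emb L (X1 C)))
       (genericI (evalr_ev f) (@generic_neq0 R)))).
move=> x [h1 [[h2 h3] [h4 x0]]]; apply: (is_derive_eq h1).
rewrite (sLi_coef0 Li c0) add0r -eG h2 h3 evq_X1 h4 mulrC mulKf //.
Qed.

End ValueDerivative.

(** * Correctness of the algorithm *)

Section Answer.
Variable R : realType.
Local Notation C := (CC R).
Local Notation P2 := {poly {poly C}}.
Variable L : fractions P2.
Local Notation "p %:F" := (embed L p).
Implicit Types (o : outs C) (Q : P2).

Lemma frac_Ratio (n d : P2) : d != 0 -> frac (Ratio n d) = (n, d).
Proof. by move=> d0; rewrite /Ratio insubdK. Qed.

Lemma rL_Ratio (n d : P2) : d != 0 -> rL L (Ratio n d) = n%:F / d%:F.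
Proof. by move=> d0; rewrite /rL frac_Ratio. Qed.

Lemma zsgn_neq0 k : zsgn k != 0.
Proof. by case: k => [[] n]; rewrite /zsgn //= oppr_eq0. Qed.

Lemma zsgn_inj : injective zsgn.
Proof.
move=> [b n] [b' n']; rewrite /zsgn /=; case: b b' => [] [] //.
- by move=> [->].
- by move=> /oppr_inj [->].
Qed.

Lemma ln_prod_neq0 (l : seq (P2 * C)) t : (forall u, u \in l -> u.1 != 0) ->
  t \in collect_ln l -> t.2 != 0.
Proof.
move=> h /mapP [c _ ->] /=; rewrite big_filter prodf_seq_neq0.
by apply/allP => u /h hu; apply/implyP.
Qed.

(** Collected lists have distinct keys, and p, p mu determine p, mu because p is not
    0. *)
Lemma wf_expr_of o Q : out_ok o -> wf_expression (expr_of o Q).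
Proof.
move=> [ok _ g0]; apply/and5P; split => /=.
- rewrite -map_comp; have := collect_uniq o.1.1.
  have inj : injective (fun k : eikey C => (zsgn k.1, (zsgn k.1)%:~R * k.2) : int * C).
    move=> [k mu] [k' mu'] /= [e]; rewrite (zsgn_inj e) => /mulfI ->//.
    by rewrite intr_eq0 zsgn_neq0.
  by rewrite -(map_inj_uniq inj) -map_comp.
- by apply/allP => t /mapP [u _ ->]; exact: zsgn_neq0.
- exact: collect_uniq.
- by apply/allP => t /collect_keys [t' /ok h <-]; apply/andP.
- apply/andP; split.
    by rewrite -map_comp /collect_ln -map_comp map_id undup_uniq.
  apply/allP => t /mapP [u hu ->] /=; rewrite frac_Ratio ?oner_neq0 //=.
  exact: ln_prod_neq0 hu.
Qed.

Lemma ei_part_expr_of o Q : ei_part L (ei_terms (expr_of o Q)) = eival L o.1.1.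
Proof.
rewrite /ei_part /= big_map -[RHS](sum_collect (L := L) (fun k : eikey C => tval L (TEi (zsgn k.1) k.2))).
apply: eq_bigr => t _ /=; have z0 : (zsgn t.1.1)%:~R != 0 :> C by rewrite intr_eq0 zsgn_neq0.
rewrite mulrAC -mulrA -CexpD addrN Cexp0 mulr1.
by rewrite [_ * t.1.2]mulrC mulfK.
Qed.

Lemma ln_part_expr_of o Q : (forall t, t \in o.2.1 -> t.1 != 0) ->
  ln_part L (ln_terms (expr_of o Q)) = lgval L o.2.1.
Proof.
move=> g0; rewrite /ln_part /= big_map /lgval -[RHS](sum_undup_keys (fun t => t.2)).
rewrite big_map; apply: eq_bigr => c _ /=.
set r := [seq t <- o.2.1 | t.2 == c].
have r0 g : g \in [seq t.1 | t <- r] -> g != 0.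
  by move=> /mapP [t]; rewrite mem_filter => /andP[_ /g0 h] ->.
have e : \prod_(t <- r) t.1 = \prod_(g <- [seq t.1 | t <- r]) g by rewrite big_map.
rewrite rL_Ratio ?oner_neq0 // e logderiv ?oner_neq0 //; last first.
  by rewrite prodf_seq_neq0; apply/allP => g /r0.
rewrite (logd_prod L r0) logd1 subr0 big_map mulr_sumr /r big_filter.
by apply: eq_bigr => t /eqP ->.
Qed.

Lemma li_part_expr_of o Q : tsum L (li_rat (li_terms (expr_of o Q))) = tsum L (li_rat o.1.2).
Proof.
rewrite !li_ratE /=; exact: (sum_collect (L := L) (fun k : likey C =>
  if k.1.1 == 1%N then - tval L (TLi k.1.2 k.2^-1) else 0)).
Qed.

Lemma value_rat_expr_of o Q : Q != 0 -> out_ok o -> value_rat L (expr_of o Q) = oval L Q o.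
Proof.
move=> Q0 [_ _ g0]; rewrite /value_rat ei_part_expr_of li_part_expr_of ln_part_expr_of //.
by rewrite /= rL_Ratio.
Qed.

Lemma step_expr_of o Q : out_ok o -> forall k, coef (step (li_terms (expr_of o Q))) k = 0.
Proof.
move=> [ok null _] [[p r] la] /=; have okc : li_ok (collect o.1.2).
  by move=> t /collect_keys [t' /ok h <-].
case: p => [|p].
  rewrite /coef big_seq_cond big_pred0 // => t; apply/negbTE/negP => /andP[/(step_ok okc) [h _]].
  by move=> /eqP e; rewrite e in h.
by rewrite coef_step // !coef_collect null.
Qed.

(** Each part of the derivative of an answer is a term, up to constants; logarithms
    are reduced to irreducible polynomials by [rep_logd]. *)
Lemma rep_value_rat (e : expression C) : wf_expression e -> representable (value_rat L e).
Proof.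
move=> /wf_ok [ok1 ok2 ok3]; rewrite /value_rat; apply: repD; last exact: rep_dL.
apply: repD; first apply: repD.
- by apply: rep_sum => t _; apply/repZ/rep_term.
- by exists 0, (li_rat (li_terms e)); rewrite dL0 add0r; split=> //; apply: li_rat_ok.
- apply: rep_sum => t /ok3 h; apply: repZ.
  rewrite /rL logderiv ?denom_ratioP //; rewrite -[- _]mulN1r -(cst1 L) -raddfN.
  by apply: repD; [|apply: repZ]; apply: rep_logd => //; exact: denom_ratioP.
Qed.

(** Soundness: when the right-hand side is reduced to 0, [row_ok] says that x f is
    [value_rat] of the answer.  Completeness: an integral gives a bounded identity,
    hence a combination of rows equal to the right-hand side, which the elimination
    reduces to 0. *)
Theorem integrate_ln_correct (f : ratfun C) c (s : seq P2) (Ei : C -> C) (Li : nat -> C -> C) :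
  (forall g, g \in s -> irreducible_elt g) -> (frac f).2 = c%:P%:P * \prod_(g <- s) g ->
  is_Ei Ei -> is_polylog Li ->
  ((exists e, expresses_integral Ei Li e f) ->
     exists2 e, integrate_ln (frac f).1 (frac f).2 s = Some e & expresses_integral Ei Li e f) /\
  (~ (exists e, expresses_integral Ei Li e f) -> integrate_ln (frac f).1 (frac f).2 s = None).
Proof.
set A := (frac f).1; set B := (frac f).2 => irrs eB HEi HLi.
have B0 : B != 0 := denom_ratioP f.
pose Q := X1 C ^+ bound A B * B.
pose T : L := embed L (X1 C) * embed L A / embed L B.
have eT : T = embed L (X1 C) * rL L f by rewrite /T /rL mulrA.
have Q0 : Q != 0 := denom_neq0 A B0.
have [D [rs [D0 [ok val] span solved]]] :=
  solve_items_spec (target_ok L Q A B0) (fun it => items_of_ok L B0 irrs (it := it)).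
have sound : (solve_items (items_of A B s)).1 = 0 -> expresses_integral Ei Li
    (expr_of (osub 1 (no_out _) (solve_items (items_of A B s)).2) Q) f.
  move=> z; set o := osub _ _ _.
  have oko : out_ok o by apply: out_ok_osub => //; split=> //; exact: li_null0.
  apply: (rational_integral HEi HLi (L := L)) => //; first exact: wf_expr_of.
    exact: step_expr_of.
  rewrite value_rat_expr_of // -eT /o oval_osub cst1 mul1r.
  move: val; rewrite -/(items_of A B s) z emb0 => /esym/eqP.
  rewrite mulf_eq0 emb_eq0 (negPf D0) /= addr_eq0 /T => /eqP ->.
  by rewrite /oval eival0 lgval0 li_rat0 frac0 !addr0 sub0r.
have complete : (exists e, expresses_integral Ei Li e f) ->
    (solve_items (items_of A B s)).1 = 0.
  move=> [e he]; apply: solved => /=.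
  have [H [l [okl el]]] := rep_value_rat he.1.
  have eT2 : T = dL H + tsum L l by rewrite -el eT (integral_rational HEi HLi L he).
  have [b1 b2 b3 b4] := bound_size A B.
  have [N [l' [n1 n2 n3 n4 n5]]] := bounded_solution B0 okl b1 b2 b3 b4 eT2.
  by rewrite embM -/T [T]n5; apply: (span_all B0 irrs eB).
rewrite /integrate_ln; split=> [/complete z|h].
  by rewrite z eqxx; eexists; [reflexivity | exact: sound].
by case: eqP => // /sound h2; case: h; eexists; exact: h2.
Qed.

End Answer.

Theorem mainTheorem5 (R : realType) :
  exists IntegrateLnFoliation : prog,
  forall factor : data (CC R) -> data (CC R), factorization_oracle factor ->
  forall f : ratfun (CC R),
  exists result : option (expression (CC R)),
    exec factor IntegrateLnFoliation (enc_ratfun f) (enc_result result) /\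
    forall (Ei : CC R -> CC R) (Li : nat -> CC R -> CC R),
      is_Ei Ei -> is_polylog Li ->
      ((exists e, expresses_integral Ei Li e f) ->
         exists2 e, result = Some e & expresses_integral Ei Li e f) /\
      (~ (exists e, expresses_integral Ei Li e f) -> result = None).
Proof.
have [p hp] := integrate_ln_program (CC R).
exists p => factor oracle f; have B0 := denom_ratioP f.
have [c [s [hs irrs eB]]] := oracle _ B0.
exists (integrate_ln (frac f).1 (frac f).2 s); split; first exact: hp.
move=> Ei Li; exact: (@integrate_ln_correct R (fractions_of {poly {poly CC R}}) f c s Ei Li irrs eB).
Qed.
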